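(* Let $\psi\in\mathbb{Q}\setminus\{0,1\}$ and let $X_{\psi}\subset\mathbb{P}^3$ be the quartic surface $$x_0^3x_1+x_1^3x_2+x_2^4+x_3^4-36\psi\,x_0x_1x_2x_3=0.$$ Put $t=2^{-48}3^{-30}7^{-7}\psi^{-36}$, $$\bm{\alpha}=\left\{\tfrac{k}{36}:1\le k\le 35,\ \gcd(k,6)=1\right\}\cup\left\{\tfrac{k}{18}:k\in\{1,5,7,11,13,17\}\right\},$$ $$\bm{\beta}=\left\{\tfrac{j}{8}:1\le j\le 7\right\}\cup\left\{\tfrac{j}{7}:1\le j\le 6\right\}\cup\left\{\tfrac13,\tfrac23,1,1,1\right\}.$$ Let $S$ be the set consisting of $2,3,7$ together with all primes dividing the numerator or denominator of $t$ or of $t-1$. Then $$L_S(X_{\psi},s)=L_S(\mathbb{Q}(\zeta_8)\mid\mathbb{Q},s-1)\,L_S\big(H(\bm{\alpha},\bm{\beta}\mid t),s\big).$$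
   Context: Gauss sums: for a power $q=p^u$ of an odd prime $p$, write $q^\times=q-1$, fix a generator $\omega$ of the cyclic group of multiplicative characters $\mathbb{F}_q^\times\to\mathbb{C}^\times$ and a nontrivial additive character $\Theta$ of $\mathbb{F}_q$, and set $g(m)=\sum_{x\in\mathbb{F}_q^\times}\omega^m(x)\Theta(x)$. Finite field hypergeometric sums: for multisets $\bm{\alpha},\bm{\beta}$ of $d$ rationals with $\alpha_i-\beta_j\notin\mathbb{Z}$, put $F(x)=\prod_i(x-e^{2\pi i\alpha_i})$, $G(x)=\prod_i(x-e^{2\pi i\beta_i})$. If $F,G\in\mathbb{Q}[x]$ (defined over $\mathbb{Q}$), write $F/G=\prod_{j=1}^r(x^{p_j}-1)/\prod_{j=1}^s(x^{q_j}-1)$ with $\{p_j\}\cap\{q_j\}=\emptyset$. $q$ is good if $\gcd(q,\mathrm{lcd}(\bm{\alpha}\cup\bm{\beta}))=1$. Let $D(x)=\gcd(\prod(x^{p_j}-1),\prod(x^{q_j}-1))$, $\epsilon=(-1)^{\sum q_j}$, $M=\prod p_j^{p_j}\prod q_j^{-q_j}$, $s(m)$ the multiplicity of $e^{2\pi im/q^\times}$ as a root of $D$. For $t\in\mathbb{F}_q^\times$, $H_q(\bm{\alpha},\bm{\beta}\mid t)=\frac{(-1)^{r+s}}{1-q}\sum_{m=0}^{q-2}q^{-s(0)+s(m)}\prod_{i=1}^r g(p_im)\prod_{i=1}^s g(-q_im)\,\omega(\epsilon M^{-1}t)^m.$ $L$-functions: for $p\notin S$ define $P_p(T)$ by $\exp\big(\sum_{m\ge1}\#X_\psi(\mathbb{F}_{p^m})T^m/m\big)=1/((1-T)(1-pT)(1-p^2T)P_p(T))$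 and $L_S(X_\psi,s)=\prod_{p\notin S}P_p(p^{-s})^{-1}$. For a pair defined over $\mathbb{Q}$, $L_p(H(\bm{\alpha},\bm{\beta}\mid t),T)=\exp(-\sum_{r\ge1}H_{p^r}(\bm{\alpha},\bm{\beta}\mid t)T^r/r)$ ($t$ reduced mod $p$) and $L_S(H(\bm{\alpha},\bm{\beta}\mid t),s)=\prod_{p\notin S}L_p(H(\bm{\alpha},\bm{\beta}\mid t),p^{-s})^{-1}$. For a number field $K$, $L_S(K\mid\mathbb{Q},s)=\zeta_{S,K}(s)/\zeta_S(s)$, where $\zeta_S(s)=\prod_{p\notin S}(1-p^{-s})^{-1}$ and $\zeta_{S,K}(s)=\prod_{\mathfrak{p}}(1-\mathrm{N}\mathfrak{p}^{-s})^{-1}$ over primes of $K$ not above $S$. *)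

(* Defs.v *)
From HB Require Import structures.
From mathcomp Require Import all_boot all_order all_algebra all_field.
From mathcomp Require Import finmap complex.
From mathcomp Require Import all_classical all_reals all_analysis.
Import Order.TTheory GRing.Theory Num.Theory numFieldNormedType.Exports.

Set Implicit Arguments.
Unset Strict Implicit.
Unset Printing Implicit Defensive.

Local Open Scope ring_scope.
Local Open Scope complex_scope.

(* Limits in the complex plane; as usual for [lim], the value of a divergent
   limit is the default point 0. *)
Definition limC (R : realType) (u : nat -> R[i]) : R[i] :=
  lim ((u : nat -> R[i]^o) @ \oo)%classic.

Definition expC (R : realType) (z : R[i]) : R[i] :=
  (expR (complex.Re z))%:C * (cos (complex.Im z) +i* sin (complex.Im z)).

Definition natpowC (R : realType) (n : nat) (s : R[i]) : R[i] :=
  expC (s * (ln (n%:R : R))%:C).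

Definition seriesC (R : realType) (a : nat -> R[i]) : R[i] :=
  limC (fun n => \sum_(1 <= m < n) a m).

Definition euler_product (R : realType) (S : pred nat) (f : nat -> R[i]) : R[i] :=
  limC (fun n => \prod_(0 <= p < n | prime p && ~~ S p) f p).

(* Multiplicative characters of F are functions on F whose value at 0 is
   irrelevant. *)
Definition mult_char (R : realType) (F : finFieldType) (chi : F -> R[i]) : Prop :=
  chi 1 = 1 /\
  forall x y : F, x != 0 -> y != 0 -> chi (x * y) = chi x * chi y.

Definition mult_char_generator (R : realType) (F : finFieldType)
    (omega : F -> R[i]) : Prop :=
  mult_char omega /\
  forall chi : F -> R[i], mult_char chi ->
    exists k : nat, forall x : F, x != 0 -> chi x = omega x ^+ k.

Definition nontrivial_add_char (R : realType) (F : finFieldType)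
    (Theta : F -> R[i]) : Prop :=
  [/\ Theta 0 = 1,
      forall x y : F, Theta (x + y) = Theta x * Theta y
    & exists x : F, Theta x != 1].

Definition gauss_sum (R : realType) (F : finFieldType) (omega Theta : F -> R[i])
    (m : int) : R[i] :=
  \sum_(x : F | x != 0) omega x ^ m * Theta x.

Definition root1C (R : realType) (a : rat) : R[i] :=
  expC (0 +i* (2 * pi * ratr a)).

Definition param_poly (R : realType) (l : seq rat) : {poly R[i]} :=
  \prod_(a <- l) ('X - (root1C R a)%:P).

Definition prod_Xn1 (R : realType) (l : seq nat) : {poly R[i]} :=
  \prod_(n <- l) ('X^n - 1).

(* F/G = prod_j (X^(p_j) - 1) / prod_j (X^(q_j) - 1) with disjoint exponents;
   cross-multiplied, all polynomials being nonzero. *)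
Definition is_cyclotomic_data (R : realType) (alpha beta : seq rat)
    (pq : seq nat * seq nat) : Prop :=
  [/\ all (ltn 0%N) pq.1, all (ltn 0%N) pq.2, ~~ has (mem pq.1) pq.2
    & param_poly R alpha * prod_Xn1 R pq.2 = param_poly R beta * prod_Xn1 R pq.1].

(* Such (p_j), (q_j) exist when the pair is defined over Q, and are then unique
   up to order. *)
Definition cyclotomic_data (R : realType) (alpha beta : seq rat) :
    seq nat * seq nat :=
  xget ([::], [::]) [set pq | is_cyclotomic_data R alpha beta pq]%classic.

Definition hyp_sum (R : realType) (F : finFieldType) (omega Theta : F -> R[i])
    (alpha beta : seq rat) (t : F) : R[i] :=
  let q := #|F| in
  let ps := (cyclotomic_data R alpha beta).1 in
  let qs := (cyclotomic_data R alpha beta).2 in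
  let D := gcdp (prod_Xn1 R ps) (prod_Xn1 R qs) in
  let mult (m : nat) := mup (root1C R (m%:Q / q.-1%:Q)) D in
  let eps : rat := (-1) ^+ (\sum_(n <- qs) n)%N in
  let M : rat := \prod_(n <- ps) n%:Q ^+ n / \prod_(n <- qs) n%:Q ^+ n in
  let g := gauss_sum omega Theta in
  (-1) ^+ (size ps + size qs) / (1 - q%:R) *
  \sum_(0 <= m < q.-1)
    q%:R ^ ((mult m)%:Z - (mult 0%N)%:Z) *
    \prod_(n <- ps) g (n%:Z * m%:Z) *
    \prod_(n <- qs) g (- n%:Z * m%:Z) *
    omega (ratr (eps * M^-1) * t) ^+ m.

(* The value at T of the series P_p(T) attached to the point counts
   N m = #X(F_(p^m)) of a surface, for T in the disc of convergence of
   sum_m N m T^m / m. *)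
Definition surface_factor (R : realType) (N : nat -> nat) (p : nat) (T : R[i]) :
    R[i] :=
  ((1 - T) * (1 - p%:R * T) * (1 - p%:R ^+ 2 * T) *
   expC (seriesC (fun m => (N m)%:R * T ^+ m / m%:R)))^-1.

Definition L_surface (R : realType) (S : pred nat) (N : nat -> nat -> nat)
    (s : R[i]) : R[i] :=
  euler_product S (fun p => (surface_factor (N p) p (natpowC p (- s)))^-1).

Definition hyp_factor (R : realType) (F : nat -> finFieldType)
    (omega Theta : forall r, F r -> R[i]) (alpha beta : seq rat) (t : rat)
    (T : R[i]) : R[i] :=
  expC (- seriesC (fun r =>
    hyp_sum (omega r) (Theta r) alpha beta (ratr t) * T ^+ r / r%:R)).

Definition L_hyp (R : realType) (S : pred nat) (Fq : nat -> nat -> finFieldType)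
    (omega Theta : forall p r, Fq p r -> R[i]) (alpha beta : seq rat) (t : rat)
    (s : R[i]) : R[i] :=
  euler_product S (fun p =>
    (hyp_factor (omega p) (Theta p) alpha beta t (natpowC p (- s)))^-1).

Definition ring_of_integers (K : fieldExtType rat) : set K :=
  [set x | integralOver (fun z : int => z%:~R : K) x]%classic.

Arguments ring_of_integers : clear implicits.

Definition prime_ideal (K : fieldExtType rat) (P : set K) : Prop :=
  let O := ring_of_integers K in
  [/\ (P `<=` O)%classic,
      P 0 /\ (forall x y, P x -> P y -> P (x - y)),
      forall a x, O a -> P x -> P (a * x),
      ~ P 1 /\ (forall a b, O a -> O b -> P (a * b) -> P a \/ P b)
    & exists2 x, P x & x != 0].

(* The number of cosets of P in the ring of integers. *)
Definition ideal_norm (K : fieldExtType rat) (P : set K) : nat :=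
  #|` fset_set [set [set y + x | x in P] | y in ring_of_integers K]%classic |.

Definition primes_above (K : fieldExtType rat) (p : nat) : set (set K) :=
  [set P | prime_ideal P /\ P p%:R]%classic.

Arguments primes_above : clear implicits.

Definition zetaS (R : realType) (S : pred nat) (s : R[i]) : R[i] :=
  euler_product S (fun p => (1 - natpowC p (- s))^-1).

(* The product over the primes of K not above S, grouped by the rational prime
   below (the product converges absolutely for Re s > 1). *)
Definition zetaSK (R : realType) (S : pred nat) (K : fieldExtType rat)
    (s : R[i]) : R[i] :=
  euler_product S (fun p =>
    \big[*%R/1]_(P \in primes_above K p) (1 - natpowC (ideal_norm P) (- s))^-1).

Definition L_rel (R : realType) (S : pred nat) (K : fieldExtType rat)
    (s : R[i]) : R[i] :=
  zetaSK S K s / zetaS S s.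

Definition quartic (F : finFieldType) (psi : F) (x : 'rV[F]_4) : F :=
  let x0 := x 0 0 in let x1 := x 0 1 in let x2 := x 0 2 in let x3 := x 0 3 in
  x0 ^+ 3 * x1 + x1 ^+ 3 * x2 + x2 ^+ 4 + x3 ^+ 4
  - 36 * psi * x0 * x1 * x2 * x3.

(* Points of projective 3-space over F are the orbits of nonzero vectors under
   the nonzero scalars. *)
Definition num_points (F : finFieldType) (psi : F) : nat :=
  #|[set [set a *: x | a : F & a != 0]
      | x : 'rV[F]_4 & (x != 0) && (quartic psi x == 0)]%SET|.

Definition alpha : seq rat :=
  [seq k%:Q / 36 | k : nat <- iota 1 35 & coprime k 6] ++
  [seq k%:Q / 18 | k : nat <- [:: 1; 5; 7; 11; 13; 17]%N].

Definition beta : seq rat :=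
  [seq j%:Q / 8 | j : nat <- iota 1 7] ++ [seq j%:Q / 7 | j : nat <- iota 1 6] ++
  [:: 1 / 3; 2 / 3; 1; 1; 1].

Definition param_t (psi : rat) : rat :=
  2 ^- 48 * 3 ^- 30 * 7 ^- 7 * psi ^- 36.

Definition bad_primes (t : rat) : pred nat := fun p =>
  prime p && ((p \in [:: 2; 3; 7]%N) ||
              has (fun z : int => p %| `|z|)%N
                [:: numq t; denq t; numq (t - 1); denq (t - 1)]).

(* Main.v *)
(** The hypergeometric data are [p = (36)], [q = (12, 9, 8, 7)], so that
    [M^-1 t = (36 psi)^-36].  By orthogonality of multiplicative characters a sum
    over [m] of products of Gauss sums [g(36m) g(-12m) g(-9m) g(-8m) g(-7m)] is a
    sum of the additive character over a monomial subvariety of a torus; the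
    exponents (12, 8, 7, 9; -36) span the kernel of the exponent matrix of the
    quartic, whence this subvariety is parametrised by the monomials of the
    quartic.  The terms with [s(m) = 1] are the torsion terms [9m = 0] and
    [12m = 0], and in the same way they count the points of the faces [x3 = 0] and
    [x0 = 0].  This gives, for good [q],
      [#X_psi(F_q) = 1 + q^2 + c q + H_q(t)],  [c = #{u : u^4 = -1}].
    Since [c = 2 (1 + eps^m)] for [q = p^m], where [eps] is 1 if [p = 1 mod 8] and
    -1 otherwise, summing over [m] yields the Euler factor of [Q(zeta_8)]; primes
    of [Q(zeta_8)] above [p] are the kernels of the reductions
    [zeta_8 |-> r^j], [r] a primitive 8-th root of unity in characteristic [p].
    Only the zeta products need to be shown convergent and nonzero: a divergent
    limit has value 0, so both sides are equal even if the product for [H]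
    diverges. *)
Require Import Defs.
From HB Require Import structures.
From mathcomp Require Import all_boot all_order all_algebra all_field.
From mathcomp Require Import finmap complex.
From mathcomp Require Import all_classical all_reals all_analysis.
From mathcomp Require cyclic.
From mathcomp Require Import ring lra zify.
Import Order.TTheory GRing.Theory Num.Theory numFieldNormedType.Exports.
Set Implicit Arguments.
Unset Strict Implicit.
Unset Printing Implicit Defensive.
Local Open Scope ring_scope.
Local Open Scope complex_scope.

(** * Roots of unity and cyclotomic data *)

(** The weight $q^{s(m)-1}$ equals $(1+(q-1)s(m))/q$, so $H_q$ splits into the full sum over $m$ and
    $q-1$ times the torsion part. In the chart $x_2=1$ the full sum sees only the torus
    $x_0x_1x_3\ne0$. Inclusion-exclusion over $12m=0$, $9m=0$ and $3m=0$ supplies the two faces and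
    the edge $x_0=x_3=0$. The face $x_1=0$, where $x_0$ is free, gives the $cq$ points, and the
    plane $x_2=0$ gives $q+1$.

    The ring of integers of $K$ is never identified with $\mathbb{Z}[\zeta_8]$. It suffices that,
    for each good $p$, an integral element has a denominator prime to $p$ over
    $\mathbb{Z}[\zeta_8]$. This rests on $X^4+1$ having four distinct roots in a field of
    characteristic $p$ that contains a primitive 8-th root of unity. Every reduction is then
    evaluation of one integer polynomial, at $\zeta_8$ and at $r^j$.

    No estimate of $H_q$ enters. Its local series converges because the series of point counts does,
    by the trivial bound of order $q^2$; this is where $\mathrm{Re}\,s>2$ is used. *)

Section Exp.
Variable R : realType.
Implicit Types z w : R[i].

Lemma expC0 : expC (0 : R[i]) = 1.
Proof. by rewrite /expC /= expR0 cos0 sin0 mul1r. Qed.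

Lemma expCD z w : expC (z + w) = expC z * expC w.
Proof.
rewrite /expC raddfD /= raddfD /= expRD cosD sinD.
apply/eqP; rewrite eq_complex /=; apply/andP; split; apply/eqP; ring.
Qed.

Lemma expC_neq0 z : expC z != 0.
Proof.
apply/eqP => h; have := expCD z (- z); rewrite subrr expC0 h mul0r.
by move/eqP; rewrite oner_eq0.
Qed.

Lemma expCN z : expC (- z) = (expC z)^-1.
Proof.
apply: (mulfI (expC_neq0 z)).
by rewrite -expCD subrr expC0 mulfV // expC_neq0.
Qed.

Lemma expCMn z n : expC (n%:R * z) = expC z ^+ n.
Proof.
elim: n => [|n ih]; first by rewrite mul0r expC0 expr0.
by rewrite exprS -ih -expCD -natr1 mulrDl mul1r addrC.
Qed.

Lemma norm_expC z : `|expC z| = (expR (complex.Re z))%:C.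
Proof.
rewrite /expC normrM; set u := (_ +i* _).
have -> : `|u| = 1.
  by rewrite /u normc_def /= cos2Dsin2 sqrtr1.
by rewrite mulr1 normc_def /= expr0n /= addr0 sqrtr_sqr ger0_norm // expR_ge0.
Qed.

Lemma root1CD a b : Defs.root1C R (a + b) = Defs.root1C R a * Defs.root1C R b.
Proof.
rewrite /Defs.root1C -expCD; congr expC.
by apply/eqP; rewrite eq_complex /= rmorphD /= addr0 mulrDr !eqxx.
Qed.

Lemma root1CX (a : rat) n : Defs.root1C R a ^+ n = Defs.root1C R (n%:R * a).
Proof.
elim: n => [|n ih].
  by rewrite mul0r expr0 /Defs.root1C rmorph0 mulr0 expC0.
by rewrite exprS ih -root1CD -natr1 mulrDl mul1r addrC.
Qed.

Lemma root1C_int n : Defs.root1C R n%:R = 1.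
Proof.
rewrite -[n%:R]mulr1 -root1CX /Defs.root1C rmorph1 mulr1 /expC /= expR0 mul1r.
by rewrite mulr_natl cos2pi sin2pi expr1n.
Qed.

(** Halving the angle turns $\cos(2\pi a)=1$ into $\sin(\pi a)=0$, which is impossible for $0<\pi
    a<\pi$. *)
Lemma root1C_neq1 (a : rat) : 0 < a < 1 -> Defs.root1C R a != 1.
Proof.
move=> /andP[a0 a1]; rewrite /Defs.root1C /expC /= expR0 mul1r.
apply/eqP => -[+ _].
have -> : 2 * pi * ratr a = (pi * ratr a : R) *+ 2 by rewrite mulr2n; ring.
rewrite cos_mulr2n cos2sin2 => h.
have : 0 < sin (pi * ratr a : R).
  have ra0 : 0 < ratr a :> R by rewrite ltr0q.
  have ra1 : ratr a < 1 :> R by rewrite -(rmorph1 (@ratr R)) ltr_rat.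
  apply: sin_gt0_pi; rewrite mulr_gt0 ?pi_gt0 //=.
  by rewrite -[X in _ < X]mulr1 ltr_pM2l // pi_gt0.
move=> s0; have : sin (pi * ratr a : R) ^+ 2 = 0 by lra.
by move/eqP; rewrite sqrf_eq0 gt_eqF.
Qed.

Lemma root1C_eq1 (m n : nat) : (0 < n)%N ->
  (Defs.root1C R (m%:R / n%:R) == 1) = (n %| m)%N.
Proof.
move=> n0; have n0q : (n%:R : rat) != 0 by rewrite pnatr_eq0 -lt0n.
rewrite [in LHS](divn_eq m n) natrD natrM mulrDl mulfK // root1CD root1C_int mul1r.
have [m0|m0] := posnP (m %% n)%N.
  by rewrite m0 mul0r (root1C_int 0) eqxx /dvdn m0.
have -> : (n %| m)%N = false by apply/negbTE; rewrite /dvdn -lt0n.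
apply/negbTE/root1C_neq1.
rewrite divr_gt0 ?ltr0n //= ltr_pdivrMr ?ltr0n // mul1r ltr_nat.
exact: ltn_pmod.
Qed.

Lemma root1C_exp_eq1 (m n k : nat) : (0 < n)%N ->
  (Defs.root1C R (m%:R / n%:R) ^+ k == 1) = (n %| k * m)%N.
Proof. by move=> n0; rewrite root1CX mulrA -natrM root1C_eq1. Qed.

Lemma root1C_prim n : (0 < n)%N -> n.-primitive_root (Defs.root1C R n%:R^-1).
Proof.
move=> n0; apply/andP; split => //.
apply/forallP => i; rewrite unity_rootE.
have -> : Defs.root1C R n%:R^-1 = Defs.root1C R (1%:R / n%:R) by rewrite mul1r.
rewrite root1C_exp_eq1 // muln1 eqn_leq ltn_ord /=.
apply/eqP; apply/idP/idP => [h|h]; first by rewrite dvdn_leq.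
by have -> : i.+1 = n by apply/eqP; rewrite eqn_leq h ltn_ord.
Qed.

End Exp.

Section CyclotomicData.
Variable R : realType.
Implicit Types (l : seq nat) (x : R[i]).

Lemma Xn1_neq0 n : (0 < n)%N -> 'X^n - 1 != 0 :> {poly R[i]}.
Proof. by move=> n0; rewrite -size_poly_eq0 size_XnsubC. Qed.

(** The derivative $nX^{n-1}$ does not vanish at a root of $X^n-1$, so every root is simple. *)
Lemma mup_Xn1 x n : (0 < n)%N -> mup x ('X^n - 1) = (x ^+ n == 1).
Proof.
move=> n0; have rE : root ('X^n - 1) x = (x ^+ n == 1).
  by rewrite /root !hornerE subr_eq0.
have [x1|xn1] := boolP (x ^+ n == 1); last by rewrite mupNroot // rE.
have : ('X - x%:P) %| ('X^n - 1) by rewrite dvdp_XsubCl rE.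
move=> /dvdpP [q qE]; rewrite qE mupMr; first by rewrite -['X - _]expr1 mup_XsubCX eqxx.
have := congr1 (fun p => (p^`()).[x]) qE.
rewrite /= derivB derivXn derivC derivM derivXsubC subr0 mulr1 !hornerE /=.
rewrite subrr mulr0 add0r => h; rewrite rootE -h hornerMn hornerXn -mulr_natl mulf_neq0 //.
  by rewrite pnatr_eq0 -lt0n.
rewrite expf_eq0; apply/negP => /andP[_ /eqP x0].
by move: x1; rewrite x0 expr0n gtn_eqF //= eq_sym oner_eq0.
Qed.

Lemma prod_Xn1_neq0 l : all (ltn 0%N) l -> prod_Xn1 R l != 0.
Proof.
rewrite /prod_Xn1; elim: l => [|n l ih] /=; first by rewrite big_nil oner_eq0.
by case/andP=> n0 /ih h; rewrite big_cons mulf_neq0 // Xn1_neq0.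
Qed.

Lemma mup_prod_Xn1 x l : all (ltn 0%N) l ->
  mup x (prod_Xn1 R l) = count (fun n => x ^+ n == 1) l.
Proof.
elim: l => [|n l ih] /=; first by rewrite /prod_Xn1 big_nil mupNroot // rootC oner_eq0.
case/andP=> n0 l0; have := prod_Xn1_neq0 l0.
by rewrite /prod_Xn1 big_cons => ln0; rewrite mupM ?Xn1_neq0 // mup_Xn1 // -ih.
Qed.

Lemma mup_gcdp x (p q : {poly R[i]}) : p != 0 -> q != 0 ->
  mup x (gcdp p q) = minn (mup x p) (mup x q).
Proof.
move=> p0 q0; have g0 : gcdp p q != 0 by rewrite gcdp_eq0 negb_and p0.
apply/eqP; rewrite eqn_leq leq_min; apply/andP; split; last first.
  by rewrite mup_geq // dvdp_gcd -!mup_geq // geq_minl geq_minr.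
have := leqnn (mup x (gcdp p q)).
by rewrite mup_geq // dvdp_gcd -!mup_geq.
Qed.

Lemma prod_Xn1_count l1 l2 : all (ltn 0%N) l1 -> all (ltn 0%N) l2 ->
  prod_Xn1 R l1 = prod_Xn1 R l2 -> forall n, count_mem n l1 = count_mem n l2.
Proof.
move=> h1 h2 e n.
have dvE d : (0 < d)%N -> count (dvdn d) l1 = count (dvdn d) l2.
  move=> d0; have := congr1 (mup (Defs.root1C R (1%:R / d%:R))) e.
  rewrite !mup_prod_Xn1 // => h.
  have E : dvdn d =1 (fun n => Defs.root1C R (1%:R / d%:R) ^+ n == 1).
    by move=> k; rewrite root1C_exp_eq1 // muln1.
  by rewrite (eq_count E) (eq_count E) h.
pose B := (\max_(k <- l1 ++ l2) k)%N.
have Bl k : (k \in l1 ++ l2) -> (k <= B)%N by move=> kl; exact: leq_bigmax_seq.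
have c0 (k : nat) l : k \notin l -> count_mem k l = 0%N by move/count_memPn.
have [n0|npos] := posnP n.
  by rewrite n0 (c0 _ l1) ?(c0 _ l2) //; apply/negP; [move/(allP h2)|move/(allP h1)].
(* the multiplicity of a primitive n-th root of unity counts the multiples of n;
   peel off the proper multiples by descending induction *)
have [m] := ubnP (B - n)%N.
elim: m n npos => // m ih n npos hm.
have [Bn|nB] := ltnP B n.
  rewrite (c0 _ l1) ?(c0 _ l2) //; apply/negP => nl.
    by have := Bl n; rewrite mem_cat nl orbT leqNgt Bn => /(_ isT).
  by have := Bl n; rewrite mem_cat nl leqNgt Bn => /(_ isT).
pose mu l := (\sum_(n.+1 <= k < B.+1) (n %| k) * count_mem k l)%N.
have cE l : {subset l <= l1 ++ l2} -> all (ltn 0%N) l ->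
    count (dvdn n) l = (count_mem n l + mu l)%N.
  move=> + _; rewrite /mu; elim: l => [|a l ihl] sub.
    by rewrite big1 // => k _; rewrite muln0.
  have sub' : {subset l <= l1 ++ l2} by move=> k kl; apply: sub; rewrite inE kl orbT.
  have aB : (a <= B)%N by apply: Bl; apply: sub; rewrite inE eqxx.
  rewrite /= ihl //.
  under [in RHS]eq_bigr do rewrite mulnDr.
  rewrite big_split /=.
  have -> : (\sum_(n.+1 <= k < B.+1) (n %| k) * (a == k) = (n < a) && (n %| a))%N.
    have [na|na] := ltnP n a; last first.
      rewrite big_nat_cond big1 // => k /andP[/andP[nk _] _].
      by rewrite (_ : a == k = false) ?muln0 //; apply/negbTE; lia.
    rewrite (bigD1_seq a) /= ?iota_uniq ?mem_index_iota ?na ?ltnS ?aB //.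
    rewrite eqxx muln1 big1 ?addn0 // => k ka.
    by rewrite eq_sym (negbTE ka) muln0.
  have [->|an] := eqVneq a n; first by rewrite ltnn dvdnn /=; lia.
  have [nda|nda] := boolP (n %| a)%N; last by rewrite andbF; lia.
  have -> : (n < a)%N.
    rewrite ltn_neqAle eq_sym an /=; apply: dvdn_leq nda.
    have : a \in l1 ++ l2 by apply: sub; rewrite inE eqxx.
    by rewrite mem_cat => /orP[/(allP h1)|/(allP h2)].
  by rewrite /=; lia.
have := dvE n npos; rewrite !cE //; try by move=> k kl; rewrite mem_cat kl ?orbT.
have -> : mu l1 = mu l2.
  apply: eq_big_nat => k /andP[nk kB].
  by congr (_ * _)%N; apply: ih; lia.
by move/addIn.
Qed.

(** [cyclotomic_data] is a choice, so concrete data are reached only through uniqueness. Cancelling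
    the parameter polynomials gives equal multiplicities in [q ++ p'] and [p ++ q']; since no
    exponent lies in both [p] and [q], nor in both [p'] and [q'], the two lists can be told
    apart. *)
Lemma cyclotomic_data_uniq a b (pq pq' : seq nat * seq nat) :
  is_cyclotomic_data R a b pq -> is_cyclotomic_data R a b pq' ->
  perm_eq pq.1 pq'.1 /\ perm_eq pq.2 pq'.2.
Proof.
case: pq pq' => [p q] [p' q'] [/= p0 q0 pq e] [/= p0' q0' pq' e'].
have monic_param (l : seq rat) : param_poly R l != 0 by apply/monic_neq0/monic_prod_XsubC.
have H : prod_Xn1 R (q ++ p') = prod_Xn1 R (p ++ q').
  have cat l1 l2 : prod_Xn1 R (l1 ++ l2) = prod_Xn1 R l1 * prod_Xn1 R l2.
    by rewrite /prod_Xn1 big_cat.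
  apply: (mulfI (monic_param a)); apply: (mulfI (monic_param b)).
  rewrite !cat; transitivity ((param_poly R a * prod_Xn1 R q) * (param_poly R b * prod_Xn1 R p')).
    by ring.
  by rewrite e -e'; ring.
have C n := prod_Xn1_count (l1 := q ++ p') (l2 := p ++ q') _ _ H n.
rewrite !all_cat p0 q0 p0' q0' in C.
have D n (l1 l2 : seq nat) : ~~ has (mem l1) l2 -> (count_mem n l1 = 0 \/ count_mem n l2 = 0)%N.
  move=> hh; have [n1|n1] := boolP (n \in l1); last by left; apply/count_memPn.
  by right; apply/count_memPn; apply: contra hh => n2; apply/hasP; exists n.
have E n : count_mem n p = count_mem n p' /\ count_mem n q = count_mem n q'.
  have := C isT isT n; rewrite !count_cat.
  have := D n _ _ pq; have := D n _ _ pq'; lia.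
split.
  by apply/allP => n _; apply/eqP; case: (E n).
by apply/allP => n _; apply/eqP; case: (E n).
Qed.
End CyclotomicData.


(** * The data (36; 12, 9, 8, 7) and the explicit form of the hypergeometric sum *)

Section HypData.
Variable R : realType.

Lemma param_poly_unity n : (0 < n)%N ->
  param_poly R [seq k%:R / n%:R | k <- iota 0 n] = 'X^n - 1.
Proof.
move=> n0; have /factor_Xn_sub_1 <- := root1C_prim R n0.
rewrite /param_poly big_map /index_iota subn0; apply: eq_bigr => k _.
by rewrite root1CX.
Qed.

(** [beta] with each 1 replaced by 0: the roots of unity are the same, and the entries now lie in
    $[0,1)$ like the fractions $k/n$ with $0\le k<n$. *)
Definition beta0 : seq rat :=
  [seq j%:Q / 8 | j : nat <- iota 1 7] ++ [seq j%:Q / 7 | j : nat <- iota 1 6] ++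
  [:: 1 / 3; 2 / 3; 0; 0; 0].

Lemma param_poly_beta0 : param_poly R beta = param_poly R beta0.
Proof.
by rewrite /param_poly /beta /beta0 !big_cat !big_cons (root1C_int R 0) (root1C_int R 1).
Qed.

(** The polynomial identity becomes an equality of multisets of exponents with 54 elements each,
    decided by evaluation. *)
Lemma alpha_beta_perm :
  perm_eq (alpha ++ flatten [seq [seq k%:R / n%:R | k <- iota 0 n] | n <- [:: 12; 9; 8; 7]%N])
          (beta0 ++ [seq k%:R / 36%:R | k <- iota 0 36]).
Proof. by vm_compute. Qed.

Lemma cyclotomic_data36 : is_cyclotomic_data R alpha beta ([:: 36], [:: 12; 9; 8; 7])%N.
Proof.
split => //=; rewrite param_poly_beta0 /prod_Xn1 !big_cons !big_nil.
rewrite -!param_poly_unity // !mulr1.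
rewrite /param_poly -!big_cat /=; apply: perm_big.
by have := alpha_beta_perm; rewrite /= ?cats0.
Qed.

Lemma cyclotomic_data_spec :
  (cyclotomic_data R alpha beta).1 = [:: 36]%N /\
  perm_eq (cyclotomic_data R alpha beta).2 [:: 12; 9; 8; 7]%N.
Proof.
have : is_cyclotomic_data R alpha beta (cyclotomic_data R alpha beta).
  by apply: xgetPex; exists ([:: 36], [:: 12; 9; 8; 7])%N; exact: cyclotomic_data36.
move=> /cyclotomic_data_uniq /(_ cyclotomic_data36) [h1 h2]; split => //.
exact: perm_small_eq h1.
Qed.

(* the exponent s(m) of the paper, which is 0 or 1 here *)
Definition smult (n m : nat) : bool := (n %| 12 * m)%N || (n %| 9 * m)%N.

(** Roots of $X^{36}-1$ are simple, so the multiplicity in the gcd is at most 1. Common roots with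
    $X^8-1$ or $X^7-1$ bring nothing new: $36-3\cdot8=12$ and $36-5\cdot7=1$, so they are already
    roots of $X^{12}-1$. *)
Lemma mup_hyp (n m : nat) qs : (0 < n)%N -> perm_eq qs [:: 12; 9; 8; 7]%N ->
  mup (Defs.root1C R (m%:Q / n%:Q)) (gcdp (prod_Xn1 R [:: 36]%N) (prod_Xn1 R qs)) = smult n m.
Proof.
move=> n0 /permP qsE.
have qs0 : all (ltn 0%N) qs.
  by apply/allP => k; rewrite -has_pred1 has_count qsE -has_count has_pred1 !inE; lia.
have h36 : all (ltn 0%N) [:: 36]%N by [].
rewrite (mup_gcdp _ (prod_Xn1_neq0 R h36) (prod_Xn1_neq0 R qs0)).
rewrite (mup_prod_Xn1 _ h36) (mup_prod_Xn1 _ qs0) qsE.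
have E k : (Defs.root1C R (m%:Q / n%:Q) ^+ k == 1) = (n %| k * m)%N.
  by rewrite -!pmulrn root1C_exp_eq1.
have cE l : count (fun k => Defs.root1C R (m%:Q / n%:Q) ^+ k == 1) l =
    count (fun k => n %| k * m)%N l by apply: eq_count.
rewrite !cE /count /smult !addn0.
have d36 : (n %| 12 * m)%N || (n %| 9 * m)%N -> (n %| 36 * m)%N.
  by case/orP => h; [rewrite (_ : 36 = 3 * 12)%N | rewrite (_ : 36 = 4 * 9)%N] => //;
     rewrite -mulnA dvdn_mull.
have d8 : (n %| 36 * m)%N -> (n %| 8 * m)%N -> (n %| 12 * m)%N.
  move=> h1 h2; have := dvdn_sub h1 (dvdn_mull 3 h2).
  by rewrite mulnA -mulnBl.
have d7 : (n %| 36 * m)%N -> (n %| 7 * m)%N -> (n %| 12 * m)%N.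
  move=> h1 h2; have := dvdn_sub h1 (dvdn_mull 5 h2).
  by rewrite mulnA -mulnBl mul1n => /(dvdn_mull 12).
move: d36 d8 d7.
by case: (n %| 36 * m)%N; case: (n %| 12 * m)%N; case: (n %| 9 * m)%N;
   case: (n %| 8 * m)%N; case: (n %| 7 * m)%N => // d1 d2 d3;
   try (by have := d1 isT); try (by have := d2 isT isT); try (by have := d3 isT isT).
Qed.

Definition Mconst : rat :=
  36%N%:Q ^+ 36 / (12%N%:Q ^+ 12 * 9%N%:Q ^+ 9 * 8%N%:Q ^+ 8 * 7%N%:Q ^+ 7).

Definition gprod (F : finFieldType) (omega Theta : F -> R[i]) (m : nat) : R[i] :=
  let g := gauss_sum omega Theta in
  g (36%:Z * m%:Z) * g (- 12%:Z * m%:Z) * g (- 9%:Z * m%:Z) * g (- 8%:Z * m%:Z)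
  * g (- 7%:Z * m%:Z).

(** With $r+s=5$ the sign turns $1/(1-q)$ into $1/(q-1)$; moreover $\epsilon=(-1)^{36}=1$ and
    $s(0)=1$. *)
Lemma hyp_sumE (F : finFieldType) (omega Theta : F -> R[i]) (t : F) :
  hyp_sum omega Theta alpha beta t =
  (#|F|.-1%:R)^-1 * \sum_(0 <= m < #|F|.-1)
    #|F|%:R ^ ((smult #|F|.-1 m)%:Z - 1) * gprod omega Theta m *
    omega (ratr Mconst^-1 * t) ^+ m.
Proof.
have [h1 h2] := cyclotomic_data_spec.
have F1 : (0 < #|F|.-1)%N by rewrite -ltnS prednK ?finNzRing_gt1 // ltnW // finNzRing_gt1.
rewrite /hyp_sum /= h1 (perm_size h2) /=.
have -> : (\sum_(n <- (cyclotomic_data R alpha beta).2) n = 36)%N.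
  by rewrite (perm_big _ h2) !big_cons big_nil.
have PE (f : nat -> rat) : \prod_(n <- (cyclotomic_data R alpha beta).2) f n =
    f 12%N * f 9%N * f 8%N * f 7%N.
  by rewrite (perm_big _ h2) /= !big_cons big_nil mulr1 !mulrA.
have GE (f : nat -> R[i]) : \prod_(n <- (cyclotomic_data R alpha beta).2) f n =
    f 12%N * f 9%N * f 8%N * f 7%N.
  by rewrite (perm_big _ h2) /= !big_cons big_nil mulr1 !mulrA.
have P1 (f : nat -> rat) : \prod_(n <- [:: 36]%N) f n = f 36%N.
  by rewrite big_cons big_nil mulr1.
have G1 (f : nat -> R[i]) : \prod_(n <- [:: 36]%N) f n = f 36%N.
  by rewrite big_cons big_nil mulr1.
have s36 : (-1) ^+ 36 = 1 :> rat by rewrite -signr_odd.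
have ME : (-1) ^+ 36 / (\prod_(n <- [:: 36]%N) n%:Q ^+ n /
    \prod_(n <- (cyclotomic_data R alpha beta).2) n%:Q ^+ n) = Mconst^-1.
  by rewrite PE P1 s36; exact: mul1r.
move: (_ / (_ / _)) ME => M ->.
congr (_ * _).
  rewrite (_ : (-1) ^+ (1 + 4) = -1 :> R[i]); last by ring.
  rewrite mulN1r -invrN opprB; congr _^-1.
  have -> : #|F|%:R = #|F|.-1%:R + 1 :> R[i].
    by rewrite natr1 (prednK (ltnW (finNzRing_gt1 F))).
  exact: addrK.
have s0 : smult #|F|.-1 0 = true by rewrite /smult muln0 dvdn0.
apply: eq_bigr => m _; rewrite (mup_hyp m F1 h2) (mup_hyp 0 F1 h2) s0.
by rewrite GE G1 /gprod !mulrA.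
Qed.
End HypData.

(** * Character sums over finite fields *)

Section Char.
Variables (R : realType) (F : finFieldType).
Local Notation C := R[i].
Local Notation q := #|F|.
Local Notation n := (#|F|.-1).

Lemma card_units_gt0 : (0 < n)%N.
Proof. by rewrite -ltnS prednK ?finNzRing_gt1 // ltnW // finNzRing_gt1. Qed.

Lemma cardF_succ : q = n.+1.
Proof. by rewrite prednK // ltnW // finNzRing_gt1. Qed.

Lemma expf_card1 (x : F) : x != 0 -> x ^+ n = 1.
Proof.
move=> x0; apply: (mulfI x0); rewrite -exprS -cardF_succ mulr1.
exact: expf_card.
Qed.

Lemma finField_prim_root : exists g : F, n.-primitive_root g.
Proof.
have /hasP[g _ gP] : has n.-primitive_root (enum [pred x : F | x != 0]).
  apply: cyclic.has_prim_root; rewrite ?enum_uniq ?card_units_gt0 //.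
    apply/allP => x; rewrite mem_enum inE => x0.
    by rewrite unity_rootE expf_card1.
  rewrite -cardE -(leq_add2l 1) add1n -cardF_succ.
  by rewrite -(cardC (pred1 (0 : F))) card1.
by exists g.
Qed.

Lemma card_neq0 : #|[pred x : F | x != 0]| = n.
Proof. by have := cardC (pred1 (0 : F)); rewrite card1 => <-. Qed.

Section MultChar.
Variable chi : F -> C.
Hypothesis hchi : mult_char chi.

Lemma mult_char_neq0 x : x != 0 -> chi x != 0.
Proof.
move=> x0; apply/eqP => h; have := hchi.2 x x^-1 x0.
rewrite invr_eq0 => /(_ x0); rewrite mulfV // hchi.1 h mul0r => /eqP.
by rewrite oner_eq0.
Qed.

Lemma mult_charV x : x != 0 -> chi x^-1 = (chi x)^-1.
Proof.
move=> x0; apply: (mulfI (mult_char_neq0 x0)).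
by rewrite -hchi.2 ?invr_eq0 // !mulfV ?hchi.1 // mult_char_neq0.
Qed.

Lemma mult_charX x k : x != 0 -> chi (x ^+ k) = chi x ^+ k.
Proof.
move=> x0; elim: k => [|k ih]; first by rewrite !expr0 hchi.1.
by rewrite !exprS hchi.2 ?expf_neq0 // ih.
Qed.

Lemma mult_charXz x (k : int) : x != 0 -> chi (x ^ k) = chi x ^ k.
Proof.
move=> x0; case: k => k; first exact: mult_charX.
by rewrite !NegzE -!invr_expz mult_charV ?mult_charX // expf_neq0.
Qed.

Lemma mult_char_card x : x != 0 -> chi x ^+ n = 1.
Proof. by move=> x0; rewrite -mult_charX // expf_card1 // hchi.1. Qed.

End MultChar.

Variables omega Theta : F -> C.
Hypothesis homega : mult_char_generator omega.
Hypothesis hTheta : nontrivial_add_char Theta.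

(** The discrete logarithm to a primitive root, composed with $i\mapsto e^{2\pi i\cdot i/(q-1)}$, is
    an injective character. Being a power of [omega], it forces [omega] to be injective. *)
Lemma generator_faithful (x : F) : x != 0 -> omega x = 1 -> x = 1.
Proof.
have [g gP] := finField_prim_root.
have zP := root1C_prim R card_units_gt0; set z := Defs.root1C R _ in zP.
pose log y := if [pick i : 'I_n | g ^+ i == y] is Some i then i : nat else 0%N.
have logE y : y != 0 -> g ^+ log y = y.
  move=> y0; rewrite /log; case: pickP => [i /eqP //|h].
  have /(prim_rootP gP)[i iE] := expf_card1 y0.
  by have := h i; rewrite iE eqxx.
have chiP : mult_char (fun y => z ^+ log y).
  split=> [|y y' y0 y0']; last first.
    rewrite -exprD; apply/eqP; rewrite (eq_prim_root_expr zP) -(eq_prim_root_expr gP).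
    by rewrite exprD !logE // mulf_neq0.
  rewrite -[RHS](expr0 z); apply/eqP.
  by rewrite (eq_prim_root_expr zP) -(eq_prim_root_expr gP) logE ?oner_neq0.
have [k kE] := homega.2 _ chiP.
move=> x0 ox; have := kE x x0; rewrite ox expr1n => /eqP.
rewrite -[1](expr0 z) (eq_prim_root_expr zP) -(eq_prim_root_expr gP) logE // expr0.
by move/eqP.
Qed.

Let hom := homega.1.

Lemma sum_char_powers x : x != 0 ->
  \sum_(0 <= m < n) omega x ^+ m = if x == 1 then n%:R else 0.
Proof.
move=> x0; case: eqP => [->|x1].
  under eq_bigr do rewrite hom.1 expr1n.
  by rewrite sumr_const_nat subn0.
have ox : omega x - 1 != 0.
  by rewrite subr_eq0; apply/eqP => /(generator_faithful x0).
apply: (mulfI ox); rewrite mulr0 big_mkord -subrX1.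
by rewrite mult_char_card // subrr.
Qed.

Lemma sum_char_points k :
  \sum_(x : F | x != 0) omega x ^+ k = if (n %| k)%N then n%:R else 0.
Proof.
case: ifP => hk.
  rewrite (eq_bigr (fun=> 1)) ?sumr_const ?card_neq0 // => x x0.
  by case/dvdnP: hk => j ->; rewrite mulnC exprM mult_char_card // expr1n.
have [g gP] := finField_prim_root.
have g0 : g != 0.
  apply/eqP => g0; have := prim_expr_order gP.
  by rewrite g0 expr0n gtn_eqF ?card_units_gt0 //= => /eqP; rewrite eq_sym oner_eq0.
have og : omega g ^+ k - 1 != 0.
  rewrite subr_eq0 -mult_charX //; apply/eqP => /generator_faithful.
  rewrite expf_neq0 // => /(_ isT) /eqP; rewrite -(prim_order_dvd gP) hk //.
apply: (mulfI og); rewrite mulr0 mulrBl mul1r; apply/eqP; rewrite subr_eq0; apply/eqP.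
rewrite [RHS](reindex_onto (fun x => g * x) (fun x => g^-1 * x)) /=; last first.
  by move=> x _; rewrite mulrA mulfV // mul1r.
rewrite mulr_sumr; apply: eq_big => [x|x x0].
  by rewrite mulf_eq0 (negbTE g0) /= mulrA mulVf // mul1r eqxx andbT.
by rewrite hom.2 // exprMn.
Qed.

Lemma sum_add_char c : \sum_(y : F) Theta (y * c) = if c == 0 then q%:R else 0.
Proof.
have [T0 TD [a Ta]] := hTheta.
case: eqP => [->|/eqP c0].
  by rewrite (eq_bigr (fun=> 1)) ?sumr_const // => x _; rewrite mulr0.
have Ta1 : Theta a - 1 != 0 by rewrite subr_eq0.
apply: (mulfI Ta1); rewrite mulr0 mulrBl mul1r; apply/eqP; rewrite subr_eq0; apply/eqP.
rewrite [RHS](reindex_onto (fun x => x + a / c) (fun x => x - a / c)) /=; last first.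
  by move=> x _; rewrite subrK.
rewrite mulr_sumr; apply: eq_big => [x|x _]; first by rewrite addrK eqxx.
by rewrite mulrDl divfK // TD mulrC.
Qed.

(** Over all $y$ the sum would be $q$ times the number of zeros of [P]; restricting to $y\ne0$
    removes the term $y=0$, which is the size of [Q]. *)
Lemma sum_add_char_points (U : finType) (Q : pred U) (P : U -> F) :
  \sum_(j : F * U | (j.1 != 0) && Q j.2) Theta (j.1 * P j.2) =
  q%:R * #|[pred u | Q u && (P u == 0)]|%:R - #|Q|%:R.
Proof.
rewrite -(pair_big (fun y : F => y != 0) Q (fun y u => Theta (y * P u))) /=.
rewrite exchange_big /=.
have -> : #|[pred u | Q u && (P u == 0)]|%:R = \sum_(u | Q u) (P u == 0)%:R :> C.
  by rewrite -sum1_card natr_sum big_mkcondr /=; apply: eq_bigr => u _; case: eqP.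
have -> : #|Q|%:R = \sum_(u | Q u) 1 :> C by rewrite -sum1_card natr_sum.
rewrite mulr_sumr -sumrB; apply: eq_bigr => u _.
have := sum_add_char (P u); rewrite (bigD1 0) //= mul0r.
case: hTheta => -> _ _ h; apply: (addrI 1); rewrite h.
by case: eqP => _; rewrite ?mulr1 ?mulr0; ring.
Qed.

Lemma sum_char_family (J : finType) (P : pred J) (M : J -> F) (h : J -> C) :
  (forall j, P j -> M j != 0) ->
  \sum_(0 <= m < n) \sum_(j | P j) omega (M j) ^+ m * h j =
  n%:R * \sum_(j | P j && (M j == 1)) h j.
Proof.
move=> M0; rewrite exchange_big big_mkcondr /= mulr_sumr; apply: eq_bigr => j Pj.
rewrite -mulr_suml sum_char_powers ?M0 //.
by case: eqP => _; rewrite ?mulr0 ?mul0r.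
Qed.

(** The condition $dm\equiv0$ is detected by averaging $\omega(w)^{dm}$ over $w$. This adds one
    torus variable $w$ and changes the equation into $w^dM=1$. *)
Lemma sum_char_torsion d (J : finType) (P : pred J) (M : J -> F) (h : J -> C) :
  (forall j, P j -> M j != 0) ->
  \sum_(0 <= m < n | (n %| d * m)%N) \sum_(j | P j) omega (M j) ^+ m * h j =
  \sum_(j : J * F | [&& P j.1, j.2 != 0 & j.2 ^+ d * M j.1 == 1]) h j.1.
Proof.
move=> M0; have n0 : n%:R != 0 :> C by rewrite pnatr_eq0 -lt0n card_units_gt0.
apply: (mulfI n0).
have M0' (j : J * F) : P j.1 && (j.2 != 0) -> j.2 ^+ d * M j.1 != 0.
  by case/andP=> hP w0; rewrite mulf_neq0 ?expf_neq0 ?M0.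
under [in RHS]eq_bigl do rewrite andbA.
rewrite -(@sum_char_family _ _ _ (fun j => h j.1) M0').
rewrite big_mkcond mulr_sumr; apply: eq_bigr => m _.
rewrite -(pair_big P (fun w : F => w != 0)
  (fun j w => omega (w ^+ d * M j) ^+ m * h j)) /=.
have -> : (if (n %| d * m)%N then \sum_(j | P j) omega (M j) ^+ m * h j else 0) =
   \sum_(j | P j) (if (n %| d * m)%N then 1 else 0) * (omega (M j) ^+ m * h j).
  by case: ifP => _; [under [RHS]eq_bigr do rewrite mul1r | rewrite big1 // => j _; rewrite mul0r].
rewrite mulr_sumr; apply: eq_bigr => j Pj; rewrite !mulrA.
have -> : n%:R * (if (n %| d * m)%N then 1 else 0) = \sum_(w : F | w != 0) omega w ^+ (d * m) :> C.
  by rewrite sum_char_points; case: ifP => _; rewrite ?mulr1 ?mulr0.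
rewrite -mulrA mulr_suml; apply: eq_bigr => w w0.
by rewrite hom.2 ?expf_neq0 ?M0 // mult_charX // exprMn -exprM mulrA.
Qed.

Lemma gauss_sum_periodic (a b : int) : (n%:Z %| a - b)%Z ->
  gauss_sum omega Theta a = gauss_sum omega Theta b.
Proof.
move=> /dvdzP[k kE]; have -> : a = b + k * n%:Z by rewrite -kE addrC subrK.
apply: eq_bigr => x x0; congr (_ * _).
rewrite expfzDr ?mult_char_neq0 // [k * _]mulrC -exprz_exp -[_ ^ n%:Z]/(_ ^+ n).
by rewrite mult_char_card // exp1rz mulr1.
Qed.

Lemma gauss_sum0 : gauss_sum omega Theta 0 = -1.
Proof.
have := sum_add_char 1; rewrite oner_eq0 (bigD1 0) //= mul0r.
case: hTheta => -> _ _ h; apply: (addrI 1); rewrite subrr -[RHS]h; congr (_ + _).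
by apply: eq_bigr => x _; rewrite expr0z mul1r mulr1.
Qed.

Definition nz2 (z : F * F) := (z.1 != 0) && (z.2 != 0).
Definition nz3 (z : F * F * F) := nz2 z.1 && (z.2 != 0).
Definition nz4 (z : F * F * F * F) := nz3 z.1 && (z.2 != 0).
Definition nz5 (z : F * F * F * F * F) := nz4 z.1 && (z.2 != 0).

Local Notation g := (gauss_sum omega Theta).

Lemma gauss_sum_mul2 a b : g a * g b =
  \sum_(z | nz2 z) omega z.1 ^ a * omega z.2 ^ b * Theta (z.1 + z.2).
Proof.
have [_ TD _] := hTheta.
by rewrite big_distrlr pair_big; apply: eq_bigr => z _ /=; rewrite TD; ring.
Qed.

Lemma gauss_sum_mul3 a b c : g a * g b * g c =
  \sum_(z | nz3 z) omega z.1.1 ^ a * omega z.1.2 ^ b * omega z.2 ^ c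
    * Theta (z.1.1 + z.1.2 + z.2).
Proof.
have [_ TD _] := hTheta.
rewrite gauss_sum_mul2 big_distrlr pair_big.
by apply: eq_bigr => z _ /=; rewrite [in RHS]TD; ring.
Qed.

Lemma gauss_sum_mul4 a b c d : g a * g b * g c * g d =
  \sum_(z | nz4 z) omega z.1.1.1 ^ a * omega z.1.1.2 ^ b * omega z.1.2 ^ c
    * omega z.2 ^ d * Theta (z.1.1.1 + z.1.1.2 + z.1.2 + z.2).
Proof.
have [_ TD _] := hTheta.
rewrite gauss_sum_mul3 big_distrlr pair_big.
by apply: eq_bigr => z _ /=; rewrite [in RHS]TD; ring.
Qed.

Lemma gauss_sum_mul5 a b c d e : g a * g b * g c * g d * g e =
  \sum_(z | nz5 z) omega z.1.1.1.1 ^ a * omega z.1.1.1.2 ^ b * omega z.1.1.2 ^ c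
    * omega z.1.2 ^ d * omega z.2 ^ e
    * Theta (z.1.1.1.1 + z.1.1.1.2 + z.1.1.2 + z.1.2 + z.2).
Proof.
have [_ TD _] := hTheta.
rewrite gauss_sum_mul4 big_distrlr pair_big.
by apply: eq_bigr => z _ /=; rewrite [in RHS]TD; ring.
Qed.

End Char.

Ltac fieldnz := field; repeat (apply/andP; split); rewrite ?oner_neq0 ?mulf_neq0 ?expf_neq0 //.

(** * Torus and torsion sums as point counts *)

Section Eval.
Variables (R : realType) (F : finFieldType).
Local Notation C := R[i].
Local Notation q := #|F|.
Local Notation n := (#|F|.-1).

(** Strata of the chart $x_2=1$: all of $x_0,x_1,x_3$ nonzero; then $x_3=0$ with coordinates
    $(x_0,x_1)$; then $x_0=0$ with coordinates $(x_1,x_3)$; then $x_0=x_3=0$. The parameter [lam]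
    stands for $-36\psi$. *)
Definition torus_count (lam : F) := #|[pred u : F * F * F | nz3 u &&
  (u.1.1 ^+ 3 * u.1.2 + u.1.2 ^+ 3 + 1 + u.2 ^+ 4 + lam * u.1.1 * u.1.2 * u.2 == 0)]|.
Definition face3_count := #|[pred u : F * F | nz2 u && (u.1 ^+ 3 * u.2 + u.2 ^+ 3 + 1 == 0)]|.
Definition face0_count := #|[pred u : F * F | nz2 u && (u.1 ^+ 3 + 1 + u.2 ^+ 4 == 0)]|.
Definition edge_count := #|[pred u : F | (u != 0) && (u ^+ 3 + 1 == 0)]|.

Variables omega Theta : F -> C.
Hypothesis homega : mult_char_generator omega.
Hypothesis hTheta : nontrivial_add_char Theta.
Let hom := homega.1.
Local Notation g := (gauss_sum omega Theta).

Lemma char_expz (e : int) (m : nat) z : z != 0 ->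
  omega z ^ (e * m%:Z) = omega (z ^ e) ^+ m.
Proof. by move=> z0; rewrite -exprz_exp mult_charXz. Qed.

Lemma gauss2_torsion d (e1 e2 : int) :
  \sum_(0 <= m < n | (n %| d * m)%N) g (e1 * m%:Z) * g (e2 * m%:Z) =
  \sum_(j : F * F * F | [&& nz2 j.1, j.2 != 0 & j.2 ^+ d * (j.1.1 ^ e1 * j.1.2 ^ e2) == 1])
     Theta (j.1.1 + j.1.2).
Proof.
rewrite -(@sum_char_torsion _ _ _ homega d _ (@nz2 F) (fun z => z.1 ^ e1 * z.2 ^ e2)
  (fun z => Theta (z.1 + z.2))); last first.
  by move=> z /andP[h1 h2]; rewrite mulf_neq0 // expfz_neq0.
apply: eq_bigr => m _; rewrite gauss_sum_mul2 //; apply: eq_bigr => z /andP[h1 h2].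
by rewrite !char_expz // -exprMn hom.2 // expfz_neq0.
Qed.

Lemma gauss3_torsion d (e1 e2 e3 : int) :
  \sum_(0 <= m < n | (n %| d * m)%N) g (e1 * m%:Z) * g (e2 * m%:Z) * g (e3 * m%:Z) =
  \sum_(j : F * F * F * F | [&& nz3 j.1, j.2 != 0 &
      j.2 ^+ d * (j.1.1.1 ^ e1 * j.1.1.2 ^ e2 * j.1.2 ^ e3) == 1])
     Theta (j.1.1.1 + j.1.1.2 + j.1.2).
Proof.
rewrite -(@sum_char_torsion _ _ _ homega d _ (@nz3 F)
  (fun z => z.1.1 ^ e1 * z.1.2 ^ e2 * z.2 ^ e3)
  (fun z => Theta (z.1.1 + z.1.2 + z.2))); last first.
  by move=> z /andP[/andP[h1 h2] h3]; rewrite !mulf_neq0 // expfz_neq0.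
apply: eq_bigr => m _; rewrite gauss_sum_mul3 //; apply: eq_bigr => z /andP[/andP[h1 h2] h3].
by rewrite !char_expz // -!exprMn !hom.2 // ?mulf_neq0 // expfz_neq0.
Qed.

(** The variety $w^3z_1z_2^2=1$ is parametrised by $z_1=yu^3$, $z_2=y$, $w=1/(yu)$, where $z_1,z_2$
    are $y$ times the monomials of the edge equation. The argument of [Theta] becomes $y(u^3+1)$. *)
Lemma sum_torsion3 :
  \sum_(0 <= m < n | (n %| 3 * m)%N) g (1 * m%:Z) * g (2 * m%:Z) = q%:R * edge_count%:R - n%:R.
Proof.
rewrite gauss2_torsion.
pose P (u : F) := u ^+ 3 + 1.
have := sum_add_char_points hTheta (fun u : F => u != 0) P.
rewrite card_neq0 => <-.
pose h (j : F * F) := ((j.1 * j.2 ^+ 3, j.1), (j.1 * j.2)^-1).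
pose h' (z : F * F * F) := (z.1.2, (z.1.2 * z.2)^-1).
have hP j : [&& nz2 (h j).1, (h j).2 != 0 &
    (h j).2 ^+ 3 * ((h j).1.1 ^ 1 * (h j).1.2 ^ 2) == 1] = (j.1 != 0) && (j.2 != 0).
  case: j => y u; rewrite /nz2 /h /= !(mulf_eq0, expf_eq0, invr_eq0) /=.
  case: (eqVneq y 0) => //= y0; case: (eqVneq u 0) => //= u0.
  apply/eqP; rewrite expr1z -[_ ^ 2]/(_ ^+ 2).
  by fieldnz.
rewrite (@reindex _ _ _ _ _ h) /=; last first.
  exists h' => [[y u]|[[z1 z2] w]]; rewrite !inE.
    rewrite hP /= => /andP[y0 u0]; rewrite /h /h' /=.
    by congr (_, _); fieldnz.
  rewrite /h /h' /= => /and3P[/andP[/= z10 z20] w0 /eqP e].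
  congr (_, _, _); last by fieldnz.
  rewrite expr1z -[_ ^ 2]/(_ ^+ 2) in e.
  by rewrite -[LHS]mulr1 -[1 in LHS]e; fieldnz.
apply: eq_big => -[y u]; first by rewrite hP.
by move=> _; congr Theta; rewrite /P /=; ring.
Qed.

Lemma sum_torsion9 :
  \sum_(0 <= m < n | (n %| 9 * m)%N) g (-3 * m%:Z) * g (1 * m%:Z) * g (2 * m%:Z) =
  q%:R * face3_count%:R - n%:R ^+ 2.
Proof.
rewrite gauss3_torsion.
pose P (u : F * F) := u.1 ^+ 3 * u.2 + u.2 ^+ 3 + 1.
have nn : #|@nz2 F| = (n ^ 2)%N.
  have -> : #|@nz2 F| = #|[predX [pred x : F | x != 0] & [pred x : F | x != 0]]|.
    by apply: eq_card => -[x y].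
  by rewrite cardX card_neq0.
have := sum_add_char_points hTheta (@nz2 F) P.
rewrite nn natrX => <-.
(* The monomials of the face $x_3=0$ times $y$, with $w=u$: in $w^9z_1^{-3}z_2z_3^2$ all exponents
   cancel, and $v$ is recovered from $z_1=yu^3v$. *)
pose h (j : F * (F * F)) :=
  (((j.1 * j.2.1 ^+ 3 * j.2.2, j.1 * j.2.2 ^+ 3), j.1), j.2.1).
pose h' (z : F * F * F * F) := (z.1.2, (z.2, z.1.1.1 / (z.1.2 * z.2 ^+ 3))).
have hP j : [&& nz3 (h j).1, (h j).2 != 0 & (h j).2 ^+ 9 *
    ((h j).1.1.1 ^ (-3) * (h j).1.1.2 ^ 1 * (h j).1.2 ^ 2) == 1] = (j.1 != 0) && nz2 j.2.
  case: j => y [u v]; rewrite /nz3 /nz2 /h /= !(mulf_eq0, expf_eq0, invr_eq0) /=.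
  case: (eqVneq y 0) => //= y0; case: (eqVneq u 0) => //= u0; case: (eqVneq v 0) => //= v0.
  apply/eqP; rewrite expr1z -[_ ^ 2]/(_ ^+ 2) -[_ ^ (-3)]/((_ ^+ 3)^-1).
  by fieldnz.
rewrite (@reindex _ _ _ _ _ h) /=; last first.
  exists h' => [[y [u v]]|[[[z1 z2] z3] w]]; rewrite !inE.
    rewrite hP /= => /and3P[y0 /= u0 v0]; rewrite /h /h' /=.
    by congr (_, (_, _)); fieldnz.
  rewrite /h /h' /= => /and3P[/andP[/andP[/= z10 z20] z30] w0 /eqP e].
  rewrite /= in z30.
  congr (_, _, _, _); first by fieldnz.
  rewrite expr1z -[_ ^ 2]/(_ ^+ 2) -[_ ^ (-3)]/((_ ^+ 3)^-1) in e.
  rewrite -[LHS]mulr1 -[1 in LHS]e.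
  by fieldnz.
apply: eq_big => -[y [u v]]; first by rewrite hP.
by move=> _; congr Theta; rewrite /P /=; ring.
Qed.

Lemma sum_torsion12 :
  \sum_(0 <= m < n | (n %| 12 * m)%N) g (3 * m%:Z) * g (4 * m%:Z) * g (5 * m%:Z) =
  q%:R * face0_count%:R - n%:R ^+ 2.
Proof.
rewrite gauss3_torsion.
pose P (u : F * F) := u.1 ^+ 3 + 1 + u.2 ^+ 4.
have nn : #|@nz2 F| = (n ^ 2)%N.
  have -> : #|@nz2 F| = #|[predX [pred x : F | x != 0] & [pred x : F | x != 0]]|.
    by apply: eq_card => -[x y].
  by rewrite cardX card_neq0.
have := sum_add_char_points hTheta (@nz2 F) P.
rewrite nn natrX => <-.
pose h (j : F * (F * F)) :=
  (((j.1 * j.2.2 ^+ 4, j.1 * j.2.1 ^+ 3), j.1), (j.1 * j.2.1 * j.2.2)^-1).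
(* Since $yw=1/(uv)$ and $z_1z_2/y^2=u^3v^4$, multiplying the latter by $(yw)^3$ gives $v$ and by
   $(yw)^4$ gives $1/u$. *)
pose h' (z : F * F * F * F) := (z.1.2,
   (z.1.2 ^+ 2 / (z.1.1.1 * z.1.1.2 * (z.1.2 * z.2) ^+ 4),
    z.1.1.1 * z.1.1.2 * (z.1.2 * z.2) ^+ 3 / z.1.2 ^+ 2)).
have hP j : [&& nz3 (h j).1, (h j).2 != 0 & (h j).2 ^+ 12 *
    ((h j).1.1.1 ^ 3 * (h j).1.1.2 ^ 4 * (h j).1.2 ^ 5) == 1] = (j.1 != 0) && nz2 j.2.
  case: j => y [u v]; rewrite /nz3 /nz2 /h /= !(mulf_eq0, expf_eq0, invr_eq0) /=.
  case: (eqVneq y 0) => //= y0; case: (eqVneq u 0) => //= u0; case: (eqVneq v 0) => //= v0.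
  apply/eqP; rewrite -[_ ^ 3]/(_ ^+ 3) -[_ ^ 4]/(_ ^+ 4) -[_ ^ 5]/(_ ^+ 5).
  by fieldnz.
rewrite (@reindex _ _ _ _ _ h) /=; last first.
  exists h' => [[y [u v]]|[[[z1 z2] z3] w]]; rewrite !inE.
    rewrite hP /= => /and3P[y0 /= u0 v0]; rewrite /h /h' /=.
    by congr (_, (_, _)); fieldnz.
  rewrite /h /h' /= => /and3P[/andP[/andP[/= z10 z20] z30] w0 /eqP e].
  rewrite /= in z30.
  rewrite -[_ ^ 3]/(_ ^+ 3) -[_ ^ 4]/(_ ^+ 4) -[_ ^ 5]/(_ ^+ 5) in e.
  congr (_, _, _, _); last by fieldnz.
    rewrite -[RHS]mulr1 -[1 in RHS]e.
    by fieldnz.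
  rewrite -[LHS]mulr1 -[1 in LHS]e.
  by fieldnz.
apply: eq_big => -[y [u v]]; first by rewrite hP.
by move=> _; congr Theta; rewrite /P /=; ring.
Qed.

Lemma sum_gprod (lam : F) : lam != 0 ->
  \sum_(0 <= m < n) gprod omega Theta m * omega (lam ^+ 36)^-1 ^+ m =
  n%:R * (q%:R * (torus_count lam)%:R - n%:R ^+ 3).
Proof.
move=> lam0.
pose M (z : F * F * F * F * F) := z.1.1.1.1 ^ 36 * z.1.1.1.2 ^ (-12) * z.1.1.2 ^ (-9)
   * z.1.2 ^ (-8) * z.2 ^ (-7) / lam ^+ 36.
pose T (z : F * F * F * F * F) := Theta (z.1.1.1.1 + z.1.1.1.2 + z.1.1.2 + z.1.2 + z.2).
have M0 z : nz5 z -> M z != 0.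
  move=> /andP[/andP[/andP[/andP[h1 h2] h3] h4] h5].
  by rewrite /M !mulf_neq0 ?invr_eq0 ?expf_neq0 // expfz_neq0.
rewrite (eq_bigr (fun m => \sum_(z | nz5 z) omega (M z) ^+ m * T z)); last first.
  move=> m _; rewrite /gprod gauss_sum_mul5 // mulr_suml.
  apply: eq_bigr => z /andP[/andP[/andP[/andP[h1 h2] h3] h4] h5].
  rewrite !char_expz // /M /T !hom.2 ?mulf_neq0 ?invr_eq0 ?expf_neq0 ?expfz_neq0 //.
  by rewrite !exprMn; ring.
rewrite (sum_char_family homega _ M0); congr (_ * _).
pose P (u : F * F * F) := u.1.1 ^+ 3 * u.1.2 + u.1.2 ^+ 3 + 1 + u.2 ^+ 4
   + lam * u.1.1 * u.1.2 * u.2.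
have nn : #|@nz3 F| = (n ^ 3)%N.
  have -> : #|@nz3 F| = #|[predX [predX [pred x : F | x != 0] & [pred x : F | x != 0]]
      & [pred x : F | x != 0]]|.
    by apply: eq_card => -[[x y] z].
  by rewrite !cardX card_neq0 !expnS expn0 muln1 mulnA.
have := sum_add_char_points hTheta (@nz3 F) P.
rewrite nn natrX => <-.
(* The exponents $36,-12,-9,-8,-7$ are attached to $y$ times the monomials $\lambda uvw$, $u^3v$,
   $w^4$, $v^3$, $1$. The powers of $y,u,v,w$ cancel, and $\lambda^{36}$ is absorbed by the
   character value. *)
pose h (j : F * (F * F * F)) :=
  ((((lam * j.1 * j.2.1.1 * j.2.1.2 * j.2.2, j.1 * j.2.1.1 ^+ 3 * j.2.1.2),
     j.1 * j.2.2 ^+ 4), j.1 * j.2.1.2 ^+ 3), j.1).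
(* With $a=u^3v$, $b=v^3$, $d=w^4$, $e=uvw$ one has $u=e^4/(abd)$, $v=a^4b^3d^3/e^{12}$ and
   $w=e^9/(a^3b^2d^2)$. *)
pose h' (z : F * F * F * F * F) :=
  let y := z.2 in let a := z.1.1.1.2 / y in let b := z.1.2 / y in
  let d := z.1.1.2 / y in let e := z.1.1.1.1 / (lam * y) in
  (y, ((e ^+ 4 / (a * b * d), a ^+ 4 * b ^+ 3 * d ^+ 3 / e ^+ 12),
       e ^+ 9 / (a ^+ 3 * b ^+ 2 * d ^+ 2))).
have ME a b c d e : M (a, b, c, d, e) = a ^+ 36 / (b ^+ 12 * c ^+ 9 * d ^+ 8 * e ^+ 7 * lam ^+ 36).
  have gen (x y1 y2 y3 y4 y5 : F) :
    x / y1 / y2 / y3 / y4 / y5 = x / (y1 * y2 * y3 * y4 * y5) by rewrite !invfM !mulrA.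
  exact: gen.
have hP j : nz5 (h j) && (M (h j) == 1) = (j.1 != 0) && nz3 j.2.
  case: j => y [[u v] w].
  rewrite /nz5 /nz4 /nz3 /nz2 /h ME /= !(mulf_eq0, expf_eq0, invr_eq0) (negbTE lam0) /=.
  case: (eqVneq y 0) => //= y0; case: (eqVneq u 0) => //= u0; case: (eqVneq v 0) => //= v0.
  case: (eqVneq w 0) => //= w0.
  apply/eqP.
  by fieldnz.
rewrite (@reindex _ _ _ _ _ h) /=; last first.
  exists h' => [[y [[u v] w]]|[[[[z5 z1] z4] z2] z3]]; rewrite !inE.
    rewrite hP /= => /andP[y0 /andP[/andP[/= u0 v0] w0]]; rewrite /h /h' /=.
    by congr (_, (_, _, _)); fieldnz.
  rewrite ME => /andP[/andP[/andP[/andP[/andP[/= h5 h1] /= h4] /= h2] /= h3] /eqP e].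
  rewrite /h /h' /=.
  (* The components $\lambda yuvw$ and $yu^3v$ are formal identities. The components $yw^4$ and
     $yv^3$ need the relation $e^{36}=a^{12}b^8d^9$, inserted as a factor 1. *)
  congr (_, _, _, _, _); first by fieldnz.
  - by fieldnz.
  - by rewrite -[RHS]mulr1 -[1 in RHS]e; fieldnz.
  - by rewrite -[LHS]mulr1 -[1 in LHS]e; fieldnz.
apply: eq_big => -[y [[u v] w]]; first by rewrite hP.
by move=> _; rewrite /T; congr Theta; rewrite /P /=; ring.
Qed.
End Eval.

(** * Counting points of the quartic *)

Section HypValue.
Variables (R : realType) (F : finFieldType) (omega Theta : F -> R[i]).
Hypothesis homega : mult_char_generator omega.
Hypothesis hTheta : nontrivial_add_char Theta.
Local Notation q := #|F|.
Local Notation n := (#|F|.-1).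
Local Notation g := (gauss_sum omega Theta).

Lemma gauss_sum_shift d (e e' k : int) (m : nat) : (n %| d * m)%N ->
  e - e' = k * d%:Z -> g (e * m%:Z) = g (e' * m%:Z).
Proof.
move=> h E; apply: (gauss_sum_periodic Theta homega).
by rewrite -mulrBl E -mulrA -PoszM; apply: dvdz_mull; rewrite dvdzE.
Qed.

Lemma gauss_sum_triv d (e k : int) (m : nat) : (n %| d * m)%N ->
  e = k * d%:Z -> g (e * m%:Z) = -1.
Proof.
move=> h E; rewrite (@gauss_sum_shift d e 0 k m) ?subr0 // mul0r.
exact: (gauss_sum0 omega hTheta).
Qed.

Variable lam : F.
Hypothesis lam0 : lam != 0.
Let W m := gprod omega Theta m * omega (lam ^+ 36)^-1 ^+ m.

Lemma char36_trivial d k m : (n %| d * m)%N -> (36 = k * d)%N ->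
  omega (lam ^+ 36)^-1 ^+ m = 1.
Proof.
move=> h E; rewrite (mult_charV homega.1) ?expf_neq0 // exprVn.
rewrite (mult_charX homega.1) // -exprM E -mulnA.
case/dvdnP: h => j ->; rewrite mulnA mulnC exprM mult_char_card ?expr1n ?invr1 //.
exact: homega.1.
Qed.

(** Indices matter only modulo 12 here: $36$ and $-12$ give two trivial Gauss sums with product 1,
    and $-9,-8,-7$ become $3,4,5$. The character of $\lambda^{36}$ is trivial, which is why the face
    counts do not involve $\psi$. *)
Lemma W_torsion12 m : (n %| 12 * m)%N ->
  W m = g (3 * m%:Z) * g (4 * m%:Z) * g (5 * m%:Z).
Proof.
move=> h; rewrite /W /gprod (@char36_trivial 12 3) // mulr1.
rewrite (@gauss_sum_triv 12 36%:Z 3) // (@gauss_sum_triv 12 (- 12%:Z) (-1)) //.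
rewrite (@gauss_sum_shift 12 (- 9%:Z) 3 (-1)) // (@gauss_sum_shift 12 (- 8%:Z) 4 (-1)) //.
by rewrite (@gauss_sum_shift 12 (- 7%:Z) 5 (-1)) //; ring.
Qed.

Lemma W_torsion9 m : (n %| 9 * m)%N ->
  W m = g (-3 * m%:Z) * g (1 * m%:Z) * g (2 * m%:Z).
Proof.
move=> h; rewrite /W /gprod (@char36_trivial 9 4) // mulr1.
rewrite (@gauss_sum_triv 9 36%:Z 4) // (@gauss_sum_triv 9 (- 9%:Z) (-1)) //.
rewrite (@gauss_sum_shift 9 (- 12%:Z) (-3) (-1)) // (@gauss_sum_shift 9 (- 8%:Z) 1 (-1)) //.
by rewrite (@gauss_sum_shift 9 (- 7%:Z) 2 (-1)) //; ring.
Qed.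

(** Three Gauss sums are now trivial, whence the sign. *)
Lemma W_torsion3 m : (n %| 3 * m)%N ->
  W m = - (g (1 * m%:Z) * g (2 * m%:Z)).
Proof.
move=> h; rewrite /W /gprod (@char36_trivial 3 12) // mulr1.
rewrite (@gauss_sum_triv 3 36%:Z 12) // (@gauss_sum_triv 3 (- 9%:Z) (-3)) //.
rewrite (@gauss_sum_triv 3 (- 12%:Z) (-4)) // (@gauss_sum_shift 3 (- 8%:Z) 1 (-3)) //.
by rewrite (@gauss_sum_shift 3 (- 7%:Z) 2 (-3)) //; ring.
Qed.

(** Inclusion-exclusion: $12m=0$ and $9m=0$ hold together exactly when $3m=0$. The sign in
    [W_torsion3] makes the edge count enter with a plus. *)
Lemma sum_smult : \sum_(0 <= m < n | smult n m) W m =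
  q%:R * (face3_count F)%:R + q%:R * (face0_count F)%:R + q%:R * (edge_count F)%:R - n%:R - 2 * n%:R ^+ 2.
Proof.
have h3 m : (n %| 12 * m)%N && (n %| 9 * m)%N = (n %| 3 * m)%N.
  apply/andP/idP => [[h1 h2]|h].
    by have := dvdn_sub h1 h2; rewrite -mulnBl.
  have := dvdn_mull 4 h; have := dvdn_mull 3 h.
  by rewrite !mulnA.
transitivity (\sum_(0 <= m < n | (n %| 12 * m)%N) W m +
   \sum_(0 <= m < n | (n %| 9 * m)%N) W m - \sum_(0 <= m < n | (n %| 3 * m)%N) W m).
  rewrite [LHS]big_mkcond [in RHS]big_mkcond [X in _ + X - _]big_mkcond /=.
  rewrite [X in _ - X]big_mkcond -big_split -sumrB.
  apply: eq_bigr => m _ /=; rewrite -h3 /smult.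
  by case: (n %| 12 * m)%N; case: (n %| 9 * m)%N => /=; ring.
rewrite (eq_bigr _ W_torsion12) (eq_bigr _ W_torsion9) (eq_bigr _ W_torsion3).
rewrite sumrN sum_torsion12 // sum_torsion9 // sum_torsion3 //.
by ring.
Qed.

(** The constants left over from the torus and torsion sums add up to
    $-(n^3+2n^2+n)/q=-n(n+1)^2/q=-nq$. *)
Lemma hyp_sum_points (t : F) : ratr Mconst^-1 * t = (lam ^+ 36)^-1 ->
  hyp_sum omega Theta alpha beta t =
  (torus_count lam)%:R + (face3_count F)%:R + (face0_count F)%:R + (edge_count F)%:R - n%:R * q%:R.
Proof.
move=> tE; rewrite hyp_sumE tE.
have q0 : q%:R != 0 :> R[i] by rewrite pnatr_eq0 -lt0n cardF_succ.
have n0 : n%:R != 0 :> R[i] by rewrite pnatr_eq0 -lt0n card_units_gt0.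
have qn : q%:R = n%:R + 1 :> R[i] by rewrite natr1 -cardF_succ.
(* As $q=n+1$, the weight is $q^{s(m)-1}=q^{-1}(1+n\,s(m))$ for $s(m)\in\{0,1\}$. *)
have -> : \sum_(0 <= m < n) q%:R ^ ((smult n m)%:Z - 1) * gprod omega Theta m *
    omega (lam ^+ 36)^-1 ^+ m =
  q%:R^-1 * (\sum_(0 <= m < n) W m + n%:R * \sum_(0 <= m < n | smult n m) W m).
  rewrite [X in n%:R * X]big_mkcond !mulr_sumr -big_split mulr_sumr /=.
  apply: eq_bigr => m _; rewrite -mulrA -/(W m); case: (smult n m) => /=.
    by rewrite subrr expr0z -[X in X + _]mul1r -mulrDl [1 + _]addrC -qn mulKf // mul1r.
  by rewrite mulr0 addr0 sub0r.
rewrite sum_smult sum_gprod // qn; rewrite qn in q0; field.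
by rewrite q0 n0.
Qed.

End HypValue.

(** * From projective points to the strata of one affine chart *)

Section Count.
Variable F : finFieldType.
Local Notation q := #|F|.
Local Notation n := (#|F|.-1).

Definition fourth_roots_count := #|[pred u : F | u ^+ 4 + 1 == 0]|.

(** The scalars act freely on nonzero vectors, so every orbit has $q-1$ elements. *)
Lemma card_scalar_orbits (V : finLmodType F) (P : pred V) :
  (forall a x, a != 0 -> P (a *: x) = P x) ->
  (#|[set [set (a *: x)%R | a : F & a != 0%R]%SET | x : V & (x != 0%R) && P x]%SET| * n =
   #|[pred x : V | (x != 0%R) && P x]|)%N.
Proof.
move=> PZ; pose orb (x : V) := [set a *: x | a : F & a != 0]%SET.
have orbP x y : reflect (exists2 a, a != 0 & y = a *: x) (y \in orb x).
  apply: (iffP imsetP) => [[a]|[a a0 ->]]; first by rewrite inE => a0 ->; exists a.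
  by exists a; rewrite ?inE.
have orb_id x : x \in orb x by apply/orbP; exists 1; rewrite ?oner_neq0 ?scale1r.
have orb_eq x y : y \in orb x -> orb y = orb x.
  case/orbP => a a0 ->; apply/setP => z; apply/orbP/orbP => -[b b0 ->].
    by exists (b * a); rewrite ?mulf_neq0 ?scalerA.
  by exists (b / a); rewrite ?mulf_neq0 ?invr_eq0 // scalerA divfK.
pose D := [set x : V | (x != 0) && P x]%SET.
have -> : #|[pred x : V | (x != 0) && P x]| = #|D| by rewrite cardsE.
have -> : [set [set a *: x | a : F & a != 0]%SET | x : V & (x != 0) && P x]%SET = (orb @: D)%SET.
  by apply/setP => A; apply/imsetP/imsetP => -[x xD ->]; exists x; rewrite // ?inE // in xD *.
rewrite -[RHS]sum1_card (partition_big_imset orb) /= -sum_nat_const.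
apply: eq_bigr => _ /imsetP[x xD ->].
have [x0 Px] : x != 0 /\ P x by move: xD; rewrite inE => /andP.
transitivity #|orb x|; last first.
  rewrite -sum1_card; apply: eq_bigl => y.
  apply/idP/andP => [yx|[_ /eqP <-]]; last exact: orb_id.
  split; last by rewrite (orb_eq _ _ yx).
  case/orbP: yx => a a0 ->; rewrite inE PZ // Px andbT.
  by rewrite scaler_eq0 negb_or a0.
rewrite card_in_imset ?cardsE ?card_neq0 // => a b _ _ /eqP.
by rewrite -subr_eq0 -scalerBl scaler_eq0 (negbTE x0) orbF subr_eq0 => /eqP.
Qed.

Definition quartic_form (lam u0 u1 u2 u3 : F) : F :=
  u0 ^+ 3 * u1 + u1 ^+ 3 * u2 + u2 ^+ 4 + u3 ^+ 4 + lam * u0 * u1 * u2 * u3.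

Lemma quartic_formZ lam a u0 u1 u2 u3 :
  quartic_form lam (a * u0) (a * u1) (a * u2) (a * u3) = a ^+ 4 * quartic_form lam u0 u1 u2 u3.
Proof. by rewrite /quartic_form; ring. Qed.

Local Notation zc lam u0 u1 u2 u3 := (nat_of_bool (quartic_form lam%R u0%R u1%R u2%R u3%R == 0%R)).

Definition chart_count lam := (\sum_(u1 : F) \sum_(u0 : F) \sum_(u3 : F) zc lam u0 u1 1 u3)%N.

Lemma sum_split0 (f : F -> nat) : (\sum_x f x = f 0%R + \sum_(x | x != 0%R) f x)%N.
Proof. by rewrite (bigD1 0). Qed.

Lemma card_nz2 (P : F -> F -> bool) :
  #|[pred u : F * F | nz2 u && P u.1 u.2]| =
  (\sum_(x | x != 0%R) \sum_(y | y != 0%R) P x y)%N.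
Proof.
rewrite (pair_big (fun x : F => x != 0) (fun y : F => y != 0) (fun x y => P x y : nat)) /=.
rewrite -sum1_card big_mkcondr /=; by apply: eq_big => [[x y]|[x y] _] //=; case: (P x y).
Qed.

Lemma card_nz3 (P : F -> F -> F -> bool) :
  #|[pred u : F * F * F | nz3 u && P u.1.1 u.1.2 u.2]| =
  (\sum_(x | x != 0%R) \sum_(y | y != 0%R) \sum_(z | z != 0%R) P x y z)%N.
Proof.
rewrite (pair_big (fun x : F => x != 0) (fun y : F => y != 0)
  (fun x y => \sum_(z | z != 0%R) P x y z)%N) /=.
rewrite (pair_big (fun u : F * F => (u.1 != 0) && (u.2 != 0)) (fun y : F => y != 0)
  (fun u z => P u.1 u.2 z : nat)) /=.
rewrite -sum1_card big_mkcondr /=; by apply: eq_big => [[[x y] z]|[[x y] z] _] //=; case: (P x y z).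
Qed.

(** For $x_1=0$ the equation is $x_3^4+1=0$ with $x_0$ free. For $x_1\ne0$ the chart is cut
    according to the vanishing of $x_0$ and of $x_3$. *)
Lemma chart_count_strata lam : chart_count lam =
  (torus_count lam + face3_count F + face0_count F + edge_count F +
   q * fourth_roots_count)%N.
Proof.
have P0 k : (0 : F) ^+ k.+1 = 0 by rewrite expr0n.
rewrite /chart_count sum_split0.
have -> : (\sum_u0 \sum_u3 zc lam u0 0 1 u3 = q * fourth_roots_count)%N.
  rewrite -sum_nat_const; apply: eq_bigr => u0 _.
  rewrite /fourth_roots_count -sum1_card [RHS]big_mkcond; apply: eq_bigr => u3 _ /=.
  by rewrite /quartic_form P0 !(mulr0, mul0r, expr1n, add0r, addr0) addrC inE; case: eqP.
have -> : (\sum_(u1 | u1 != 0%R) \sum_u0 \sum_u3 zc lam u0 u1 1 u3 =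
  \sum_(u1 | u1 != 0%R) zc lam 0 u1 1 0 +
  \sum_(u1 | u1 != 0%R) \sum_(u3 | u3 != 0%R) zc lam 0 u1 1 u3 +
  (\sum_(u1 | u1 != 0%R) \sum_(u0 | u0 != 0%R) zc lam u0 u1 1 0 +
   \sum_(u1 | u1 != 0%R) \sum_(u0 | u0 != 0%R) \sum_(u3 | u3 != 0%R) zc lam u0 u1 1 u3))%N.
  rewrite -!big_split; apply: eq_bigr => u1 u10; rewrite sum_split0 sum_split0 /=.
  by congr addn; rewrite -big_split; apply: eq_bigr => u0 _; rewrite sum_split0.
have -> : (\sum_(u1 | u1 != 0%R) zc lam 0 u1 1 0 = edge_count F)%N.
  rewrite /edge_count -sum1_card big_mkcondr; apply: eq_bigr => u1 _ /=.
  rewrite /quartic_form !P0 !(mulr0, mul0r, mulr1, expr1n, add0r, addr0).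
  by case: eqP.
have -> : (\sum_(u1 | u1 != 0%R) \sum_(u3 | u3 != 0%R) zc lam 0 u1 1 u3 = face0_count F)%N.
  rewrite /face0_count (card_nz2 (fun u v => u ^+ 3 + 1 + v ^+ 4 == 0)).
  apply: eq_bigr => u1 _; apply: eq_bigr => u3 _.
  by rewrite /quartic_form !P0 !(mulr0, mul0r, mulr1, expr1n, add0r, addr0).
rewrite exchange_big /=.
have -> : (\sum_(u0 | u0 != 0%R) \sum_(u1 | u1 != 0%R) zc lam u0 u1 1 0 = face3_count F)%N.
  rewrite /face3_count (card_nz2 (fun u v => u ^+ 3 * v + v ^+ 3 + 1 == 0)).
  apply: eq_bigr => u0 _; apply: eq_bigr => u1 _.
  by rewrite /quartic_form !P0 !(mulr0, mul0r, mulr1, expr1n, add0r, addr0).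
rewrite exchange_big /=.
have -> : (\sum_(u0 | u0 != 0%R) \sum_(u1 | u1 != 0%R) \sum_(u3 | u3 != 0%R)
    zc lam u0 u1 1 u3 = torus_count lam)%N.
  rewrite /torus_count (card_nz3 (fun u v w => u ^+ 3 * v + v ^+ 3 + 1 + w ^+ 4 + lam * u * v * w == 0)).
  apply: eq_bigr => u0 _; apply: eq_bigr => u1 _; apply: eq_bigr => u3 _.
  by rewrite /quartic_form !(mulr1, expr1n).
lia.
Qed.

Lemma sum_scale (a : F) (f : F -> nat) : a != 0 -> (\sum_x f (a * x)%R = \sum_x f x)%N.
Proof.
move=> a0; rewrite [RHS](reindex_onto (fun x => a * x) (fun x => a^-1 * x)) /=.
  by apply: eq_bigl => x; rewrite mulrA mulVf // mul1r eqxx.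
by move=> x _; rewrite mulrA mulfV // mul1r.
Qed.

(** For $x_2=a\ne0$, scaling by $a$ reduces to the chart $x_2=1$; the plane $x_2=0$ contributes
    $q^2$. *)
Lemma affine_count lam :
  (\sum_x2 \sum_x1 \sum_x0 \sum_x3 zc lam x0 x1 x2 x3 = q ^ 2 + n * chart_count lam)%N.
Proof.
have P0 k : (0 : F) ^+ k.+1 = 0 by rewrite expr0n.
rewrite sum_split0; congr addn; last first.
  rewrite -card_neq0 -sum_nat_const; apply: eq_bigr => a a0.
  rewrite /chart_count -(sum_scale _ a0); apply: eq_bigr => u1 _.
  rewrite -(sum_scale _ a0); apply: eq_bigr => u0 _.
  rewrite -(sum_scale _ a0); apply: eq_bigr => u3 _.
  by rewrite -{3}[a]mulr1 quartic_formZ mulf_eq0 expf_eq0 (negbTE a0).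
(* On $x_2=0$ there remains $x_0^3x_1+x_3^4=0$. If $x_0=0$ then $x_3=0$ and $x_1$ is free; otherwise
   $x_1$ is determined by $x_3$. This gives $q+(q-1)q=q^2$ solutions. *)
transitivity (\sum_(x1 : F) \sum_(x0 : F) \sum_(x3 : F) (x0 ^+ 3 * x1 + x3 ^+ 4 == 0)%R)%N.
  apply: eq_bigr => x1 _; apply: eq_bigr => x0 _; apply: eq_bigr => x3 _.
  by rewrite /quartic_form !P0 !(mulr0, mul0r, addr0).
rewrite exchange_big sum_split0 /=.
have -> : (\sum_(x1 : F) \sum_(x3 : F) (0 ^+ 3 * x1 + x3 ^+ 4 == 0)%R = q)%N.
  rewrite -[RHS]muln1 -sum_nat_const; apply: eq_bigr => x1 _.
  rewrite sum_split0 !P0 mul0r addr0 eqxx big1 // => x3 x30.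
  by rewrite add0r expf_eq0 (negbTE x30).
rewrite (eq_bigr (fun=> q)); last first.
  move=> x0 x00; rewrite exchange_big -[RHS]muln1 -sum_nat_const; apply: eq_bigr => x3 _.
  rewrite (bigD1 (- x3 ^+ 4 / x0 ^+ 3)) //= mulrCA divff ?expf_neq0 // mulr1 addNr eqxx.
  rewrite big1 // => x1 hx; apply/eqP; rewrite eqb0; apply: contra hx.
  rewrite addr_eq0 => /eqP <-; apply/eqP; field; exact: x00.
by rewrite sum_nat_const card_neq0 [in RHS]cardF_succ; rewrite [in LHS]cardF_succ /=; ring.
Qed.

(** Removing the zero vector from the affine count leaves $q^2-1+n\cdot\mathrm{chart}$, and division
    by $n=q-1$ gives the formula. *)
Lemma num_pointsE psi :
  num_points psi = (chart_count (- (36 * psi)) + q + 1)%N.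
Proof.
set lam := - _.
pose tov (z : F * F * F * F) : 'rV[F]_4 := \row_i nth 0 [:: z.1.1.1; z.1.1.2; z.1.2; z.2] i.
pose fromv (x : 'rV[F]_4) := (x 0 0, x 0 1, x 0 2, x 0 3).
have tovK : cancel tov fromv by move=> [[[a b] c] d]; rewrite /fromv !mxE.
have fromvK : cancel fromv tov.
  move=> x; apply/rowP => i; rewrite mxE /=.
  case: i => -[|[|[|[|//]]]] hi /=; congr (x _ _); exact: val_inj.
have quarticE (x : 'rV[F]_4) : quartic psi x = quartic_form lam (x 0 0) (x 0 1) (x 0 2) (x 0 3).
  by rewrite /quartic /quartic_form /lam; ring.
have qZ a (x : 'rV[F]_4) : a != 0 -> (quartic psi (a *: x) == 0) = (quartic psi x == 0).
  by move=> a0; rewrite !quarticE !mxE quartic_formZ mulf_eq0 expf_eq0 (negbTE a0).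
have := card_scalar_orbits qZ; rewrite -/(num_points psi) => H.
apply/eqP; rewrite -(eqn_pmul2r (card_units_gt0 F)) H; apply/eqP.
have q00 : quartic psi 0 == 0.
  by rewrite quarticE !mxE /quartic_form !(expr0n, mulr0, addr0).
have E : (\sum_(x : 'rV[F]_4) (quartic psi x == 0)%R = q ^ 2 + n * chart_count lam)%N.
  rewrite -affine_count pair_bigA pair_bigA pair_bigA /=.
  rewrite (reindex (fun z => tov (z.1.2, z.1.1.2, z.1.1.1, z.2))); last first.
    apply: onW_bij.
    exists (fun x => let z := fromv x in (z.1.2, z.1.1.2, z.1.1.1, z.2)) => [[[[a b] c] d]|x].
      by rewrite tovK.
    by rewrite fromvK.
  apply: eq_bigr => z _.
  by rewrite quarticE !mxE.
move: E; rewrite (bigD1 0) //= q00 => E.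
have -> : #|[pred x | (x != 0) && (quartic psi x == 0)]| =
   (\sum_(x : 'rV[F]_4 | x != 0%R) (quartic psi x == 0)%R)%N.
  by rewrite -sum1_card big_mkcondr; apply: eq_bigr => x _; case: eqP.
apply: (@addnI 1); rewrite E.
move: (cardF_succ F); case: (#|F|) => // k _ /=.
by rewrite -addn1; ring.
Qed.

End Count.

Lemma prim8_pow4 (S : idomainType) (r : S) : 8.-primitive_root r -> r ^+ 4 = -1.
Proof.
move=> rP; have : (r ^+ 4 - 1) * (r ^+ 4 + 1) = 0.
  by rewrite -subr_sqr expr1n -exprM (prim_expr_order rP) subrr.
move/eqP; rewrite mulf_eq0 => /orP[|]; last by rewrite addr_eq0 => /eqP.
by rewrite subr_eq0 -[1](expr0 r) (eq_prim_root_expr rP).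
Qed.

(** * A bound for the point count, and the fourth roots of -1 *)

Section CountBounds.
Variable F : finFieldType.
Local Notation q := #|F|.
Local Notation n := (#|F|.-1).

Lemma card_roots_le (p : {poly F}) : p != 0 -> (#|[pred x | root p x]| <= (size p).-1)%N.
Proof.
move=> p0; rewrite cardE; have := max_poly_roots p0 (rs := enum [pred x | root p x]).
rewrite enum_uniq => /(_ _ isT) h; rewrite -ltnS prednK ?h ?size_poly_gt0 //.
by apply/allP => x; rewrite mem_enum.
Qed.

(** For fixed $x_0,x_1$ the equation is monic of degree 4 in $x_3$. This bound serves the
    convergence of the local series. *)
Lemma chart_count_le lam : (chart_count (F := F) lam <= 4 * q ^ 2)%N.
Proof.
have qq : (4 * q ^ 2 = \sum_(u1 : F) \sum_(u0 : F) 4)%N.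
  by rewrite !sum_nat_const; ring.
rewrite qq /chart_count; apply: leq_sum => u1 _; apply: leq_sum => u0 _.
pose c := u0 ^+ 3 * u1 + u1 ^+ 3 + 1.
pose r : {poly F} := (lam * u0 * u1) *: 'X + c%:P.
have sr : (size r < 5)%N.
  rewrite ltnS; apply: leq_trans (size_polyD _ _) _; rewrite geq_max.
  rewrite (leq_trans (size_scale_leq _ _)) ?size_polyX //=.
  by rewrite (leq_trans (size_polyC_leq1 _)).
have sp : size ('X^4 + r) = 5 by rewrite size_polyDl size_polyXn.
have p0 : 'X^4 + r != 0 by rewrite -size_poly_eq0 sp.
suff -> : (\sum_u3 (quartic_form lam u0 u1 1 u3 == 0)%R = #|[pred x | root ('X^4 + r) x]|)%N.
  by rewrite (leq_trans (card_roots_le p0)) // sp.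
rewrite -sum1_card [RHS]big_mkcond /=.
apply: eq_bigr => x _; rewrite inE rootE !hornerE /=.
rewrite (_ : quartic_form _ _ _ _ _ = x ^+ 4 + lam * u0 * u1 * x + u0 ^+ 3 * u1 + u1 ^+ 3 + 1);
  last by rewrite /quartic_form; ring.
by case: eqP.
Qed.

Hypothesis two0 : 2 != 0 :> F.

Lemma prim8E (r u : F) : 8.-primitive_root r -> u ^+ 4 + 1 = 0 ->
  exists2 i : 'I_8, odd i & u = r ^+ i.
Proof.
move=> rP u4; have r4 := prim8_pow4 rP.
have u8 : u ^+ 8 = 1.
  have -> : u ^+ 8 = (u ^+ 4 + 1) * (u ^+ 4 - 1) + 1 by ring.
  by rewrite u4 mul0r add0r.
have [i iE] := prim_rootP rP u8; exists i => //.
apply/negP => /negP oi; move/eqP: u4.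
rewrite iE -exprM mulnC exprM r4 -signr_odd (negbTE oi) expr0.
by rewrite (_ : 1 + 1 = 2) // (negbTE two0).
Qed.

Lemma finField_prim8 : (8 %| n)%N -> exists r : F, 8.-primitive_root r.
Proof.
move=> h; have [g gP] := finField_prim_root F.
by exists (g ^+ (n %/ 8)); exact: (dvdn_prim_root gP h).
Qed.

(** If $8\mid n$, the solutions of $u^4=-1$ are the odd powers of a primitive 8-th root of unity.
    Conversely a solution $g^i$ has $n\mid8i$ but $n\nmid4i$, so $8i=jn$ with $j$ odd, and $8\mid
    n$. *)
Lemma card_fourth_roots : fourth_roots_count F = if (8 %| n)%N then 4 else 0%N.
Proof.
case: ifP => h8.
  have [r rP] := finField_prim8 h8.
  transitivity #|[set r ^+ (i : nat) | i : 'I_8 & odd i]%SET|.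
    apply: eq_card => u; rewrite inE; apply/eqP/imsetP => [u4|].
      by have [i oi ->] := prim8E rP u4; exists i; rewrite ?inE.
    case=> k; rewrite inE => oi ->; rewrite -exprM mulnC exprM (prim8_pow4 rP) -signr_odd oi.
    by rewrite expr1 addNr.
  rewrite card_in_imset ?cardsE.
    by rewrite -sum1_card big_mkcond !big_ord_recl big_ord0.
  move=> i j _ _ /eqP; rewrite (eq_prim_root_expr rP) /= !modn_small ?ltn_ord // => /eqP.
  exact: val_inj.
apply: eq_card0 => u; rewrite inE; apply/negbTE/negP => /eqP u4.
have [g gP] := finField_prim_root F.
have u0 : u != 0.
  by apply/eqP => e; move/eqP: u4; rewrite e expr0n add0r oner_eq0.
have [i iE] := prim_rootP gP (expf_card1 u0).
have um : u ^+ 4 = -1 by apply/eqP; rewrite -addr_eq0 u4.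
have u8 : u ^+ 8 = 1.
  have -> : u ^+ 8 = u ^+ 4 * u ^+ 4 by ring.
  by rewrite um mulrNN mulr1.
have d1 : (n %| i * 8)%N by rewrite (prim_order_dvd gP) exprM -iE u8.
have d2 : ~~ (n %| i * 4)%N.
  rewrite (prim_order_dvd gP) exprM -iE um eq_sym -subr_eq0 opprK.
  by rewrite (_ : 1 + 1 = 2).
case/dvdnP: d1 => j jE.
have oj : odd j.
  apply/negP => /negP ej; move/negP: d2; apply; apply/dvdnP; exists j./2.
  have : j = (j./2 * 2)%N by rewrite muln2 even_halfK.
  by move=> jj; move: jE; rewrite {1}jj; lia.
move/negP: h8; apply.
have c8 : coprime 8 j by rewrite (_ : 8 = 2 ^ 3)%N // coprimeXl // coprime2n.
by rewrite -(Gauss_dvdr _ c8) -jE dvdn_mull.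
Qed.

End CountBounds.

(** * Complex limits, logarithms and Euler products *)

Section ComplexLimits.
Variable R : realType.
Local Notation C := R[i].
Implicit Types (u v a b : nat -> C) (z w l : C).

Definition cvgC u l : Prop := ((u : nat -> C^o) @ \oo --> (l : C^o))%classic.

Lemma limC_cvg u l : cvgC u l -> limC u = l.
Proof. exact: (@cvg_lim C^o (@norm_hausdorff C C^o) nat \oo%classic _ u l). Qed.

Lemma limC_dvg u : ~ (exists l, cvgC u l) -> limC u = 0.
Proof.
move=> h; apply: (@dvgP C^o ((u : nat -> C^o) @ \oo)%classic) => ul; apply: h.
by exists (limC u).
Qed.

Lemma cvgC_cst z : cvgC (fun=> z) z.
Proof. exact: cvg_cst. Qed.

Lemma cvgCD u v l m : cvgC u l -> cvgC v m -> cvgC (fun n => u n + v n) (l + m).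
Proof. by move=> ul vm; apply: (cvgD ul vm). Qed.

Lemma cvgCM u v l m : cvgC u l -> cvgC v m -> cvgC (fun n => u n * v n) (l * m).
Proof. by move=> ul vm; apply: (cvgM ul vm). Qed.

Lemma cvgCV u l : l != 0 -> cvgC u l -> cvgC (fun n => (u n)^-1) l^-1.
Proof. by move=> l0 ul; apply: (cvgV l0 ul). Qed.

Lemma limC_ext u v : (forall n, u n = v n) -> limC u = limC v.
Proof. by move=> e; congr limC; apply/funext. Qed.

(* also for divergent [v], both sides being then 0 *)
Lemma limCM_nz u v l : l != 0 -> (forall n, u n != 0) -> cvgC u l ->
  limC (fun n => u n * v n) = l * limC v.
Proof.
move=> l0 u0 ul; have [[m vm]|h] := pselect (exists m, cvgC v m).
  by rewrite (limC_cvg vm) (limC_cvg (cvgCM ul vm)).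
rewrite (limC_dvg h) mulr0; apply: limC_dvg => -[m uvm]; apply: h.
exists (l^-1 * m).
have -> : v = (fun n => (u n)^-1 * (u n * v n)) by apply/funext => n; rewrite mulKf.
exact: cvgCM (cvgCV l0 ul) uvm.
Qed.

Definition normR z : R := complex.Re `|z|.

Lemma norm_normR z : `|z| = (normR z)%:C.
Proof. by rewrite /normR normc_def. Qed.

Lemma normRE z : normR z = Num.sqrt (complex.Re z ^+ 2 + complex.Im z ^+ 2).
Proof. by rewrite /normR normc_def; case: z. Qed.

Lemma normR_ge0 z : 0 <= normR z.
Proof. by rewrite normRE sqrtr_ge0. Qed.

Lemma normRM z w : normR (z * w) = normR z * normR w.
Proof. by apply: complexI; rewrite -norm_normR normrM !norm_normR -rmorphM. Qed.

Lemma normR1 : normR 1 = 1.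
Proof. by apply: complexI; rewrite -norm_normR normr1. Qed.

Lemma normRX z n : normR (z ^+ n) = normR z ^+ n.
Proof. by elim: n => [|n ih]; rewrite ?expr0 ?normR1 // !exprS normRM ih. Qed.

Lemma normRV z : normR z^-1 = (normR z)^-1.
Proof. by apply: complexI; rewrite -norm_normR normfV !norm_normR -fmorphV. Qed.

Lemma normRN z : normR (- z) = normR z.
Proof. by rewrite /normR normrN. Qed.

Lemma normR_nat n : normR n%:R = n%:R.
Proof. by apply: complexI; rewrite -norm_normR normr_nat rmorph_nat. Qed.

Lemma normRD z w : normR (z + w) <= normR z + normR w.
Proof. by rewrite -lecR rmorphD /= -!norm_normR ler_normD. Qed.

Lemma normR_sum (I : Type) (r : seq I) (P : pred I) (f : I -> C) :
  normR (\sum_(i <- r | P i) f i) <= \sum_(i <- r | P i) normR (f i).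
Proof.
elim/big_rec2: _ => [|i x y _ h]; first by rewrite -[0]/(0%:R) normR_nat.
by apply: le_trans (normRD _ _) _; rewrite lerD2l.
Qed.

Lemma Re_le_normR z : `|complex.Re z| <= normR z.
Proof. by rewrite normRE -sqrtr_sqr ler_wsqrtr // lerDl sqr_ge0. Qed.

Lemma Im_le_normR z : `|complex.Im z| <= normR z.
Proof. by rewrite normRE -sqrtr_sqr ler_wsqrtr // lerDr sqr_ge0. Qed.

Lemma normR_le_parts z : normR z <= `|complex.Re z| + `|complex.Im z|.
Proof.
rewrite -(@ger0_norm _ (_ + _)) ?addr_ge0 // -sqrtr_sqr normRE ler_wsqrtr // sqrrD.
rewrite !real_normK ?num_real // addrAC lerDl mulrn_wge0 // mulr_ge0 //.
Qed.

Lemma cvgC_normR u l : cvgC u l <->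
  (forall e : R, 0 < e -> \forall n \near \oo, normR (l - u n) < e)%classic.
Proof.
split=> [/cvgrPdist_lt h e e0|h].
  have e0' : (0 : C) < e%:C by rewrite ltcR.
  near=> n; rewrite -ltcR -norm_normR; near: n; exact: h.
apply/cvgrPdist_lt => e e0.
(* In the order of [C], $0<e$ forces $e$ to be real. *)
have eE : e = (complex.Re e)%:C by move: e0; rewrite ltcE => /andP[/eqP]; case: e => a b /= ->.
near=> n; rewrite norm_normR eE ltcR; near: n; apply: h.
by move: e0; rewrite ltcE => /andP[_].
Unshelve. all: by end_near.
Qed.

Lemma cvgC_parts u l : cvgC u l <->
  ((fun n => complex.Re (u n)) @ \oo --> complex.Re l)%classic /\
  ((fun n => complex.Im (u n)) @ \oo --> complex.Im l)%classic.
Proof.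
split=> [/cvgC_normR h|[/cvgrPdist_lt h1 /cvgrPdist_lt h2]].
  split; apply/cvgrPdist_lt => e e0; near=> n.
    rewrite -raddfB; apply: le_lt_trans (Re_le_normR _) _; near: n; exact: h.
  rewrite -raddfB; apply: le_lt_trans (Im_le_normR _) _; near: n; exact: h.
apply/cvgC_normR => e e0; have e20 : 0 < e / 2 by rewrite divr_gt0.
near=> n; apply: le_lt_trans (normR_le_parts _) _; rewrite !raddfB /=.
rewrite [e]splitr ltrD //; near: n; [exact: h1|exact: h2].
Unshelve. all: by end_near.
Qed.

Lemma cvgC_le u l (B : R) : cvgC u l -> (forall n, normR (u n) <= B) -> normR l <= B.
Proof.
move=> /cvgC_normR h hB; apply/ler_addgt0Pr => e e0.
have [n _ hn] := h e e0.
have := hn n (leqnn _) => /= hne.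
rewrite -[l](subrK (u n)) addrC; apply: le_trans (normRD _ _) _.
by rewrite lerD // ltW.
Qed.

Lemma expC_cvg u l : cvgC u l -> cvgC (fun n => expC (u n)) (expC l).
Proof.
case/cvgC_parts => h1 h2; apply/cvgC_parts; rewrite /expC /=.
have cR : ((fun n => expR (complex.Re (u n))) @ \oo --> expR (complex.Re l))%classic.
  exact: continuous_cvg (@continuous_expR R _) h1.
have cc : ((fun n => cos (complex.Im (u n))) @ \oo --> cos (complex.Im l))%classic.
  exact: continuous_cvg (@continuous_cos R _) h2.
have cs : ((fun n => sin (complex.Im (u n))) @ \oo --> sin (complex.Im l))%classic.
  exact: continuous_cvg (@continuous_sin R _) h2.
split.
  have -> : (fun n => expR (complex.Re (u n)) * cos (complex.Im (u n)) -
      0 * sin (complex.Im (u n))) = (fun n => expR (complex.Re (u n)) * cos (complex.Im (u n))).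
    by apply/funext => n; rewrite mul0r subr0.
  by rewrite mul0r subr0; exact: (cvgM cR cc).
have -> : (fun n => expR (complex.Re (u n)) * sin (complex.Im (u n)) +
    0 * cos (complex.Im (u n))) = (fun n => expR (complex.Re (u n)) * sin (complex.Im (u n))).
  by apply/funext => n; rewrite mul0r addr0.
by rewrite mul0r addr0; exact: (cvgM cR cs).
Qed.

Definition summableC a : Prop :=
  exists B : R, forall n, \sum_(1 <= m < n) normR (a m) <= B.

Lemma real_abs_series (f : nat -> R) (B : R) :
  (forall n, \sum_(1 <= m < n) `|f m| <= B) ->
  exists l : R, ((fun n => \sum_(1 <= m < n) f m) @ \oo --> l)%classic.
Proof.
(* [f'] kills the term of index 0, so the sums from 1 become the partial sums of a series from 0. *)
move=> hB; pose f' k := if k is 0%N then 0 else f k.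
have e1 n (h : R -> R) : h 0 = 0 -> \sum_(1 <= m < n) h (f m) = \sum_(0 <= m < n) h (f' m).
  move=> h0; case: n => [|n]; first by rewrite !big_geq.
  rewrite [RHS]big_ltn // h0 add0r; apply: eq_big_nat => -[//|m] _.
  by [].
have : cvgn [normed series f'].
  apply: nondecreasing_is_cvgn.
    by apply: nondecreasing_series => k _ _; exact: normr_ge0.
  exists B => _ [n _ <-]; have := hB n; rewrite (e1 n Num.norm) ?normr0 //.
move=> hn; have h := @normed_cvg R R^o f' hn; exists (lim (series f' @ \oo)%classic).
have -> : (fun n => \sum_(1 <= m < n) f m) = series f'.
  by apply/funext => n; rewrite (e1 n id).
exact: h.
Qed.

Lemma summableC_cvg a : summableC a -> exists l, cvgC (fun n => \sum_(1 <= m < n) a m) l.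
Proof.
case=> B hB.
have [|l1 h1] := @real_abs_series (fun m => complex.Re (a m)) B.
  by move=> n; apply: le_trans (hB n); apply: ler_sum => m _; exact: Re_le_normR.
have [|l2 h2] := @real_abs_series (fun m => complex.Im (a m)) B.
  by move=> n; apply: le_trans (hB n); apply: ler_sum => m _; exact: Im_le_normR.
exists (l1 +i* l2); apply/cvgC_parts; split => /=.
  by under eq_fun do rewrite raddf_sum.
by under eq_fun do rewrite raddf_sum.
Qed.

End ComplexLimits.

(** * The identity $\exp(\sum z^m/m)=1/(1-z)$ on the unit disc *)

Section LogSeries.
Variable R : realType.
Local Notation C := R[i].
Implicit Types (z w : C).

Definition logsum z n : C := \sum_(1 <= m < n) z ^+ m / m%:R.

Lemma geom_le (r : R) n : 0 <= r < 1 -> \sum_(1 <= m < n) r ^+ m <= r / (1 - r).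
Proof.
move=> /andP[r0 r1]; have r1' : 0 < 1 - r by rewrite subr_gt0.
rewrite ler_pdivlMr //; elim: n => [|n ih]; first by rewrite big_geq // mul0r.
case: n ih => [|n] ih; first by rewrite big_geq // mul0r.
suff -> : (\sum_(1 <= m < n.+2) r ^+ m) * (1 - r) = r - r ^+ n.+2.
  by rewrite gerBl exprn_ge0.
elim: n {ih} => [|n ih]; first by rewrite big_nat1; ring.
by rewrite big_nat_recr //= mulrDl ih !exprS; ring.
Qed.

Lemma logsum_summable z : normR z < 1 -> summableC (fun m => z ^+ m / m%:R).
Proof.
move=> z1; exists (normR z / (1 - normR z)) => n.
apply: le_trans (geom_le n _); last by rewrite normR_ge0.
rewrite big_nat_cond [leRHS]big_nat_cond; apply: ler_sum => m /andP[/andP[m1 _] _].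
rewrite normRM normRX normRV normR_nat ler_piMr ?exprn_ge0 ?normR_ge0 // invf_le1 ?ltr0n //.
by rewrite ler1n.
Qed.

Lemma normR_logsum_le z n : normR z < 1 -> normR (logsum z n) <= normR z / (1 - normR z).
Proof.
move=> z1; apply: le_trans (geom_le n _); last by rewrite normR_ge0.
apply: le_trans (normR_sum _ _ _) _.
rewrite big_nat_cond [leRHS]big_nat_cond; apply: ler_sum => m /andP[/andP[m1 _] _].
rewrite normRM normRX normRV normR_nat ler_piMr ?exprn_ge0 ?normR_ge0 // invf_le1 ?ltr0n //.
by rewrite ler1n.
Qed.

Section Ray.
Variables (z : C) (n : nat).
Hypothesis z1 : normR z < 1.
Let a := complex.Re z.
Let b := complex.Im z.
(** [A t] and [B t] are the real and imaginary parts of the partial logarithm series at $tz$, and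
    [A'], [B'] are their derivatives. The function studied on the ray $t\in[0,1]$ is
    $f(t)=e^{A+iB}(1-tz)$, with parts [fr] and [fi]: it is 1 at $t=0$ and should be nearly 1 at
    $t=1$. *)
Let A (t : R) := \sum_(1 <= m < n) complex.Re (z ^+ m) / m%:R * t ^+ m.
Let B (t : R) := \sum_(1 <= m < n) complex.Im (z ^+ m) / m%:R * t ^+ m.
Let A' (t : R) := \sum_(1 <= m < n) complex.Re (z ^+ m) * t ^+ m.-1.
Let B' (t : R) := \sum_(1 <= m < n) complex.Im (z ^+ m) * t ^+ m.-1.

Lemma is_derive_polysum (c : nat -> R) k (t : R) :
  is_derive t 1 (fun t => \sum_(1 <= m < k) c m / m%:R * t ^+ m)
    (\sum_(1 <= m < k) c m * t ^+ m.-1).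
Proof.
elim: k => [|[|k] ih].
- rewrite big_geq //; under eq_fun do rewrite big_geq //.
  exact: is_derive_cst.
- rewrite big_geq //; under eq_fun do rewrite big_geq //.
  exact: is_derive_cst.
rewrite big_nat_recr //=; under eq_fun do rewrite big_nat_recr //=.
apply: is_deriveD.
have h : is_derive t 1 (fun x : R => x ^+ k.+1) (k.+1%:R * t ^+ k).
  have := is_deriveX k.+1 (is_derive_id t (1 : R)).
  by rewrite exprfctE /= scaler1.
have := is_deriveZ (c k.+1 / k.+1%:R) h.
by rewrite -[_ *: _]/(_ * _) mulrA divfK ?pnatr_eq0.
Qed.

Let w t := - z * (t%:C * z) ^+ n.-1.

(** The geometric sum telescopes to $z(1-(tz)^{n-1})$. Hence $f'=e^{A+iB}w$ with the single small
    term $w(t)=-z(tz)^{n-1}$. *)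
Lemma ray_identity (t : R) : (0 < n)%N ->
  (A' t +i* B' t) * (1 - t%:C * z) - z = w t.
Proof.
have ReM (x : C) (r : R) : complex.Re (x * r%:C) = complex.Re x * r.
  by case: x => x y /=; rewrite mulr0 subr0.
have ImM (x : C) (r : R) : complex.Im (x * r%:C) = complex.Im x * r.
  by case: x => x y /=; rewrite mulr0 add0r.
have -> : A' t +i* B' t = \sum_(1 <= m < n) z ^+ m * (t ^+ m.-1)%:C.
  apply/eqP; rewrite eq_complex /= !raddf_sum /=; apply/andP; split; apply/eqP.
    by apply: eq_bigr => m _; rewrite ReM.
  by apply: eq_bigr => m _; rewrite ImM.
rewrite /w; case: n => // k _ /=.
elim: k => [|k ih]; first by rewrite big_geq // !expr0; ring.
rewrite big_nat_recr //= mulrDl addrAC ih rmorphXn /= !exprMn !exprS.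
ring.
Qed.

Let e1 (t : R) := 1 - t * a.
Let e2 (t : R) := - (t * b).

Lemma ray_parts (t : R) : (0 < n)%N ->
  A' t * e1 t - B' t * e2 t - a = complex.Re (w t) /\
  A' t * e2 t + B' t * e1 t - b = complex.Im (w t).
Proof.
move=> n0; have E : 1 - t%:C * z = e1 t +i* e2 t.
  by rewrite /e1 /e2 /a /b; case: z => x y; apply/eqP; rewrite eq_complex /=;
     apply/andP; split; apply/eqP; ring.
have := ray_identity t n0; rewrite E => <-.
by rewrite !raddfB.
Qed.

Let fr (t : R) := expR (A t) * (cos (B t) * e1 t - sin (B t) * e2 t).
Let fi (t : R) := expR (A t) * (cos (B t) * e2 t + sin (B t) * e1 t).

Lemma is_derive_fr (t : R) : (0 < n)%N -> is_derive t 1 fr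
  (expR (A t) * (cos (B t) * complex.Re (w t) - sin (B t) * complex.Im (w t))).
Proof.
move=> n0; have [h1 h2] := ray_parts t n0; rewrite -h1 -h2.
have dA : is_derive t 1 A (A' t) by exact: is_derive_polysum.
have dB : is_derive t 1 B (B' t) by exact: is_derive_polysum.
have dE : is_derive t 1 (expR \o A) (expR (A t) * A' t) by exact: is_derive1_comp.
have dC : is_derive t 1 (cos \o B) (- sin (B t) * B' t) by exact: is_derive1_comp.
have dS : is_derive t 1 (sin \o B) (cos (B t) * B' t) by exact: is_derive1_comp.
have d1 : is_derive t 1 e1 (- a).
  have := is_deriveB (is_derive_cst (1 : R) t 1) (is_deriveM (is_derive_id t (1 : R)) (is_derive_cst a t 1)).
  by rewrite scaler0 !add0r -[_ *: 1]/(a * 1) mulr1.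
have d2 : is_derive t 1 e2 (- b).
  have := is_deriveN (is_deriveM (is_derive_id t (1 : R)) (is_derive_cst b t 1)).
  by rewrite scaler0 add0r -[_ *: 1]/(b * 1) mulr1.
have := is_deriveM dE (is_deriveB (is_deriveM dC d1) (is_deriveM dS d2)).
move/is_derive_eq; apply; rewrite /= -![_ *: _]/(_ * _).
have -> : ((cos \o B) * e1 - (sin \o B) * e2) t = cos (B t) * e1 t - sin (B t) * e2 t by [].
by ring.
Qed.

Lemma is_derive_fi (t : R) : (0 < n)%N -> is_derive t 1 fi
  (expR (A t) * (cos (B t) * complex.Im (w t) + sin (B t) * complex.Re (w t))).
Proof.
move=> n0; have [h1 h2] := ray_parts t n0; rewrite -h1 -h2.
have dA : is_derive t 1 A (A' t) by exact: is_derive_polysum.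
have dB : is_derive t 1 B (B' t) by exact: is_derive_polysum.
have dE : is_derive t 1 (expR \o A) (expR (A t) * A' t) by exact: is_derive1_comp.
have dC : is_derive t 1 (cos \o B) (- sin (B t) * B' t) by exact: is_derive1_comp.
have dS : is_derive t 1 (sin \o B) (cos (B t) * B' t) by exact: is_derive1_comp.
have d1 : is_derive t 1 e1 (- a).
  have := is_deriveB (is_derive_cst (1 : R) t 1) (is_deriveM (is_derive_id t (1 : R)) (is_derive_cst a t 1)).
  by rewrite scaler0 !add0r -[_ *: 1]/(a * 1) mulr1.
have d2 : is_derive t 1 e2 (- b).
  have := is_deriveN (is_deriveM (is_derive_id t (1 : R)) (is_derive_cst b t 1)).
  by rewrite scaler0 add0r -[_ *: 1]/(b * 1) mulr1.
have := is_deriveM dE (is_deriveD (is_deriveM dC d2) (is_deriveM dS d1)).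
move/is_derive_eq; apply; rewrite /= -![_ *: _]/(_ * _).
have -> : ((cos \o B) * e2 + (sin \o B) * e1) t = cos (B t) * e2 t + sin (B t) * e1 t by [].
by ring.
Qed.

Let rho := normR z.
(** $e^{\rho/(1-\rho)}$ bounds $e^A$, and each of the two terms containing a part of $w$ is at most
    $\rho^n$. *)
Let M := expR (rho / (1 - rho)) * (2 * rho ^+ n).

Lemma ray_derivative_bound (t x y : R) : (0 < n)%N -> 0 <= t <= 1 -> 
  `|x| <= normR (w t) -> `|y| <= normR (w t) ->
  `|expR (A t) * (cos (B t) * x + sin (B t) * y)| <= M.
Proof.
move=> n0 /andP[t0 t1] hx hy.
have hw : normR (w t) <= rho ^+ n.
  rewrite /w normRM normRN normRX normRM -[in leRHS](prednK n0) exprS ler_wpM2l ?normR_ge0 //.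
  have -> : normR t%:C = t.
    by rewrite normRE /= expr0n /= addr0 sqrtr_sqr ger0_norm.
  rewrite lerXn2r ?nnegrE ?mulr_ge0 ?normR_ge0 //.
  by rewrite ler_piMl ?normR_ge0.
have At : A t <= rho / (1 - rho).
  apply: le_trans (geom_le n _); last by rewrite normR_ge0.
  rewrite /A big_nat_cond [leRHS]big_nat_cond; apply: ler_sum => m /andP[/andP[m1 _] _].
  apply: le_trans (ler_norm _) _; rewrite !normrM.
  have h1 : `|complex.Re (z ^+ m)| <= rho ^+ m by rewrite -normRX Re_le_normR.
  have h2 : `|t ^+ m| <= 1 by rewrite ger0_norm ?exprn_ge0 ?exprn_ile1.
  have h3 : `|m%:R^-1 : R| <= 1.
    by rewrite ger0_norm ?invr_ge0 // invf_le1 ?ltr0n // ler1n.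
  rewrite -[leRHS]mulr1 ler_pM ?mulr_ge0 //.
  by rewrite -[leRHS]mulr1 ler_pM.
rewrite /M normrM ger0_norm ?expR_ge0 // ler_pM ?expR_ge0 ?ler_expR //.
apply: le_trans (ler_normD _ _) _; rewrite !normrM.
have c1 : `|cos (B t)| * `|x| <= rho ^+ n.
  rewrite -[leRHS]mul1r ler_pM ?cos_max //; exact: le_trans hx hw.
have c2 : `|sin (B t)| * `|y| <= rho ^+ n.
  rewrite -[leRHS]mul1r ler_pM ?sin_max //; exact: le_trans hy hw.
by rewrite mulr_natl mulr2n lerD.
Qed.

Lemma MVT01 (f df : R -> R) (K : R) : (forall t : R, is_derive t 1 f (df t)) ->
  (forall t, 0 <= t <= 1 -> `|df t| <= K) -> `|f 1 - f 0| <= K.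
Proof.
move=> hd hK; have hc : {within `[0, 1], continuous f}%classic.
  by apply: derivable_within_continuous => x _; have [] := hd x.
have [c c01 ->] := @MVT_segment R f df 0 1 ler01 (fun x _ => hd x) hc.
by rewrite subr0 mulr1; apply: hK; move: c01; rewrite in_itv.
Qed.

(** The mean value inequality on $[0,1]$ is applied to the real and the imaginary part of $f$
    separately, whence the factor 2. *)
Lemma logsum_close : (0 < n)%N -> normR (expC (logsum z n) * (1 - z) - 1) <= 2 * M.
Proof.
move=> n0.
have A1 : A 1 = complex.Re (logsum z n).
  rewrite /A /logsum raddf_sum; apply: eq_bigr => m _ /=; rewrite expr1n mulr1.
  rewrite (_ : m%:R^-1 = (m%:R^-1 : R)%:C); last by rewrite fmorphV /= rmorph_nat.
  by case: (z ^+ m) => x y /=; rewrite mulr0 subr0.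
have B1 : B 1 = complex.Im (logsum z n).
  rewrite /B /logsum raddf_sum; apply: eq_bigr => m _ /=; rewrite expr1n mulr1.
  rewrite (_ : m%:R^-1 = (m%:R^-1 : R)%:C); last by rewrite fmorphV /= rmorph_nat.
  by case: (z ^+ m) => x y /=; rewrite mulr0 add0r.
have A0 : A 0 = 0.
  rewrite /A big_nat_cond big1 // => m /andP[/andP[m1 _] _].
  by rewrite expr0n gtn_eqF // mulr0.
have B0 : B 0 = 0.
  rewrite /B big_nat_cond big1 // => m /andP[/andP[m1 _] _].
  by rewrite expr0n gtn_eqF // mulr0.
have -> : expC (logsum z n) * (1 - z) - 1 = (fr 1 - fr 0) +i* (fi 1 - fi 0).
  rewrite /fr /fi A0 B0 A1 B1 cos0 sin0 expR0 /e1 /e2 /a /b /expC.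
  case: (logsum z n) => x y; case: z => u v.
  by apply/eqP; rewrite eq_complex /=; apply/andP; split; apply/eqP; ring.
apply: le_trans (normR_le_parts _) _; rewrite /= mulr_natl mulr2n lerD //.
  apply: MVT01 (fun t => is_derive_fr t n0) _ => t t01; rewrite -mulrN.
  by rewrite ray_derivative_bound ?normrN ?Re_le_normR ?Im_le_normR.
apply: MVT01 (fun t => is_derive_fi t n0) _ => t t01.
by rewrite ray_derivative_bound ?Re_le_normR ?Im_le_normR.
Qed.
End Ray.

(** The sequence $e^{\mathrm{logsum}}(1-z)$ tends to $e^L(1-z)$ by continuity and to 1 because the
    error is $O(|z|^n)$. *)
Lemma logC_exists z : normR z < 1 ->
  exists2 L, cvgC (logsum z) L & expC L = (1 - z)^-1.
Proof.
move=> z1; have [L LP] := summableC_cvg (logsum_summable z1); exists L => //.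
have z10 : 1 - z != 0.
  by rewrite subr_eq0; apply: contraTneq z1 => <-; rewrite normR1 ltxx.
apply: (mulIf z10); rewrite mulVf //.
have h1 := cvgCM (expC_cvg LP) (@cvgC_cst R (1 - z)).
have h2 : cvgC (fun n => expC (logsum z n) * (1 - z)) 1.
  apply/cvgC_normR => e e0.
  (* [K] is the part of the error bound independent of $n$: the bound is $K|z|^n$. *)
  pose K := 2 * (expR (normR z / (1 - normR z)) * 2).
  have K0 : 0 < K by rewrite !mulr_gt0 ?expR_gt0.
  have rz : `|normR z| < 1 by rewrite ger0_norm ?normR_ge0.
  have /cvgrPdist_lt /(_ (e / K)) := cvg_expr rz.
  rewrite divr_gt0 // => /(_ isT) hh.
  near=> n; rewrite -opprB normRN.
  have n0 : (0 < n)%N by near: n; exists 1%N.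
  apply: le_lt_trans (logsum_close z1 n0) _.
  rewrite (_ : 2 * _ = K * normR z ^+ n); last by rewrite /K; ring.
  rewrite mulrC -ltr_pdivlMr //.
  have : `|0 - normR z ^+ n| < e / K by near: n.
  by rewrite sub0r normrN ger0_norm ?exprn_ge0 ?normR_ge0.
exact: (@cvg_unique C^o (@norm_hausdorff C C^o) _ _ _ _ h1 h2).
Unshelve. all: by end_near.
Qed.

End LogSeries.

(** * Convergence of products and of $\sum m^{-x}$ for $x>1$ *)

Section EulerProducts.
Variable R : realType.
Local Notation C := R[i].
Implicit Types (z w s : C) (u : nat -> C).

Lemma normR_log_le z L : normR z <= 1 / 2 -> cvgC (logsum z) L -> normR L <= 2 * normR z.
Proof.
move=> z2 hL; apply: (cvgC_le hL) => n.
have z1 : normR z < 1 by apply: le_lt_trans z2 _; lra.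
apply: le_trans (normR_logsum_le n z1) _.
rewrite ler_pdivrMr ?subr_gt0 //; have := normR_ge0 z; nra.
Qed.

(* the product is exp of minus the sum of the logarithms, so its limit is nonzero *)
Lemma prod_cvg (u : nat -> C) (B : R) : (forall n, normR (u n) <= 1 / 2) ->
  (forall n, \sum_(1 <= m < n) normR (u m) <= B) ->
  exists2 l, l != 0 & cvgC (fun n => \prod_(1 <= m < n) (1 - u m)^-1) l.
Proof.
move=> u2 uB.
have u1 n : normR (u n) < 1 by apply: le_lt_trans (u2 n) _; lra.
pose L n := projT1 (cid2 (logC_exists (u1 n))).
have LP n : cvgC (logsum (u n)) (L n) /\ expC (L n) = (1 - u n)^-1.
  by rewrite /L; case: cid2.
have [|l lP] := @summableC_cvg R L.
  exists (2 * B) => n; apply: le_trans (_ : 2 * \sum_(1 <= m < n) normR (u m) <= _); last first.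
    by rewrite ler_wpM2l.
  by rewrite mulr_sumr; apply: ler_sum => m _; apply: normR_log_le (u2 m) (LP m).1.
exists (expC l); first exact: expC_neq0.
have -> : (fun n => \prod_(1 <= m < n) (1 - u m)^-1) = (fun n => expC (\sum_(1 <= m < n) L m)).
  apply/funext => n; elim: n => [|[|n] ih]; first by rewrite !big_geq // expC0.
    by rewrite !big_geq // expC0.
  by rewrite big_nat_recr //= [in RHS]big_nat_recr //= expCD -ih (LP _).2.
exact: expC_cvg.
Qed.

Lemma natpowCM n s w : natpowC n (s + w) = natpowC n s * natpowC n w.
Proof. by rewrite /natpowC mulrDl expCD. Qed.

Lemma natpowC1 n : (0 < n)%N -> natpowC n 1 = n%:R :> C.
Proof.
move=> n0; rewrite /natpowC mul1r /expC /= cos0 sin0 lnK ?posrE ?ltr0n //.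
by rewrite mulr1 rmorph_nat.
Qed.

Lemma natpowCX n m s : (0 < n)%N -> natpowC (n ^ m) s = natpowC n s ^+ m.
Proof.
move=> n0; rewrite /natpowC -expCMn natrX lnXn ?ltr0n //; congr expC.
by rewrite rmorphMn /= mulrnAr mulr_natl.
Qed.

Lemma normR_natpowC n s : (0 < n)%N ->
  normR (natpowC n s) = expR (complex.Re s * ln n%:R).
Proof.
move=> n0; apply: complexI; rewrite -norm_normR norm_expC; congr (_%:C); congr expR.
by case: s => x y /=; rewrite mulr0 subr0.
Qed.

(** This is $a(m+1)^{-1-a}\le m^{-a}-(m+1)^{-a}$. It follows from $\ln((m+1)/m)\ge1/(m+1)$ and
    $e^y\ge1+y$, and makes the zeta sum telescope. *)
Lemma zeta_step (a : R) (m : nat) : 0 < a -> (0 < m)%N ->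
  a * expR (- (1 + a) * ln m.+1%:R) <= expR (- a * ln m%:R) - expR (- a * ln m.+1%:R).
Proof.
move=> a0 m0; have mp : 0 < m%:R :> R by rewrite ltr0n.
have mp1 : 0 < m.+1%:R :> R by rewrite ltr0n.
set x := ln m.+1%:R; set y := ln m%:R.
have xE : expR x = m.+1%:R by rewrite lnK.
have yE : expR y = m%:R by rewrite lnK.
have h : m.+1%:R^-1 <= x - y.
  rewrite -lerN2 opprB -ler_expR expRD yE expRN xE.
  have -> : m%:R / m.+1%:R = 1 - m.+1%:R^-1 :> R.
    apply: (mulIf (lt0r_neq0 mp1)); rewrite divfK ?lt0r_neq0 //.
    by rewrite mulrBl mulVf ?lt0r_neq0 // mul1r -natr1 addrK.
  rewrite -mulrN1; exact: expR_ge1Dx.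
have eE : expR (- (1 + a) * x) = expR (- a * x) * m.+1%:R^-1.
  by rewrite -xE -expRN -expRD; congr expR; ring.
have dE : expR (- a * y) = expR (- a * x) * expR (a * (x - y)).
  by rewrite -expRD; congr expR; ring.
have := expR_ge1Dx (a * (x - y)); have := expR_gt0 (- a * x).
rewrite eE dE; move: (expR (- a * x)) (expR (a * (x - y))) => e1 e2 e10 he.
have : a * m.+1%:R^-1 <= e2 - 1.
  by apply: le_trans (_ : a * (x - y) <= _); [rewrite ler_pM2l|lra].
move: (m.+1%:R^-1) => v hv; have := ler_wpM2l (ltW e10) hv; lra.
Qed.

Lemma zeta_bound (x : R) : 1 < x ->
  exists B : R, forall n, \sum_(1 <= m < n) expR (- x * ln m%:R) <= B.
Proof.
move=> x1; pose a := x - 1; have a0 : 0 < a by rewrite subr_gt0.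
have xE : x = 1 + a by rewrite /a addrC subrK.
exists (1 + a^-1) => -[|n]; first by rewrite big_geq // addr_ge0 // invr_ge0 ltW.
case: n => [|n]; first by rewrite big_geq // addr_ge0 // invr_ge0 ltW.
rewrite big_ltn // ln1 mulr0 expR0 lerD2l.
rewrite -(ler_pM2l a0) mulfV ?lt0r_neq0 //.
have : a * \sum_(2 <= m < n.+2) expR (- x * ln m%:R) <= 1 - expR (- a * ln n.+1%:R).
  elim: n => [|n ih]; first by rewrite big_geq // ln1 mulr0 mulr0 expR0 subrr.
  rewrite big_nat_recr //= mulrDr.
  have := zeta_step a0 (ltn0Sn n); rewrite -xE; lra.
have := expR_ge0 (- a * ln n.+1%:R); lra.
Qed.

End EulerProducts.

(** * Primes of the eighth cyclotomic field *)

Section EvalInt.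

(** One integer polynomial is evaluated in several rings: at $\zeta_8$ in $K$ and at $r^j$ in a
    finite field. All reductions are expressed through it. *)
Definition evZ (S : nzRingType) (Y : {poly int}) (x : S) : S := (map_poly intr Y).[x].

Variable S : comNzRingType.
Implicit Types (Y Z : {poly int}) (x : S).

Lemma evZD Y Z x : evZ (Y + Z) x = evZ Y x + evZ Z x.
Proof. by rewrite /evZ rmorphD hornerD. Qed.
Lemma evZN Y x : evZ (- Y) x = - evZ Y x.
Proof. by rewrite /evZ rmorphN hornerN. Qed.
Lemma evZM Y Z x : evZ (Y * Z) x = evZ Y x * evZ Z x.
Proof. by rewrite /evZ rmorphM hornerM. Qed.
Lemma evZX x : evZ 'X x = x.
Proof. by rewrite /evZ map_polyX hornerX. Qed.
Lemma evZC (c : int) x : evZ c%:P x = c%:~R.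
Proof. by rewrite /evZ map_polyC hornerC. Qed.
Lemma evZXn Y n x : evZ (Y ^+ n) x = evZ Y x ^+ n.
Proof. by rewrite /evZ rmorphXn horner_exp. Qed.
Lemma evZ_sum (I : Type) (s : seq I) (P : pred I) (F : I -> {poly int}) x :
  evZ (\sum_(i <- s | P i) F i) x = \sum_(i <- s | P i) evZ (F i) x.
Proof. by rewrite /evZ rmorph_sum horner_sum. Qed.
Lemma evZ_nat n x : evZ n%:R x = n%:R.
Proof. by rewrite /evZ rmorph_nat -[_%:R]polyC_natr hornerC. Qed.

Definition quad (a : nat -> int) : {poly int} :=
  (a 0%N)%:P + (a 1%N)%:P * 'X + (a 2%N)%:P * 'X ^+ 2 + (a 3%N)%:P * 'X ^+ 3.

Lemma evZ_quad a x : evZ (quad a) x =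
  (a 0%N)%:~R + (a 1%N)%:~R * x + (a 2%N)%:~R * x ^+ 2 + (a 3%N)%:~R * x ^+ 3.
Proof. by rewrite /quad !(evZD, evZM, evZX, evZC); ring. Qed.

End EvalInt.

(** Division by the monic $X^4+1$ over the integers; the same remainder serves all rings. *)
Lemma evZ_reduce (Y : {poly int}) :
  exists a, forall (S : comNzRingType) (x : S), x ^+ 4 = -1 -> evZ Y x = evZ (quad a) x.
Proof.
have m4 : 'X^4 + 1 \is @monic int by rewrite monicE lead_coefDl ?lead_coefXn // size_polyXn size_polyC.
have [Q [a ->]] : exists Q a, Y = Q * ('X^4 + 1) + quad a.
  exists (Y %/ ('X^4 + 1)), (fun i => (Y %% ('X^4 + 1))`_i).
  rewrite [LHS](Pdiv.IdomainMonic.divp_eq m4); congr (_ + _).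
  have : (size (Y %% ('X^4 + 1))%R <= 4)%N.
    rewrite -ltnS; apply: (@leq_trans (size ('X^4 + 1 : {poly int}))).
      by rewrite ltn_modpN0 // monic_neq0.
    by rewrite size_polyDl ?size_polyXn // size_polyC.
  move: (_ %% _) => q sq; rewrite /quad.
  apply/polyP => i; rewrite !coefD !coefCM coefC coefX !coefXn.
  case: i => [|[|[|[|i]]]] /=; rewrite ?mulr0 ?mulr1 ?addr0 ?add0r //.
  by apply: nth_default; apply: leq_trans sq _.
exists a => S x x4; rewrite evZD evZM (evZD 'X^4 1) (evZXn 'X 4) evZX x4.
by rewrite -[1 : {poly int}]/(1%:P) evZC addNr mulr0 add0r.
Qed.

(** Irrationality of $\sqrt2$: the 2-adic valuations of the two sides have different parity. *)
Lemma sqr_double_eq0 (a b : int) : 2 * a ^+ 2 = b ^+ 2 -> a = 0.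
Proof.
move=> h; apply/eqP; apply: contraT => a0.
have b0 : b != 0 by apply: contraNneq a0 => b0; move: h; rewrite b0 => h; apply/eqP; nia.
have := congr1 (fun x => logn 2 `|x|%N) h.
rewrite abszM !abszX lognM ?expn_gt0 ?absz_gt0 ?a0 // !lognX.
by rewrite (_ : `|2%R|%N = 2) // logn_prime //=; lia.
Qed.

Lemma sqr_sum_eq0 (a b : int) : a ^+ 2 + b ^+ 2 = 0 -> a = 0 /\ b = 0.
Proof.
by move/eqP; rewrite paddr_eq0 ?sqr_ge0 // !sqrf_eq0 => /andP[/eqP-> /eqP->].
Qed.

Section Indep.
Variables (K : fieldExtType rat) (z : K).
Hypothesis z4 : z ^+ 4 = -1.

Lemma intrK_inj : injective (intr : int -> K).
Proof.
move=> m n h.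
have : (m%:~R : rat)%:A = (n%:~R : rat)%:A :> K by rewrite !scaler_int.
by move=> /(fmorph_inj (in_alg K)) /intr_inj.
Qed.

Lemma gauss_indep (u v : int) : u%:~R + v%:~R * z ^+ 2 = 0 -> u = 0 /\ v = 0.
Proof.
move=> h.
have : (u ^+ 2 + v ^+ 2)%:~R = 0 :> K.
  rewrite rmorphD !rmorphXn /=.
  have -> : u%:~R ^+ 2 + v%:~R ^+ 2 =
     (u%:~R + v%:~R * z ^+ 2) * (u%:~R - v%:~R * z ^+ 2) + v%:~R ^+ 2 * (1 + z ^+ 4) :> K by ring.
  by rewrite h z4 subrr mul0r mulr0 addr0.
by rewrite -[0 in RHS]/(0%:~R) => /intrK_inj /sqr_sum_eq0.
Qed.

(** Irreducibility of $X^4+1$ over $\mathbb{Q}$ in explicit form, by descent to $\mathbb{Z}[i]$ with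
    $i=z^2$. *)
Lemma quad_indep a : evZ (quad a) z = 0 -> [/\ a 0%N = 0, a 1%N = 0, a 2%N = 0 & a 3%N = 0].
Proof.
rewrite evZ_quad; move: (a 0%N) (a 1%N) (a 2%N) (a 3%N) => a0 a1 a2 a3 h.
(* Put $P=a_0+a_2i$ and $Q=a_1+a_3i$. The relation is $P+zQ=0$; its product with $P-zQ$ is
   $P^2-iQ^2=E_1+E_2i$. *)
pose E1 := a0 ^+ 2 - a2 ^+ 2 + 2 * a1 * a3.
pose E2 := 2 * a0 * a2 - a1 ^+ 2 + a3 ^+ 2.
have [e1 e2] : E1 = 0 /\ E2 = 0.
  apply: gauss_indep; rewrite /E1 /E2 !(rmorphD, rmorphB, rmorphM, rmorphXn) /=.
  transitivity ((a0%:~R + a1%:~R * z + a2%:~R * z ^+ 2 + a3%:~R * z ^+ 3) *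
    (a0%:~R - a1%:~R * z + a2%:~R * z ^+ 2 - a3%:~R * z ^+ 3) +
    (1 + z ^+ 4) * (a3%:~R ^+ 2 * z ^+ 2 + 2 * a1%:~R * a3%:~R - a2%:~R ^+ 2)).
    by ring.
  by rewrite h z4 subrr !mul0r addr0.
(* Here $u+vi=P\overline{Q}$ and $N=Q\overline{Q}$. From $P^2=iQ^2$ follows $(u+vi)^2=iN^2$, that
   is, $u^2=v^2$ and $2uv=N^2$, so $2u^2=\pm N^2$. *)
pose u := a0 * a1 + a2 * a3; pose v := a2 * a1 - a0 * a3; pose N := a1 ^+ 2 + a3 ^+ 2.
have uv : u ^+ 2 - v ^+ 2 = 0.
  transitivity ((a1 ^+ 2 - a3 ^+ 2) * E1 + 2 * a1 * a3 * E2); first by rewrite /u /v /E1 /E2; ring.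
  by rewrite e1 e2 !mulr0 addr0.
have uvN : 2 * u * v = N ^+ 2.
  have : 2 * u * v - N ^+ 2 = (a1 ^+ 2 - a3 ^+ 2) * E2 - 2 * a1 * a3 * E1.
    by rewrite /u /v /N /E1 /E2; ring.
  by rewrite e1 e2 !mulr0 subr0 => /eqP; rewrite subr_eq0 => /eqP.
have u0 : u = 0.
  move/eqP: uv; rewrite subr_eq0 eqf_sqr => /orP[] /eqP uE.
    by apply: (@sqr_double_eq0 u N); rewrite -uvN -uE; ring.
  have : N ^+ 2 + 2 * u ^+ 2 = 0 by rewrite -uvN uE; ring.
  move/eqP; rewrite paddr_eq0 ?sqr_ge0 //; last by rewrite mulr_ge0 // sqr_ge0.
  move=> /andP[_].
  by rewrite mulf_eq0 /= sqrf_eq0 => /eqP.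
have N0 : N ^+ 2 = 0 by rewrite -uvN u0; ring.
have {}N0 : a1 = 0 /\ a3 = 0 by move/eqP: N0; rewrite sqrf_eq0 /N => /eqP /sqr_sum_eq0.
case: N0 => h1 h3; move: e1 e2; rewrite /E1 /E2 h1 h3 => e1 e2.
have h02 : a0 ^+ 2 = a2 ^+ 2 by move/eqP: e1; rewrite mulr0 addr0 subr_eq0 => /eqP.
have : a0 * a2 = 0.
  by move/eqP: e2; rewrite expr0n subr0 addr0 -mulrA mulf_eq0 /= => /eqP.
move/eqP; rewrite mulf_eq0 => /orP[] /eqP h0.
  have {}h02 : a2 ^+ 2 = 0 by rewrite -h02 h0 expr0n.
  by move/eqP: h02; rewrite sqrf_eq0 => /eqP h'.
have {}h02 : a0 ^+ 2 = 0 by rewrite h02 h0 expr0n.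
by move/eqP: h02; rewrite sqrf_eq0 => /eqP h'.
Qed.

End Indep.

Lemma pnatr_eq0_fieldExt (K : fieldExtType rat) (n : nat) : ((n%:R : K) == 0) = (n == 0)%N.
Proof.
by rewrite -(rmorph_nat (in_alg K)) fmorph_eq0 pnatr_eq0.
Qed.

Lemma uniq_pair (T : eqType) (a b : T) : a <> b -> uniq [:: a; b].
Proof. by move=> /eqP h; rewrite /= inE h. Qed.

Lemma uniq_quadruple (T : eqType) (a b c d : T) : a <> b -> a <> c -> a <> d ->
  b <> c -> b <> d -> c <> d -> uniq [:: a; b; c; d].
Proof.
move=> /eqP h1 /eqP h2 /eqP h3 /eqP h4 /eqP h5 /eqP h6.
by rewrite /= !inE !negb_or h1 h2 h3 h4 h5 h6.
Qed.

(** * Reduction of the integers of $K$ to a field of characteristic $p$ *)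

Section Reduction.
Variables (K : fieldExtType rat) (zeta : K).
Hypothesis hz : 8.-primitive_root zeta.
Hypothesis hK : <<1; zeta>>%VS = fullv.
Variables (p : nat) (k : finFieldType).
Hypothesis pchark : p \in [pchar k].
Local Notation O := (ring_of_integers K).

Lemma prime_p : prime p. Proof. exact: pcharf_prime pchark. Qed.

Let z4 : zeta ^+ 4 = -1 := prim8_pow4 hz.

(** A relation satisfied by [zeta] is a multiple of $X^4+1$, so it holds at every fourth root of
    $-1$. *)
Lemma evZ_kernel Y : evZ Y zeta = 0 ->
  forall (S : comNzRingType) (x : S), x ^+ 4 = -1 -> evZ Y x = 0.
Proof.
have [a aP] := evZ_reduce Y; rewrite (aP _ _ z4) => /(quad_indep z4)[a0 a1 a2 a3] S x x4.
by rewrite (aP _ _ x4) evZ_quad a0 a1 a2 a3 !mul0r !addr0.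
Qed.

Lemma intr_k_eq0 (c : int) : (c%:~R == 0 :> k) = (p %| `|c|)%N.
Proof.
rewrite (dvdn_pcharf pchark); case: c => c; first by rewrite -pmulrn.
by rewrite NegzE mulrNz oppr_eq0 abszN -pmulrn.
Qed.

Section Root.
Variable r : k.
Hypothesis hr : 8.-primitive_root r.

Lemma odd_pow4 j : odd j -> (r ^+ j) ^+ 4 = -1.
Proof.
by move=> oj; rewrite -exprM mulnC exprM (prim8_pow4 hr) -signr_odd oj expr1.
Qed.

(** The remainder modulo $X^4+1$ has degree at most 3 but vanishes at four distinct points of [k],
    so all its coefficients are divisible by $p$. *)
Lemma evZ_divisible Y : (forall j, odd j -> evZ Y (r ^+ j) = 0) ->
  exists Y', forall (S : comNzRingType) (x : S), x ^+ 4 = -1 -> evZ Y x = p%:R * evZ Y' x.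
Proof.
move=> hY; have [a aP] := evZ_reduce Y.
have hq j : odd j -> evZ (quad a) (r ^+ j) = 0 by move=> oj; rewrite -aP ?hY ?odd_pow4.
pose P : {poly k} := \poly_(i < 4) (a i)%:~R.
have PE x : P.[x] = evZ (quad a) x.
  by rewrite horner_poly evZ_quad !big_ord_recl big_ord0 /= expr0 expr1; ring.
have P0 : P = 0.
  apply/eqP; apply: contraT => P0.
  have := max_poly_roots P0 (rs := [seq r ^+ i | i <- [:: 1; 3; 5; 7]%N]).
  have -> : all (root P) [seq r ^+ i | i <- [:: 1; 3; 5; 7]%N].
    apply/allP => _ /mapP[j jl ->]; rewrite rootE PE hq //.
    by move: jl; rewrite !inE => /or4P[] /eqP ->.
  rewrite map_inj_in_uniq; last first.
    move=> i j il jl /eqP; rewrite (eq_prim_root_expr hr).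
    by move: il jl; rewrite !inE => /or4P[] /eqP -> /or4P[] /eqP ->.
  by move=> /(_ isT isT); rewrite size_map ltnNge size_poly.
have dv i : (i < 4)%N -> (p %| `|a i|)%N.
  move=> i4; rewrite -intr_k_eq0; have := congr1 (fun Q : {poly k} => Q`_i) P0.
  by rewrite coef_poly i4 coef0 => /eqP.
exists (quad (fun i => (a i %/ p%:Z)%Z)) => S x x4; rewrite (aP _ _ x4) !evZ_quad.
have E i : (i < 4)%N -> (a i)%:~R = p%:R * ((a i %/ p%:Z)%Z)%:~R :> S.
  move=> /dv hd; rewrite pmulrn -rmorphM /= mulrC divzK //.
by rewrite !E //; ring.
Qed.

End Root.

Local Notation evK Y := (evZ Y zeta).

Lemma integral_zeta : O zeta.
Proof.
exists ('X^4 + 1); first by rewrite monicE lead_coefDl ?lead_coefXn // size_polyXn size_polyC.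
by rewrite rootE rmorphD /= map_polyXn rmorph1 !hornerE z4 addNr.
Qed.

Lemma O_add x y : O x -> O y -> O (x + y).
Proof. exact: integral_add. Qed.
Lemma O_mul x y : O x -> O y -> O (x * y).
Proof. exact: integral_mul. Qed.
Lemma O_opp x : O x -> O (- x).
Proof. exact: integral_opp. Qed.
Lemma O_int (c : int) : O c%:~R.
Proof. exact: integral_id. Qed.
Lemma O_nat n : O n%:R.
Proof. by rewrite pmulrn; exact: O_int. Qed.

Lemma O_exp x n : O x -> O (x ^+ n).
Proof.
by move=> Ox; elim: n => [|n ih]; rewrite ?exprS; [exact: (O_nat 1)|exact: O_mul].
Qed.

Lemma O_evZ Y : O (evK Y).
Proof.
have [a aP] := evZ_reduce Y; rewrite (aP _ _ z4) evZ_quad.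
by do ![apply: O_add | apply: O_mul | apply: O_int | apply: O_exp | exact: integral_zeta].
Qed.

Lemma denominator x : exists D Y, (0 < D)%N /\ D%:R * x = evK Y.
Proof.
have : x \in <<1; zeta>>%VS by rewrite hK memvf.
case/Fadjoin_polyP => P /polyOverP PO ->; rewrite horner_coef.
elim/big_ind: _ => [|y1 y2 [D1 [Y1 [d1 e1]]] [D2 [Y2 [d2 e2]]]|i _].
- by exists 1%N, 0; rewrite -[0 : {poly int}]/(0%:P) evZC mulr0.
- exists (D1 * D2)%N, (D2%:R * Y1 + D1%:R * Y2); rewrite muln_gt0 d1 d2; split => //.
  by rewrite evZD !evZM !evZ_nat -e1 -e2 natrM; ring.
have /vlineP[c ->] := PO i.
exists `|denq c|%N, ((numq c)%:P * 'X ^+ i); rewrite absz_gt0 denq_neq0; split => //.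
rewrite evZM evZC evZXn evZX mulrA; congr (_ * _).
rewrite pmulrn gez0_abs ?denq_ge0 // -(scaler_int (denq c)) -scalerAl mul1r scalerA.
by rewrite mulrC -numqE scaler_int.
Qed.

Variable r : k.
Hypothesis hr : 8.-primitive_root r.

(** This says that $\mathbb{Z}[\zeta_8]$ is maximal at $p$. Whenever $p$ divides a denominator, the
    numerator vanishes at all $r^j$ with $j$ odd, hence is divisible by $p$, and a factor $p$
    cancels. *)
Lemma integral_denominator x : O x ->
  exists d Y, ~~ (p %| d)%N /\ d%:R * x = evK Y.
Proof.
move=> Ox; have [D [Y [D0 e]]] := denominator x.
have [m] := ubnP D; elim: m => // m ih in D Y D0 e *; move=> Dm.
have [pD|pD] := boolP (p %| D)%N; last by exists D, Y.
case/dvdnP: pD => D' DE; have p0 := prime_gt0 prime_p; have p1 := prime_gt1 prime_p.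
have hpw : evK Y = p%:R * (D'%:R * x) by rewrite -e DE natrM; ring.
pose w := D'%:R * x; have [Q Qm Qw] : O w by apply: O_mul => //; exact: O_nat.
have Y0 j : odd j -> evZ Y (r ^+ j) = 0.
  move=> oj; pose N := (size Q).-1.
  (* The homogenised equation $p^NQ(Y/p)$, where $Q$ is a monic equation of $w=Y(\zeta_8)/p$. It
     vanishes at $\zeta_8$, hence at $r^j$, where only the leading term $Y^N$ survives because $p=0$
     in [k]. *)
  pose Z : {poly int} := \sum_(i < size Q) (Q`_i)%:P * (p%:R ^+ (N - i) * Y ^+ i).
  have sQ : size Q = N.+1 by rewrite prednK // size_poly_gt0 monic_neq0.
  have Zz : evK Z = 0.
    rewrite evZ_sum; transitivity (p%:R ^+ N * (map_poly intr Q).[w] : K).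
      rewrite horner_coef mulr_sumr size_map_poly_id0 //; last first.
        by rewrite (monicP Qm) oner_eq0.
      apply: eq_bigr => i _; rewrite coef_map /= !evZM evZC !evZXn evZ_nat hpw -/w.
      have iN : (i <= N)%N by rewrite -ltnS -sQ.
      rewrite exprMn -{2}(subnK iN) exprD; ring.
    by move: Qw; rewrite rootE => /eqP ->; rewrite mulr0.
  have := evZ_kernel Zz (odd_pow4 hr oj).
  rewrite evZ_sum sQ big_ord_recr /= big1 => [|i _]; last first.
    rewrite !evZM !evZXn evZ_nat (pcharf0 pchark) expr0n subn_eq0 leqNgt ltn_ord /=.
    by rewrite mul0r mulr0.
  rewrite add0r !evZM evZC !evZXn evZ_nat subnn expr0 mul1r.
  have -> : Q`_N = 1 by rewrite -(monicP Qm).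
  by rewrite mul1r => /eqP; rewrite expf_eq0 => /andP[_ /eqP].
have [Y' Y'P] := evZ_divisible hr Y0.
apply: (ih D' Y').
- by move: D0; rewrite DE muln_gt0 => /andP[].
- have pK : p%:R != 0 :> K by rewrite pnatr_eq0_fieldExt -lt0n.
  by apply: (mulfI pK); rewrite -Y'P // hpw.
- move: Dm D0; rewrite ltnS DE muln_gt0 => Dm /andP[D'0 _]; apply: leq_trans Dm.
  by rewrite ltn_Pmulr.
Qed.

(** The graph of $\zeta_8\mapsto r^j$ on the integers of $K$: $Y(\zeta_8)/d$ goes to $Y(r^j)/d$. The
    pair $(d,Y)$ is not unique, so this is a relation first and [red] selects its value, with
    default 0. *)
Definition rel_red j x (c : k) : Prop :=
  exists d Y, [/\ ~~ (p %| d)%N, d%:R * x = evK Y & d%:R * c = evZ Y (r ^+ j)].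

Definition red j (x : K) : k := xget 0 [set c | rel_red j x c]%classic.

Section Red.
Variable j : nat.
Hypothesis oj : odd j.

Lemma natk_neq0 d : (d%:R != 0 :> k) = ~~ (p %| d)%N.
Proof. by rewrite -(dvdn_pcharf pchark). Qed.

Lemma rel_red_uniq x c c' : rel_red j x c -> rel_red j x c' -> c = c'.
Proof.
move=> [d [Y [pd e1 e2]]] [d' [Y' [pd' e1' e2']]].
have h : evK (d'%:R * Y - d%:R * Y') = 0.
  by rewrite evZD evZN !evZM !evZ_nat -e1 -e1'; ring.
have := evZ_kernel h (odd_pow4 hr oj).
rewrite evZD evZN !evZM !evZ_nat -e2 -e2' mulrCA -mulrBr -mulrBr => /eqP.
by rewrite !mulf_eq0 -!natk_neq0 in pd pd' *; rewrite (negbTE pd) (negbTE pd') /= subr_eq0 => /eqP.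
Qed.

Lemma redP x : O x -> rel_red j x (red j x).
Proof.
move=> /integral_denominator[d [Y [pd e]]]; apply: (@xgetPex _ 0 [set c | rel_red j x c]%classic).
exists (evZ Y (r ^+ j) / d%:R); exists d, Y; split => //.
by rewrite mulrC divfK // natk_neq0.
Qed.

Lemma redE x c : O x -> rel_red j x c -> red j x = c.
Proof. by move=> Ox; apply: rel_red_uniq; exact: redP. Qed.

Lemma p_ndvdM d d' : ~~ (p %| d)%N -> ~~ (p %| d')%N -> ~~ (p %| d * d')%N.
Proof. by move=> h h'; rewrite Euclid_dvdM ?prime_p // negb_or h. Qed.

Lemma redD x y : O x -> O y -> red j (x + y) = red j x + red j y.
Proof.
move=> Ox Oy; apply: redE; first exact: O_add.
have [d [Y [pd e1 e2]]] := redP Ox; have [d' [Y' [pd' e1' e2']]] := redP Oy.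
exists (d * d')%N, (d'%:R * Y + d%:R * Y'); split; first exact: p_ndvdM.
  by rewrite evZD !evZM !evZ_nat -e1 -e1' natrM; ring.
by rewrite evZD !evZM !evZ_nat -e2 -e2' natrM; ring.
Qed.

Lemma redM x y : O x -> O y -> red j (x * y) = red j x * red j y.
Proof.
move=> Ox Oy; apply: redE; first exact: O_mul.
have [d [Y [pd e1 e2]]] := redP Ox; have [d' [Y' [pd' e1' e2']]] := redP Oy.
exists (d * d')%N, (Y * Y'); split; first exact: p_ndvdM.
  by rewrite evZM -e1 -e1' natrM; ring.
by rewrite evZM -e2 -e2' natrM; ring.
Qed.

Lemma red_evZ Y : red j (evK Y) = evZ Y (r ^+ j).
Proof.
apply: redE; first exact: O_evZ.
by exists 1%N, Y; rewrite !mul1r dvdn1 neq_ltn prime_gt1 ?orbT // prime_p.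
Qed.

Lemma red_nat n : red j n%:R = n%:R.
Proof. by rewrite -(evZ_nat n zeta) red_evZ evZ_nat. Qed.

Lemma redN x : O x -> red j (- x) = - red j x.
Proof.
move=> Ox; have := redD Ox (O_opp Ox); rewrite subrr (red_nat 0) => /esym/eqP.
by rewrite addrC addr_eq0 => /eqP.
Qed.

Lemma redX x n : O x -> red j (x ^+ n) = red j x ^+ n.
Proof.
move=> Ox; elim: n => [|n ih]; first by rewrite !expr0 (red_nat 1).
by rewrite !exprS redM ?ih //; exact: O_exp.
Qed.

Definition ker_red : set K := [set x | O x /\ red j x = 0]%classic.

Lemma ker_red_prime : primes_above K p ker_red.
Proof.
split; last by split; [exact: O_nat|rewrite red_nat (pcharf0 pchark)].
split.
- by move=> x [].
- split; first by split; [exact: (O_nat 0)|rewrite (red_nat 0)].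
  move=> x y [Ox x0] [Oy y0]; split; first exact: O_add (O_opp Oy).
  by rewrite redD ?redN ?x0 ?y0 ?subrr //; exact: O_opp.
- by move=> a x Oa [Ox x0]; split; [exact: O_mul|rewrite redM // x0 mulr0].
- split; first by move=> [_]; rewrite (red_nat 1) => /eqP; rewrite oner_eq0.
  move=> a b Oa Ob [_]; rewrite redM // => /eqP; rewrite mulf_eq0 => /orP[] /eqP h.
    by left.
  by right.
exists p%:R; first by split; [exact: O_nat|rewrite red_nat (pcharf0 pchark)].
by rewrite pnatr_eq0_fieldExt -lt0n prime_gt0 ?prime_p.
Qed.

(** The cosets of the kernel are the fibres of [red j], and these correspond to the elements of
    [k]. *)
Lemma ker_red_norm : (forall c, exists Y, evZ Y (r ^+ j) = c) -> ideal_norm ker_red = #|k|.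
Proof.
move=> surj; pose C (c : k) := [set x | O x /\ red j x = c]%classic.
have CE y : O y -> [set (y + x)%R | x in ker_red]%classic = C (red j y).
  move=> Oy; apply/seteqP; split => z /=.
    by case=> x [Ox x0] <-; split; [exact: O_add|rewrite redD // x0 addr0].
  move=> [Oz zE]; exists (z - y); last by rewrite addrC subrK.
  split; first exact: O_add (O_opp Oy).
  by rewrite redD ?redN ?zE ?subrr //; exact: O_opp.
rewrite /ideal_norm.
have -> : [set [set (y + x)%R | x in ker_red] | y in O]%classic =
    [set C c | c in [set: k]]%classic.
  apply/seteqP; split => A /=.
    by case=> y Oy <-; exists (red j y); rewrite ?CE.
  case=> c _ <-; have [Y <-] := surj c; exists (evK Y); first exact: O_evZ.
  by rewrite CE ?red_evZ //; exact: O_evZ.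
have Cinj : {in [set: k]%classic &, injective C}.
  move=> c c' _ _ e; have [Y hY] := surj c.
  have : C c (evK Y) by split; [exact: O_evZ|rewrite red_evZ].
  by rewrite e => -[_ <-]; rewrite red_evZ.
apply: card_fset_set; apply: card_eq_trans (inj_card_eq Cinj) _.
have -> : [set: k]%classic = [set` [fset x in (predT : pred k)]%fset]%classic.
  by apply/seteqP; split => x //= _; rewrite inE.
by apply/card_eq_fsetP; rewrite card_finset.
Qed.

Lemma evZ_morph (S T : comNzRingType) (f : {rmorphism S -> T}) Y (x : S) :
  f (evZ Y x) = evZ Y (f x).
Proof.
rewrite /evZ -horner_map -map_poly_comp; congr (_.[_]).
by apply: eq_map_poly => c /=; rewrite rmorph_int.
Qed.

Lemma evZ_frob Y (x : k) : evZ Y (x ^+ p) = evZ Y x ^+ p.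
Proof.
by have := evZ_morph (pFrobenius_aut pchark) Y x; rewrite /= !pFrobenius_autE => ->.
Qed.

End Red.

Lemma red_frob j : odd j -> odd p -> forall x, O x -> red (p * j) x = red j x ^+ p.
Proof.
move=> oj op x Ox; have [d [Y [pd e1 e2]]] := redP j Ox.
have opj : odd (p * j) by rewrite oddM op.
apply: (redE opj Ox); exists d, Y; split => //.
rewrite mulnC exprM evZ_frob -e2 exprMn; congr (_ * _).
by rewrite -(pFrobenius_autE pchark) rmorph_nat.
Qed.

(** Frobenius carries the reduction at $r^j$ to the one at $r^{pj}$ and is injective. This
    identifies the four kernels in pairs when $p\not\equiv1$ modulo 8. *)
Lemma ker_red_frob j : odd j -> odd p -> ker_red (p * j) = ker_red j.
Proof.
move=> oj op; apply/seteqP; split => x [Ox].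
  rewrite red_frob // => /eqP; rewrite expf_eq0 => /andP[_ /eqP h]; split=> //.
by move=> h; split => //; rewrite red_frob // h expr0n gtn_eqF // prime_gt0 ?prime_p.
Qed.

Lemma ker_red_mod8 j j' : (j = j' %[mod 8])%N -> ker_red j = ker_red j'.
Proof.
move=> /eqP; rewrite -(eq_prim_root_expr hr) => /eqP e.
by rewrite /ker_red /red /rel_red e.
Qed.

Lemma ker_red_neq j j' Y : odd j -> odd j' ->
  evZ Y (r ^+ j) = 0 -> evZ Y (r ^+ j') != 0 -> ker_red j <> ker_red j'.
Proof.
move=> oj oj' e1 e2 e.
have : ker_red j (evK Y) by split; [exact: O_evZ|rewrite red_evZ].
by rewrite e => -[_]; rewrite red_evZ // => /eqP; rewrite (negbTE e2).
Qed.

(** With $dy=pY'(\zeta_8)$ and the Bezout relation $ad=bp+1$, one gets $y=p(aY'(\zeta_8)-by)$. *)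
Lemma all_red_eq0 y : O y -> (forall j, odd j -> red j y = 0) ->
  exists2 y', O y' & y = p%:R * y'.
Proof.
move=> Oy hy; have [d [Y [pd e]]] := integral_denominator Oy.
have Y0 j : odd j -> evZ Y (r ^+ j) = 0.
  move=> oj; rewrite -red_evZ // -e redM ?hy ?mulr0 //; exact: O_nat.
have [Y' Y'P] := evZ_divisible hr Y0.
have cpd : coprime d p by rewrite coprime_sym prime_coprime ?prime_p.
have d0 : (0 < d)%N by rewrite lt0n; apply: contraNneq pd => ->; rewrite dvdn0.
have [a b ab _] := egcdnP p d0; rewrite (eqP cpd) in ab.
exists (a%:R * evK Y' - b%:R * y).
  apply: O_add; first by apply: O_mul; [exact: O_nat|exact: O_evZ].
  by apply: O_opp; apply: O_mul => //; exact: O_nat.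
have := congr1 (fun n => n%:R * y) ab.
rewrite natrM natrD mulrDl mul1r natrM -mulrA e Y'P // => h.
by rewrite mulrBr [p%:R * (_ * evK Y')]mulrCA h; ring.
Qed.

(** If $P$ contained no kernel, elements of the kernels outside $P$ would have a product lying in
    all kernels, hence in $pO\subseteq P$, against primality. A kernel contained in $P$ equals $P$,
    being maximal. *)
Lemma primes_above_ker P : primes_above K p P ->
  exists2 j, j \in [:: 1; 3; 5; 7]%N & P = ker_red j.
Proof.
case=> -[PO [P0 PB] PM [P1 Pprime] _] Pp.
have [j jl sub] : exists2 j, j \in [:: 1; 3; 5; 7]%N & (ker_red j `<=` P)%classic.
  apply: contrapT => h.
  have wit j : j \in [:: 1; 3; 5; 7]%N -> exists x, (O x /\ red j x = 0) /\ ~ P x.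
    move=> jl; apply: contrapT => h'; apply: h; exists j => // x kx.
    by apply: contrapT => nPx; apply: h'; exists x.
  have [x1 [ [q1 r1] n1]] := wit 1%N isT.
  have [x3 [ [q3 r3] n3]] := wit 3%N isT.
  have [x5 [ [q5 r5] n5]] := wit 5%N isT.
  have [x7 [ [q7 r7] n7]] := wit 7%N isT.
  have O57 := O_mul q5 q7; have O357 := O_mul q3 O57; have O1357 := O_mul q1 O357.
  have [|y Oy yE] := all_red_eq0 O1357.
    move=> j oj; rewrite !redM //.
    have : (j %% 8)%N \in [:: 1; 3; 5; 7]%N.
      have : odd (j %% 8) by rewrite odd_mod.
      by have := ltn_pmod j (isT : 0 < 8)%N; case: (j %% 8)%N => [|[|[|[|[|[|[|[|]]]]]]]].
    have rE i : (j %% 8)%N = i -> (i < 8)%N -> red j =1 red i.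
      move=> ji i8; have := eq_prim_root_expr hr j i.
      by rewrite ji (modn_small i8) eqxx => /eqP e x; rewrite /red /rel_red e.
    rewrite !inE => /or4P[] /eqP /rE /(_ isT) e; rewrite !e ?r1 ?r3 ?r5 ?r7;
    by rewrite ?(mul0r, mulr0).
  have nM a b : O a -> O b -> ~ P a -> ~ P b -> ~ P (a * b).
    by move=> Oa Ob na nb /(Pprime _ _ Oa Ob)[].
  apply: (nM _ _ q1 O357 n1 (nM _ _ q3 O57 n3 (nM _ _ q5 q7 n5 n7))).
  by rewrite yE mulrC; apply: PM.
exists j => //; have oj : odd j by move: jl; rewrite !inE => /or4P[] /eqP ->.
apply/seteqP; split => // x Px; split; first exact: PO.
apply/eqP; apply: contrapT => /negP rx.
have Ox := PO _ Px; pose n := #|k|.-1.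
have n0 : (0 < n)%N by rewrite -ltnS prednK ?finNzRing_gt1 // ltnW // finNzRing_gt1.
have rn : red j x ^+ n = 1.
  apply: (mulfI rx); rewrite -exprS mulr1 /n prednK ?expf_card //.
  by rewrite ltnW // finNzRing_gt1.
(* If $x\in P$ had nonzero reduction, then $1-x^n$ with $n=\#k-1$ would reduce to 0 and lie in $P$,
   so that $1\in P$. *)
have k1 : ker_red j (1 - x ^+ n).
  split; first by apply: O_add; [exact: (O_nat 1)|apply: O_opp; exact: O_exp].
  rewrite redD //; [|exact: (O_nat 1)|by apply: O_opp; exact: O_exp].
  by rewrite redN ?redX ?rn ?(red_nat oj 1) ?subrr //; exact: O_exp.
apply: P1; rewrite -[1](subrK (x ^+ n)) -[X in _ + X]opprK.
apply: (PB); first exact: sub.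
rewrite -[- _]sub0r; apply: (PB) => //.
by rewrite -(prednK n0) exprSr; apply: PM => //; exact: O_exp.
Qed.

Lemma fsbig_const_norm (R : realType) (s : R[i]) (l : seq (set K)) N : uniq l ->
  primes_above K p = [set` l]%classic -> (forall P, P \in l -> ideal_norm P = N) ->
  \big[*%R/1]_(P \in primes_above K p) (1 - natpowC (ideal_norm P) s)^-1 =
  (1 - natpowC N s)^-1 ^+ size l.
Proof.
move=> ul -> lN; rewrite -fsbig_seq // big_seq (eq_bigr (fun=> (1 - natpowC N s)^-1)).
  by rewrite -big_seq big_const_seq count_predT iter_mulr_1.
by move=> P /lN ->.
Qed.

(** Every $r^j$ is the image of an integer $a$, so $X-a$ separates the kernels: four primes of norm
    $p$. *)
Lemma split_factor (R : realType) (s : R[i]) : #|k| = p -> (8 %| p.-1)%N ->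
  \big[*%R/1]_(P \in primes_above K p) (1 - natpowC (ideal_norm P) s)^-1 =
  (1 - natpowC p s)^-1 ^+ 4.
Proof.
move=> kp p8; have p1 : (0 < p)%N by rewrite prime_gt0 ?prime_p.
have surj (c : k) : exists a : int, c = a%:~R.
  have inj : injective (fun i : 'I_p => (i : nat)%:R : k).
    move=> i i' /= /eqP; rewrite -subr_eq0.
    wlog le : i i' / (i' <= i)%N.
      move=> W; case: (leqP i' i) => [/W //|/ltnW/W h e].
      by rewrite [RHS]h // -opprB oppr_eq0.
    rewrite -natrB // -(dvdn_pcharf pchark) => dv; apply: val_inj => /=.
    have : (i - i' = 0)%N.
      apply/eqP; apply: contraTT dv => ne; rewrite gtnNdvd ?lt0n //.
      by apply: leq_ltn_trans (leq_subr _ _) (ltn_ord i).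
    lia.
  have := inj_card_onto inj _ c; rewrite card_ord kp leqnn => /(_ isT) /codomP[i ->].
  by exists (Posz i); rewrite pmulrn.
have surjY j (c : k) : exists Y, evZ Y (r ^+ j) = c.
  by have [a ->] := surj c; exists a%:P; rewrite evZC.
have ne j j' : odd j -> odd j' -> (j != j' %[mod 8])%N -> ker_red j <> ker_red j'.
  move=> oj oj' jj'; have [a aE] := surj (r ^+ j).
  apply: (@ker_red_neq _ _ ('X - a%:P)) => //; rewrite evZD evZN evZX evZC -aE ?subrr //.
  by rewrite subr_eq0 (eq_prim_root_expr hr) eq_sym.
apply: (@fsbig_const_norm R s [:: ker_red 1; ker_red 3; ker_red 5; ker_red 7]).
- by apply: uniq_quadruple => //; exact: ne.
- apply/seteqP; split => P.
    by move=> /primes_above_ker[j + ->]; rewrite !inE => /or4P[] /eqP -> /=;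
       rewrite !in_cons eqxx ?orbT.
  rewrite /mkset !in_cons in_nil orbF => /or4P[] /eqP ->; exact: ker_red_prime.
by move=> P; rewrite !in_cons in_nil orbF -[in RHS]kp => /or4P[] /eqP ->; apply: ker_red_norm.
Qed.

(** Residue degree 2: multiplication by $p$ pairs the odd classes modulo 8, which leaves two primes
    of norm $p^2$. *)
Lemma inert_factor (R : realType) (s : R[i]) : #|k| = (p ^ 2)%N -> odd p ->
  ~~ (8 %| p.-1)%N ->
  \big[*%R/1]_(P \in primes_above K p) (1 - natpowC (ideal_norm P) s)^-1 =
  (1 - natpowC (p ^ 2) s)^-1 ^+ 2.
Proof.
move=> kp op p8; have p1 : (0 < p)%N by rewrite prime_gt0 ?prime_p.
(* $pj\equiv j$ modulo 8 with $j$ odd would force $8\mid p-1$; so $r^j$ is not fixed by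
   Frobenius. *)
have rp j : odd j -> r ^+ (p * j) != r ^+ j.
  move=> oj; rewrite (eq_prim_root_expr hr) eqn_mod_dvd ?leq_pmull //.
  rewrite -[X in (_ - X)%N]mul1n -mulnBl subn1 Gauss_dvdl //.
  by rewrite (_ : 8 = 2 ^ 3)%N // coprimeXl // coprime2n.
have natinj a b : (b <= a)%N -> (a < p)%N -> a%:R = b%:R :> k -> a = b.
  move=> ba ap /eqP; rewrite -subr_eq0 -natrB // -(dvdn_pcharf pchark) => dv.
  have : (a - b = 0)%N.
    apply/eqP; apply: contraTT dv => ne; rewrite gtnNdvd ?lt0n //.
    by apply: leq_ltn_trans (leq_subr _ _) ap.
  lia.
have {}natinj a b : (a < p)%N -> (b < p)%N -> a%:R = b%:R :> k -> a = b.
  by move=> ap bp e; case: (leqP b a) => h; [exact: natinj|symmetry; apply: natinj => //; exact: ltnW].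
(* $1$ and $r^j$ form a basis of [k] over the prime field: a coincidence with different coefficients
   of $r^j$ would make $r^j$ a quotient of prime-field elements, fixed by Frobenius. Counting $p^2$
   pairs gives surjectivity. *)
have surj j (c : k) : odd j -> exists a b : int, c = a%:~R + b%:~R * r ^+ j.
  move=> oj; have inj : injective (fun i : 'I_p * 'I_p => i.1%:R + i.2%:R * r ^+ j : k).
    move=> [i l] [i' l'] /= e.
    have el : l = l'.
      apply/eqP; apply: contraT => ne.
      have d0 : l%:R - l'%:R != 0 :> k.
        rewrite subr_eq0; apply: contra ne => /eqP /natinj h; apply/eqP/val_inj; exact: h.
      have rE : r ^+ j = (i'%:R - i%:R) / (l%:R - l'%:R).
        apply: (mulIf d0); rewrite divfK // mulrC mulrBl; apply/eqP.
        rewrite -subr_eq0; move/eqP: e; rewrite -subr_eq0 => /eqP e; apply/eqP.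
        by rewrite -[RHS]e; ring.
      have := rp j oj; rewrite mulnC exprM -(pFrobenius_autE pchark) {1}rE fmorph_div.
      by rewrite !rmorphB !rmorph_nat -rE eqxx.
    move: e; rewrite el => /addIr /natinj h; congr (_, _); apply: val_inj; exact: h.
  have := inj_card_onto inj _ c; rewrite card_prod card_ord kp mulnn leqnn => /(_ isT).
  by move=> /codomP[[a b] ->]; exists (Posz a), (Posz b); rewrite !pmulrn.
have surjY j : odd j -> forall c : k, exists Y, evZ Y (r ^+ j) = c.
  move=> oj c; have [a [b ->]] := surj j c oj; exists (a%:P + b%:P * 'X).
  by rewrite evZD evZM !evZC evZX.
(* The separating polynomial lifts the minimal polynomial of $r^j$ over the prime field, whose roots
   are exactly $r^j$ and $r^{pj}$. *)
have ne j j' : odd j -> odd j' -> (j != j' %[mod 8])%N -> (p * j != j' %[mod 8])%N ->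
    ker_red j <> ker_red j'.
  move=> oj oj' jj' pjj'; have [a [b abE]] := surj j (r ^+ j * r ^+ j) oj.
  pose Y : {poly int} := 'X * 'X - a%:P - b%:P * 'X.
  have YE x : evZ Y x = x * x - a%:~R - b%:~R * x :> k.
    by rewrite !evZD !evZN !evZM !evZC evZX.
  have Y0 : evZ Y (r ^+ j) = 0 by rewrite YE abE; ring.
  have Yp : evZ Y (r ^+ (p * j)) = 0.
    by rewrite mulnC exprM evZ_frob Y0 expr0n gtn_eqF.
  have YF x : evZ Y x = (x - r ^+ j) * (x - r ^+ (p * j)).
    have d0 : r ^+ (p * j) - r ^+ j != 0 by rewrite subr_eq0 rp.
    have hb : b%:~R = r ^+ j + r ^+ (p * j).
      apply: (mulIf d0); apply/eqP; rewrite -subr_eq0; apply/eqP.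
      transitivity (evZ Y (r ^+ j) - evZ Y (r ^+ (p * j))); first by rewrite !YE; ring.
      by rewrite Y0 Yp subrr.
    have ha : a%:~R = - (r ^+ j * r ^+ (p * j)).
      apply/eqP; rewrite -subr_eq0; apply/eqP.
      transitivity (- evZ Y (r ^+ j)); last by rewrite Y0 oppr0.
      by rewrite YE hb; ring.
    by rewrite YE ha hb; ring.
  apply: (@ker_red_neq _ _ Y) => //.
  by rewrite YF mulf_neq0 // subr_eq0 (eq_prim_root_expr hr) eq_sym.
have frob j j' : odd j -> (p * j = j' %[mod 8])%N -> ker_red j' = ker_red j.
  by move=> oj /ker_red_mod8 <-; exact: ker_red_frob.
have modp j : (p * j = (p %% 8) * j %[mod 8])%N by rewrite modnMml.
have po : odd (p %% 8) by rewrite odd_mod.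
have p81 : (p %% 8)%N != 1%N.
  by apply: contra p8 => /eqP h; rewrite -subn1 -eqn_mod_dvd // h.
(* [j0] represents the class not containing 1. The pairs are {1,3}, {5,7} for $p\equiv3$; {1,5},
   {3,7} for $p\equiv5$; {1,7}, {3,5} for $p\equiv7$. *)
have [j0 [oj0 n1 n2 cov]] : exists j0, [/\ odd j0, (1 != j0 %[mod 8])%N, (p * 1 != j0 %[mod 8])%N &
   forall j, j \in [:: 1; 3; 5; 7]%N -> ker_red j = ker_red 1 \/ ker_red j = ker_red j0].
  have : (p %% 8)%N \in [:: 3; 5; 7]%N.
    move: (ltn_pmod p (isT : 0 < 8)%N) po p81.
    by case: (p %% 8)%N => [|[|[|[|[|[|[|[|]]]]]]]].
  rewrite !inE => /or3P[] /eqP pE.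
  - exists 5%N; split => //; first by rewrite modp pE.
    move=> j; rewrite !inE => /or4P[] /eqP ->; [by left|left|by right|right].
      by apply: frob => //; rewrite modp pE.
    by apply: frob => //; rewrite modp pE.
  - exists 3%N; split => //; first by rewrite modp pE.
    move=> j; rewrite !inE => /or4P[] /eqP ->; [by left|by right|left|right].
      by apply: frob => //; rewrite modp pE.
    by apply: frob => //; rewrite modp pE.
  exists 3%N; split => //; first by rewrite modp pE.
  move=> j; rewrite !inE => /or4P[] /eqP ->; [by left|by right|right|left].
    by apply: frob => //; rewrite modp pE.
  by apply: frob => //; rewrite modp pE.
apply: (@fsbig_const_norm R s [:: ker_red 1; ker_red j0]).
- by apply: uniq_pair => //; exact: ne.
- apply/seteqP; split => P.
    by move=> /primes_above_ker[j /cov[] e ->]; rewrite e /= !in_cons eqxx ?orbT.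
  rewrite /mkset !in_cons in_nil orbF => /orP[] /eqP ->; exact: ker_red_prime.
move=> P; rewrite !in_cons in_nil orbF -[in RHS]kp => /orP[] /eqP ->.
  by apply: ker_red_norm => //; exact: surjY.
by apply: ker_red_norm => //; exact: surjY.
Qed.

End Reduction.

(** * The local factors *)

(** The large integer stays abstract: only its images in [rat] and in the finite field are
    compared. *)
Lemma int_monomial (a b c : nat) : exists C : int, forall S : nzRingType,
  C%:~R = 2 ^+ a * 3 ^+ b * 7 ^+ c :> S.
Proof. by exists (2 ^+ a * 3 ^+ b * 7 ^+ c) => S; rewrite !rmorphM !rmorphXn. Qed.

Lemma int_power (a : nat) (e : nat) : exists d : int, forall S : nzRingType,
  d%:~R = a%:R ^+ e :> S.
Proof. by exists (a%:R ^+ e) => S; rewrite rmorphXn /= rmorph_nat. Qed.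

(** The origin of the constant in $t$: this is the denominator of $M$, so $M^{-1}t$ retains only
    powers of $36$ and $\psi$. *)
Lemma M_denominator (S : comNzRingType) :
  12 ^+ 12 * 9 ^+ 9 * 8 ^+ 8 * 7 ^+ 7 = 2 ^+ 48 * 3 ^+ 30 * 7 ^+ 7 :> S.
Proof.
have gen (x y z : S) : (x ^+ 2 * y) ^+ 12 * (y ^+ 2) ^+ 9 * (x ^+ 3) ^+ 8 * z ^+ 7 =
  x ^+ 48 * y ^+ 30 * z ^+ 7 by ring.
have := gen 2 3 7.
have -> : 2 ^+ 2 * 3 = 12 :> S by ring.
have -> : 3 ^+ 2 = 9 :> S by ring.
by have -> : 2 ^+ 3 = 8 :> S by ring.
Qed.

Lemma Mconst_inv : Mconst^-1 * 36%:R ^+ 36 = 2%:R ^+ 48 * 3%:R ^+ 30 * 7%:R ^+ 7 :> rat.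
Proof.
have c (k : nat) : k%:Q = k%:R by rewrite pmulrn.
have gen (x y : rat) : y != 0 -> (y / x)^-1 * y = x by move=> y0; rewrite invf_div divfK.
have -> : Mconst = 36%:R ^+ 36 / (12%:R ^+ 12 * 9%:R ^+ 9 * 8%:R ^+ 8 * 7%:R ^+ 7).
  by rewrite /Mconst !c.
transitivity (12%:R ^+ 12 * 9%:R ^+ 9 * 8%:R ^+ 8 * 7%:R ^+ 7 : rat).
  by apply: gen; apply: expf_neq0.
exact: M_denominator.
Qed.

Lemma inverse_of_products (F : fieldType) (m t c x y : F) :
  x * y != 0 -> m * x = c -> t * (c * y) = 1 -> m * t = (x * y)^-1.
Proof. by move=> xy0 <- h; apply: (mulIf xy0); rewrite mulVf // -h; ring. Qed.

Lemma even_exprN (S : pzRingType) (x : S) n : ~~ odd n -> (- x) ^+ n = x ^+ n.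
Proof. by move=> /negbTE on; rewrite exprNn -signr_odd on expr0 mul1r. Qed.

Section Reductions.
Variables (F : finFieldType) (p : nat).
Hypothesis pF : p \in [pchar F].

(** [ratr] uses the reduced fraction. Its denominator divides [d], hence also survives in [F], and
    any such presentation $a/d$ may be used instead. *)
Lemma ratr_frac (x : rat) (a d : int) : x * d%:~R = a%:~R -> d%:~R != 0 :> F ->
  ratr x * d%:~R = a%:~R :> F.
Proof.
move=> e d0.
have h : numq x * d = a * denq x.
  by apply: (@intr_inj rat); rewrite !rmorphM /= numqE -e; ring.
have : (denq x %| d)%Z.
  rewrite -(@Gauss_dvdzr _ (numq x)); first by rewrite h dvdz_mull.
  by rewrite /coprimez gcdzC; exact: coprime_num_den.
case/dvdzP => c dE.
have den0 : (denq x)%:~R != 0 :> F.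
  by apply: contraNneq d0 => z; rewrite dE rmorphM /= z mulr0.
apply: (mulIf den0); rewrite /ratr mulrAC divfK // -!rmorphM /= h.
by [].
Qed.

(** From $tC\psi^e=1$ with $t$ and $C$ prime to $p$: if $p$ divided the numerator or the denominator
    of $\psi$ it would divide both, against coprimality. *)
Lemma good_reduction (psi t : rat) (C : int) (e : nat) :
  psi != 0 -> (0 < e)%N -> C != 0 -> t * (C%:~R * psi ^+ e) = 1 ->
  ~~ (p %| `|C|)%N -> ~~ (p %| `|numq t|)%N -> ~~ (p %| `|denq t|)%N ->
  ratr psi != 0 :> F /\ ratr t * (C%:~R * ratr psi ^+ e) = 1 :> F.
Proof.
move=> psi0 e0 C0 tE; rewrite -!(intr_k_eq0 pF) => pC pn pd.
set a := numq psi; set b := denq psi.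
have b0 : b%:~R != 0 :> rat by rewrite intr_eq0 denq_neq0.
have psiE : psi = a%:~R / b%:~R by rewrite divq_num_den.
have tab : t * (C * a ^+ e)%:~R = (b ^+ e)%:~R.
  rewrite !rmorphM !rmorphXn /=; have -> : a%:~R = psi * b%:~R by rewrite numqE.
  by rewrite exprMn !mulrA -[t * _ * _]mulrA tE mul1r.
have h : numq t * (C * a ^+ e) = b ^+ e * denq t.
  by apply: (@intr_inj rat); rewrite rmorphM [RHS]rmorphM /= -tab numqE; ring.
have hF : (numq t)%:~R * (C%:~R * a%:~R ^+ e) = b%:~R ^+ e * (denq t)%:~R :> F.
  by have := congr1 (intr : int -> F) h; rewrite !(rmorphM, rmorphXn).
have ab1 : ~ (a%:~R = 0 :> F /\ b%:~R = 0 :> F).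
  move=> [a0 bz]; have /coprimezP[[u v] /= uv] : coprimez a b by exact: coprime_num_den.
  have := congr1 (intr : int -> F) uv; rewrite rmorphD !rmorphM /= a0 bz !mulr0 addr0 => /eqP.
  by rewrite eq_sym oner_eq0.
have aF : a%:~R != 0 :> F.
  apply/eqP => az; apply: ab1; split => //.
  move/eqP: hF; rewrite az expr0n gtn_eqF // !mulr0 eq_sym mulf_eq0 (negbTE pd) orbF expf_eq0.
  by case/andP=> _ /eqP.
have bF : b%:~R != 0 :> F.
  apply/eqP => bz; apply: ab1; split => //.
  move/eqP: hF; rewrite bz expr0n gtn_eqF // mul0r !mulf_eq0 (negbTE pn) (negbTE pC) /= expf_eq0.
  by case/andP=> _ /eqP.
have psiF : ratr psi = a%:~R / b%:~R :> F by [].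
split; first by rewrite psiF mulf_neq0 // invr_eq0.
have d0 : (C * a ^+ e)%:~R != 0 :> F by rewrite rmorphM rmorphXn mulf_neq0 ?expf_neq0.
have := ratr_frac tab d0; rewrite rmorphM !rmorphXn /= psiF => H.
by rewrite exprMn exprVn !mulrA -[_ * _ * a%:~R ^+ e]mulrA H mulfV // expf_neq0.
Qed.

Lemma hyp_argument (psi : rat) : psi != 0 ->
  ~~ (p %| 2)%N -> ~~ (p %| 3)%N -> ~~ (p %| 7)%N ->
  ~~ (p %| `|numq (param_t psi)|)%N -> ~~ (p %| `|denq (param_t psi)|)%N ->
  - (36 * ratr psi) != 0 :> F /\
  ratr Mconst^-1 * ratr (param_t psi) = ((- (36 * ratr psi)) ^+ 36)^-1 :> F.
Proof.
move=> psi0 p2 p3 p7 pn pd.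
have pp : prime p by exact: pcharf_prime pF.
have f2 : 2 != 0 :> F by rewrite (natk_neq0 pF).
have f3 : 3 != 0 :> F by rewrite (natk_neq0 pF).
have f7 : 7 != 0 :> F by rewrite (natk_neq0 pF).
have [C CR] := int_monomial 48 30 7.
have CF : C%:~R != 0 :> F by rewrite CR !mulf_neq0 // expf_neq0.
have pC : ~~ (p %| `|C|)%N by rewrite -(intr_k_eq0 pF).
have C0 : C != 0 by apply: contraNneq CF => ->.
have tE : param_t psi * (C%:~R * psi ^+ 36) = 1.
  rewrite CR /param_t; move: (2 ^+ 48) (3 ^+ 30) (7 ^+ 7) (psi ^+ 36)
    (expf_neq0 48 (isT : 2 != 0 :> rat)) (expf_neq0 30 (isT : 3 != 0 :> rat))
    (expf_neq0 7 (isT : 7 != 0 :> rat)) (expf_neq0 36 psi0) => x y z w x0 y0 z0 w0.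
  by field; rewrite x0 y0 z0 w0.
have [psiF tF] := good_reduction psi0 (isT : 0 < 36)%N C0 tE pC pn pd.
have x36 : 36 = (2 * 3) ^+ 2 :> F by rewrite -natrM -natrX.
have f36 : 36 != 0 :> F by have := expf_neq0 2 (mulf_neq0 f2 f3); rewrite -x36.
have [d dR] := int_power 36 36.
have MF : ratr Mconst^-1 * 36 ^+ 36 = C%:~R :> F.
  rewrite -dR; apply: ratr_frac; last by rewrite dR expf_neq0.
  by rewrite dR CR; exact: Mconst_inv.
split; first by rewrite oppr_eq0 mulf_neq0.
have E : (- (36 * ratr psi)) ^+ 36 = 36 ^+ 36 * ratr psi ^+ 36 :> F.
  transitivity ((36 * ratr psi) ^+ 36 : F); [exact: even_exprN|exact: exprMn].
rewrite E; apply: (inverse_of_products _ MF tF).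
apply: mulf_neq0; [exact: expf_neq0|exact: expf_neq0].
Qed.

End Reductions.

Section LocalCount.
Variables (R : realType) (F : finFieldType) (p : nat) (omega Theta : F -> R[i]).
Hypothesis pF : p \in [pchar F].
Hypothesis homega : mult_char_generator omega.
Hypothesis hTheta : nontrivial_add_char Theta.
Variable psi : rat.
Hypothesis psi0 : psi != 0.
Hypotheses (p2 : ~~ (p %| 2)%N) (p3 : ~~ (p %| 3)%N) (p7 : ~~ (p %| 7)%N).
Hypothesis pn : ~~ (p %| `|numq (param_t psi)|)%N.
Hypothesis pd : ~~ (p %| `|denq (param_t psi)|)%N.

Lemma num_points_hyp_sum : (num_points (ratr psi : F))%:R =
  hyp_sum omega Theta alpha beta (ratr (param_t psi)) +
  1 + #|F|%:R ^+ 2 + #|F|%:R * (fourth_roots_count F)%:R :> R[i].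
Proof.
have [lam0 tE] := hyp_argument pF psi0 p2 p3 p7 pn pd.
rewrite (hyp_sum_points homega hTheta lam0 tE) num_pointsE chart_count_strata.
have qn : #|F|%:R = #|F|.-1%:R + 1 :> R[i] by rewrite natr1 -cardF_succ.
rewrite !natrD !natrM qn; ring.
Qed.

End LocalCount.

Lemma num_points_le (F : finFieldType) (psi : F) : (num_points psi <= 6 * #|F| ^ 2)%N.
Proof.
rewrite num_pointsE; have := chart_count_le (- (36 * psi)).
have := finNzRing_gt1 F; move: (#|F|) (chart_count _) => q T q1 h.
have : (q <= q ^ 2)%N by rewrite -[leqLHS]expn1 leq_pexp2l // ltnW.
have : (1 <= q ^ 2)%N by rewrite expn_gt0 ltnW.
move: (q ^ 2)%N h q1 => Q; lia.
Qed.

Section LocalFactor.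
Variable R : realType.
Local Notation C := R[i].

Lemma seriesC_cvg (a : nat -> C) l : cvgC (fun n => \sum_(1 <= m < n) a m) l -> seriesC a = l.
Proof. exact: limC_cvg. Qed.

Variables (p : nat) (N : nat -> nat) (H : nat -> C) (eps T : C).
Hypothesis p0 : (0 < p)%N.
Hypothesis eps1 : eps ^+ 2 = 1.
Hypothesis hT : normR T * p%:R ^+ 2 < 1.
Hypothesis NH : forall m, (0 < m)%N -> (N m)%:R =
  H m + 1 + (p ^ m)%:R ^+ 2 + (p ^ m)%:R * (2 * (1 + eps ^+ m)).
Hypothesis Nle : forall m, (0 < m)%N -> (N m <= 6 * (p ^ m) ^ 2)%N.

Lemma normR_eps : normR eps = 1.
Proof.
have : normR eps ^+ 2 = 1 by rewrite -normRX eps1 normR1.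
by move/eqP; rewrite sqrf_eq1 => /orP[/eqP //|/eqP h]; have := normR_ge0 eps; rewrite h; lra.
Qed.

Lemma N_series_cvg : exists l, cvgC (fun n => \sum_(1 <= m < n) (N m)%:R * T ^+ m / m%:R) l.
Proof.
apply: summableC_cvg; pose rho := normR T * p%:R ^+ 2.
have r0 : 0 <= rho by rewrite mulr_ge0 ?normR_ge0 // exprn_ge0.
exists (6 * (rho / (1 - rho))) => n.
apply: le_trans (_ : 6 * \sum_(1 <= m < n) rho ^+ m <= _); last first.
  by rewrite ler_wpM2l // geom_le // r0.
rewrite mulr_sumr big_nat_cond [leRHS]big_nat_cond; apply: ler_sum => m /andP[/andP[m1 _] _].
rewrite !normRM normRX normRV !normR_nat ler_pdivrMr ?ltr0n //.
apply: le_trans (_ : 6 * rho ^+ m <= _); last first.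
  by rewrite ler_peMr ?ler1n // mulr_ge0 // exprn_ge0.
rewrite /rho exprMn mulrCA mulrC ler_wpM2l ?exprn_ge0 ?normR_ge0 //.
have := Nle m1; rewrite -(ler_nat R) => h; apply: le_trans h _.
by rewrite natrM !natrX -!exprM mulnC.
Qed.

(** Taking logarithms term by term, convergence of the series of [H] follows from that of [N] and of
    four logarithm series. The factors $1-T$ and $1-p^2T$ cancel; the remaining $1-pT$ becomes the
    inverse of the factor of $\zeta_S(s-1)$ in the relative $L$-function. *)
Lemma local_identity :
  (surface_factor N p T)^-1 =
  (1 - p%:R * T) * (((1 - p%:R * T)^-1 * (1 - eps * (p%:R * T))^-1) ^+ 2) *
  (expC (- seriesC (fun m => H m * T ^+ m / m%:R)))^-1.
Proof.
have p1 : 1 <= p%:R :> R by rewrite ler1n.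
have T0 := normR_ge0 T.
have z2 : normR (p%:R ^+ 2 * T) < 1 by rewrite normRM normRX normR_nat mulrC.
have z1 : normR (p%:R * T) < 1.
  rewrite normRM normR_nat; apply: le_lt_trans hT; rewrite mulrC ler_wpM2l //.
  by rewrite -[leLHS]expr1 ler_weXn2l.
have z0 : normR T < 1.
  apply: le_lt_trans hT; rewrite -[leLHS]mulr1 ler_wpM2l //.
  by rewrite -[leLHS](expr0 p%:R) ler_weXn2l.
have ze : normR (eps * (p%:R * T)) < 1 by rewrite normRM normR_eps mul1r.
have [LN hN] := N_series_cvg.
have [L2 h2 e2] := logC_exists z2.
have [L1 h1 e1] := logC_exists z1.
have [L0 h0 e0] := logC_exists z0.
have [Le he ee] := logC_exists ze.
have hm1 : cvgC (fun=> -1 : C) (-1) by exact: (@cvgC_cst R (-1)).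
have hm2 : cvgC (fun=> -2 : C) (-2) by exact: (@cvgC_cst R (-2)).
have hH : cvgC (fun n => \sum_(1 <= m < n) H m * T ^+ m / m%:R)
   (LN + -1 * L2 + -1 * L0 + -2 * L1 + -2 * Le).
  have := cvgCD (cvgCD (cvgCD (cvgCD hN (cvgCM hm1 h2)) (cvgCM hm1 h0)) (cvgCM hm2 h1)) (cvgCM hm2 he).
  congr cvgC; apply/funext => n; rewrite /logsum !mulr_sumr -!big_split /=.
  apply: eq_big_nat => m /andP[m0 _]; rewrite NH // !natrX !exprMn -!exprM exprM.
  by move: (m%:R^-1) (T ^+ m) (p%:R ^+ m) (eps ^+ m) (H m) => *; ring.
rewrite /surface_factor (seriesC_cvg hN) invrK.
move: hH; set LH := (_ + -2 * Le) => hH.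
have LNE : LN = LH + (L2 + L0 + (L1 + L1) + (Le + Le)) by rewrite /LH; ring.
rewrite (seriesC_cvg hH) expCN invrK LNE !expCD e0 e1 e2 ee.
have nz (z : C) : normR z < 1 -> 1 - z != 0.
  by move=> hz; rewrite subr_eq0; apply: contraTneq hz => <-; rewrite normR1 ltxx.
have := nz _ z2; have := nz _ z1; have := nz _ z0; have := nz _ ze.
move: (expC LH) => E n1 n2 n3 n4; field.
by rewrite n1 n2 n3 n4.
Qed.

End LocalFactor.

Lemma sqr_mod8 p : odd p -> (8 %| (p ^ 2).-1)%N.
Proof.
move=> op; have : odd (p %% 8) by rewrite odd_mod.
rewrite -subn1 -eqn_mod_dvd ?expn_gt0 ?odd_gt0 // -modnXm.
by move: (ltn_pmod p (isT : 0 < 8)%N); case: (p %% 8)%N => [|[|[|[|[|[|[|[|]]]]]]]].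
Qed.

Lemma pow_mod8 p m : odd p ->
  (8 %| (p ^ m).-1)%N = ((8 %| p.-1)%N || ~~ odd m).
Proof.
move=> op; have p0 := odd_gt0 op.
have dE k : (0 < k)%N -> (8 %| k.-1)%N = (k == 1 %[mod 8])%N.
  by move=> k0; rewrite -subn1 -eqn_mod_dvd.
have sq : (p ^ 2 = 1 %[mod 8])%N by apply/eqP; rewrite -dE ?expn_gt0 ?p0 // sqr_mod8.
rewrite !dE ?expn_gt0 ?p0 // -[X in (p ^ X)%N](odd_double_half m) expnD -mul2n expnM.
rewrite -modnMmr -modnXm sq modnXm exp1n modnMmr muln1.
by case: (odd m) => /=; rewrite ?expn1 ?expn0 ?eqxx ?orbT ?orbF.
Qed.

Section Eps.
Variable R : realType.
Definition eps8 (p : nat) : R[i] := if (8 %| p.-1)%N then 1 else -1.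

Lemma eps8_sqr p : eps8 p ^+ 2 = 1.
Proof. by rewrite /eps8; case: ifP; rewrite ?expr1n ?sqrrN ?expr1n. Qed.

Lemma fourth_roots_eps (F : finFieldType) p m : odd p -> #|F| = (p ^ m)%N -> 2 != 0 :> F ->
  (fourth_roots_count F)%:R = 2 * (1 + eps8 p ^+ m).
Proof.
move=> op qE t0; rewrite card_fourth_roots // qE pow_mod8 // /eps8.
case: (8 %| p.-1)%N => /=; first by rewrite expr1n; ring.
rewrite -signr_odd; case: (odd m) => /=; first by rewrite expr1 subrr mulr0.
by rewrite expr0; ring.
Qed.
End Eps.

Section GoodPrimes.
Variables (t : rat) (p : nat).
Hypothesis pp : prime p.
Hypothesis pS : ~~ bad_primes (t) p.

Lemma good_prime_spec : odd p /\ [/\ ~~ (p %| 2)%N, ~~ (p %| 3)%N, ~~ (p %| 7)%N,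
  ~~ (p %| `|numq (t)|)%N & ~~ (p %| `|denq (t)|)%N].
Proof.
move: pS; rewrite /bad_primes pp /= !inE => /norP[/norP[n2 /norP[n3 n7]] /norP[hn /norP[hd _]]].
split; first by case: (even_prime pp) => // e; rewrite e eqxx in n2.
by split => //; rewrite dvdn_prime2.
Qed.

Lemma pchar_of_card (F : finFieldType) m : #|F| = (p ^ m)%N -> p \in [pchar F].
Proof. by move=> h; apply: (@card_finPcharP F p m). Qed.
End GoodPrimes.

(** * Assembly of the Euler products *)

Section EulerConvergence.
Variable R : realType.
Local Notation C := R[i].

Lemma euler_product_cvg (S : pred nat) (w : nat -> C) (x : R) : 1 < x ->
  (forall p, prime p -> normR (w p) <= expR (- x * ln p%:R)) ->
  exists2 l, l != 0 &
    cvgC (fun n => \prod_(0 <= p < n | prime p && ~~ S p) (1 - w p)^-1) l.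
Proof.
(* Extending by 0 outside the good primes turns the Euler product into a product over all integers
   with extra factors 1. For primes, $|w_p|\le p^{-x}\le1/2$. *)
move=> x1 hw; pose u p : C := if prime p && ~~ S p then w p else 0.
have normR0 : normR 0 = 0 :> R by exact: (normR_nat R 0).
have [B hB] := zeta_bound x1.
have uB n : \sum_(1 <= m < n) normR (u m) <= B.
  apply: le_trans (hB n); apply: ler_sum => m _; rewrite /u.
  by case: ifP => [/andP[pm _]|_]; [exact: hw|rewrite normR0 expR_ge0].
have u2 n : normR (u n) <= 1 / 2.
  rewrite /u; case: ifP => [/andP[pm _]|_]; last by rewrite normR0 divr_ge0.
  apply: le_trans (hw n pm) _.
  have n2 : 2 <= n%:R :> R by rewrite ler_nat prime_gt1.
  have n0 : 0 < n%:R :> R by apply: lt_le_trans n2.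
  have l2 : ln 2 <= ln n%:R :> R by rewrite ler_ln ?posrE.
  have l0 : 0 <= ln 2 :> R by rewrite ln_ge0 // ler1n.
  rewrite div1r -[in leRHS](@lnK R 2) ?posrE // -expRN ler_expR.
  rewrite mulNr lerN2; apply: (le_trans l2).
  by apply: ler_peMl; [exact: le_trans l0 l2|exact: ltW].
have [l l0 hl] := prod_cvg u2 uB; exists l => //.
move: hl; congr cvgC; apply/funext => n; rewrite [RHS]big_mkcond.
case: n => [|n]; first by rewrite !big_geq.
rewrite [RHS]big_ltn //= mul1r; apply: eq_bigr => m _; rewrite /u.
by case: ifP; rewrite // subr0 invr1.
Qed.

End EulerConvergence.

(** Both splitting types in one formula: four primes of norm $p$ when $\epsilon=1$, and
    $(1-z^2)^{-2}=((1-z)(1+z))^{-2}$ when $\epsilon=-1$. The fields of order $p$ and $p^2$ supply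
    the 8-th roots of unity in the two cases. *)
Lemma zeta8_local_factor (R : realType) (K : fieldExtType rat) (zeta8 : K)
  (hz : 8.-primitive_root zeta8) (hK : <<1; zeta8>>%VS = fullv) (p : nat)
  (F1 F2 : finFieldType) (pp : prime p) (op : odd p)
  (h1 : #|F1| = p) (h2 : #|F2| = (p ^ 2)%N) (s : R[i]) :
  \big[*%R/1]_(P \in primes_above K p) (1 - natpowC (ideal_norm P) s)^-1 =
  ((1 - natpowC p s)^-1 / (1 - eps8 R p * natpowC p s)) ^+ 2.
Proof.
have p0 := prime_gt0 pp; rewrite /eps8; case: ifP => [h8|/negbT h8].
  have pF : p \in [pchar F1] by apply: (@pchar_of_card p pp F1 1); rewrite expn1.
  have [r rP] : exists r : F1, 8.-primitive_root r by apply: finField_prim8; rewrite h1.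
  by rewrite (split_factor hz hK pF rP s h1 h8) mul1r -expr2 -exprM.
have pF : p \in [pchar F2] by exact: (pchar_of_card pp h2).
have [r rP] : exists r : F2, 8.-primitive_root r.
  by apply: finField_prim8; rewrite h2 sqr_mod8.
rewrite (inert_factor hz hK pF rP s h2 op h8) natpowCX //; congr (_ ^+ 2).
by rewrite mulN1r opprK -invfM; congr _^-1; ring.
Qed.

Unset Implicit Arguments.
Set Strict Implicit.
Set Printing Implicit Defensive.

Theorem theorem6p6 (R : realType)
  (Fq : nat -> nat -> finFieldType)
  (hFq : forall p m, prime p -> odd p -> (0 < m)%N -> #|Fq p m| = (p ^ m)%N)
  (omega Theta : forall p m, Fq p m -> R[i])
  (homega : forall p m, prime p -> odd p -> (0 < m)%N ->
     mult_char_generator (omega p m))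
  (hTheta : forall p m, prime p -> odd p -> (0 < m)%N ->
     nontrivial_add_char (Theta p m))
  (K : fieldExtType rat) (zeta8 : K)
  (hzeta8 : 8.-primitive_root zeta8) (hK : <<1; zeta8>>%VS = fullv)
  (psi : rat) (hpsi0 : psi != 0) (hpsi1 : psi != 1)
  (s : R[i]) (hs : 2 < complex.Re s) :
  let t := param_t psi in
  let S := bad_primes t in
  L_surface S (fun p m => num_points (ratr psi : Fq p m)) s =
  L_rel S K (s - 1) * L_hyp S omega Theta alpha beta t s.
Proof.
move=> t S; set s' := s - 1; pose z p := natpowC p (- s').
have x1 : 1 < complex.Re s' by move: hs; rewrite /s' raddfB /=; lra.
have hz p : prime p -> normR (z p) <= expR (- complex.Re s' * ln p%:R).
  by move=> pp; rewrite /z normR_natpowC ?prime_gt0 // raddfN.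
have normR_eps8 p : normR (eps8 R p) = 1 by exact: normR_eps (eps8_sqr R p).
have hez p : prime p -> normR (eps8 R p * z p) <= expR (- complex.Re s' * ln p%:R).
  by move=> pp; rewrite normRM normR_eps8 mul1r; exact: hz.
(* The shift to $s-1$ is the substitution $T\mapsto pT$ in the local factors. *)
have zT p : prime p -> z p = p%:R * natpowC p (- s).
  by move=> pp; rewrite /z /s' opprB natpowCM natpowC1 // prime_gt0.
have [l1 l10 hl1] := euler_product_cvg S x1 hz.
have [l2 l20 hl2] := euler_product_cvg S x1 hez.
have zsmall p : prime p -> normR (z p) < 1.
  move=> pp; apply: le_lt_trans (hz p pp) _; rewrite expR_lt1 mulNr oppr_lt0 mulr_gt0 //.
    by apply: lt_trans x1.
  by rewrite ln_gt0 // ltr1n prime_gt1.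
have nz (w : R[i]) : normR w < 1 -> 1 - w != 0.
  by move=> hw; rewrite subr_eq0; apply: contraTneq hw => <-; rewrite normR1 ltxx.
have z1 p : prime p -> 1 - z p != 0 by move=> pp; apply: nz; exact: zsmall.
have ez1 p : prime p -> 1 - eps8 R p * z p != 0.
  by move=> pp; apply: nz; rewrite normRM normR_eps8 mul1r zsmall.
pose kf p := ((1 - z p)^-1 / (1 - eps8 R p * z p)) ^+ 2.
pose Pz n := \prod_(0 <= p < n | prime p && ~~ S p) (1 - z p)^-1.
pose Pe n := \prod_(0 <= p < n | prime p && ~~ S p) (1 - eps8 R p * z p)^-1.
have Pz0 n : Pz n != 0.
  rewrite prodf_seq_neq0; apply/allP => p _; apply/implyP => /andP[pp _].
  by rewrite invr_eq0 z1.
have Pe0 n : Pe n != 0.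
  rewrite prodf_seq_neq0; apply/allP => p _; apply/implyP => /andP[pp _].
  by rewrite invr_eq0 ez1.
have zetaE : zetaS S s' = l1 by exact: limC_cvg hl1.
have zetaKE : zetaSK S K s' = (l1 * l2) ^+ 2.
  apply: limC_cvg; have := cvgCM (cvgCM hl1 hl2) (cvgCM hl1 hl2); rewrite -expr2.
  congr cvgC; apply/funext => n; rewrite -!big_split /=; apply: eq_bigr => p /andP[pp pS].
  have [op _] := good_prime_spec pp pS.
  have h1 : #|Fq p 1| = p by rewrite hFq // expn1.
  by rewrite (zeta8_local_factor hzeta8 hK pp op h1 (hFq p 2 pp op isT)) -expr2.
rewrite /L_rel zetaKE zetaE /L_surface /euler_product /L_hyp /euler_product.
pose h p := (hyp_factor (omega p) (Theta p) alpha beta t (natpowC p (- s)))^-1.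
have key p : prime p -> ~~ S p ->
  (surface_factor (fun m => num_points (ratr psi : Fq p m)) p (natpowC p (- s)))^-1 =
  (1 - z p) * kf p * h p.
  move=> pp pS; have [op [p2 p3 p7 pn pd]] := good_prime_spec pp pS.
  have p0 := prime_gt0 pp.
  rewrite /kf zT //; apply: (local_identity p0 (eps8_sqr R p)).
  (* $|T|p^2=p^{2-\mathrm{Re}\,s}<1$. *)
  - have lp : 0 < ln p%:R :> R by rewrite ln_gt0 // ltr1n prime_gt1.
    have -> : p%:R ^+ 2 = expR (2 * ln p%:R) :> R.
      by rewrite expRM_natl lnK // posrE ltr0n.
    rewrite normR_natpowC // -expRD expR_lt1 raddfN -mulrDl pmulr_llt0 //= addrC subr_lt0.
    exact: hs.
  - move=> m m0; have cF := hFq p m pp op m0.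
    have pF := pchar_of_card pp cF.
    have two0 : 2 != 0 :> Fq p m by rewrite (natk_neq0 pF).
    rewrite -(fourth_roots_eps R op cF two0) -cF.
    refine (num_points_hyp_sum pF _ _ hpsi0 p2 p3 p7 pn pd).
      exact: homega.
    exact: hTheta.
  - move=> m m0; rewrite -(hFq p m pp op m0); exact: num_points_le.
(* The partial products of the relative $L$-function: nonzero with nonzero limit, so they can be
   taken out of the limit whether or not the product for [H] converges. *)
pose u n := (Pz n * Pe n) ^+ 2 / Pz n.
have u0 n : u n != 0 by rewrite /u mulf_neq0 ?expf_neq0 ?mulf_neq0 ?invr_eq0.
have ul : cvgC u ((l1 * l2) ^+ 2 / l1).
  have := cvgCM (cvgCM (cvgCM hl1 hl2) (cvgCM hl1 hl2)) (cvgCV l10 hl1).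
  by rewrite -expr2; congr cvgC; apply/funext => n; rewrite -expr2.
have l0 : (l1 * l2) ^+ 2 / l1 != 0 by rewrite mulf_neq0 ?expf_neq0 ?mulf_neq0 ?invr_eq0.
rewrite -(limCM_nz (fun n => \prod_(0 <= p < n | prime p && ~~ S p) h p) l0 u0 ul); apply: limC_ext => n.
rewrite /u /Pz /Pe expr2 -prodfV -!big_split /=; apply: eq_bigr => p /andP[pp pS].
rewrite key // /kf invrK; ring.
Qed.
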